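(* Let $d_c := \frac{1}{h}\tan^{-1}\frac{h}{L_{\mathrm H}}$. Then the following hold. (1) If $d\le d_c$, then $0$ is the unique critical point of the energy $E$ on $H^1_{\mathrm P}(\Omega)$. (2) If $d>d_c$, then there is a unique positive least-energy solution of the boundary value problem (SG). (3) If $d>d_c$, then the least-energy solution obtained in (2) depends only on the variable $x_3$.
   Context: Fix constants $d,h,L_{\mathrm H}>0$. $\Omega=\mathbb T^2\times(0,d)$, where $\mathbb T^2$ is the flat torus (period 1 in $x_1$ and $x_2$) and $x_3\in(0,d)$; $\mathrm H=\{x_3=0\}$, $\mathrm P=\{x_3=d\}$; $\nu$ is the outer unit normal. $H^1_{\mathrm P}(\Omega)$ is the space of functions in $H^1(\Omega)$ with zero trace on $\mathrm P$. (SG) is the boundary value problem $$-\Delta\phi=h^2\sin\phi\cos\phi\ \text{ in }\Omega,\qquad \phi=0\ \text{ on }\mathrm P,\qquad \partial_\nu\phi=L_{\mathrm H}\sin\phi\cos\phi\ \text{ on }\mathrm H.$$ Its solutions are the critical points on $H^1_{\mathrm P}(\Omega)$ of $$E[\phi]:=\int_\Omega \tfrac12|\nabla\phi|^2+\tfrac{h^2}{4}(\cos2\phi+1)+\frac{L_{\mathrm H}}{4}\int_{\mathrm H}(\cos2\phi+1).$$ A least-energy solution is a solution of (SG) which is a global minimizer of $E$ in $H^1_{\mathrm P}(\Omega)$; it is positive if it is strictly positive on $\Omega\cup\mathrm H$. *)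

(* Defs.v *)
From HB Require Import structures.
From mathcomp Require Import all_boot all_order all_algebra.
From mathcomp Require Import all_classical all_reals all_analysis.

Set Implicit Arguments.
Unset Strict Implicit.
Unset Printing Implicit Defensive.

Import Order.TTheory GRing.Theory Num.Theory.
Import numFieldNormedType.Exports.

Local Open Scope classical_set_scope.
Local Open Scope ring_scope.

(* A point of T^2 x R is represented by a triple ((x1, x2), x3), and a function
   on T^2 (resp. T^2 x R) by a function that is 1-periodic in x1 and x2.
   Integrals over T^2 are integrals over the unit cell [0, 1)^2. *)
Notation plane R := (R * R)%type.
Notation space R := (R * R * R)%type.

Section torus.
Context {R : realType}.

Definition area : {measure set (measurableTypeR R * measurableTypeR R) -> \bar R} :=
  (@lebesgue_measure R \x @lebesgue_measure R)%E.

Definition vol : {measure set (measurableTypeR R * measurableTypeR R *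
                               measurableTypeR R) -> \bar R} :=
  (area \x @lebesgue_measure R)%E.

Definition cell : set (plane R) := `[0, 1[%classic `*` `[0, 1[%classic.

Definition Omega (d : R) : set (space R) := cell `*` `]0, d[%classic.

Definition periodic2 (t : plane R -> R) : Prop :=
  forall a b, t (a + 1, b) = t (a, b) /\ t (a, b + 1) = t (a, b).

Definition periodic3 (u : space R -> R) : Prop :=
  forall a b c, u (a + 1, b, c) = u (a, b, c) /\ u (a, b + 1, c) = u (a, b, c).

Definition square_integrable {dd} {T : measurableType dd}
    (mu : {measure set T -> \bar R}) (D : set T) (f : T -> R) : Prop :=
  f \_ D \in Lfun mu 2%:E.

Definition L2norm {dd} {T : measurableType dd}
    (mu : {measure set T -> \bar R}) (D : set T) (f : T -> R) : \bar R :=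
  'N[mu]_2%:E[EFin \o (f \_ D)].

Definition L2Omega (d : R) (u : space R -> R) : Prop :=
  periodic3 u /\ square_integrable vol (Omega d) u.

Definition L2T2 (t : plane R -> R) : Prop :=
  periodic2 t /\ square_integrable area cell t.

Definition basis3 (i : 'I_3) : space R :=
  ((val i == 0)%:R, (val i == 1)%:R, (val i == 2)%:R).

Definition partial (i : 'I_3) (u : space R -> R) : space R -> R :=
  fun x => 'D_(basis3 i) u x.

Definition C1 (u : space R -> R) : Prop :=
  [/\ periodic3 u, (forall x, differentiable u x) &
      (forall i, continuous (partial i u))].

(* C^1 functions with compact support in T^2 x (0, d): only x3 has to be kept
   away from the boundary. *)
Definition test_function (d : R) (psi : space R -> R) : Prop :=
  C1 psi /\ exists a b : R, [/\ 0 < a, b < d &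
    forall x, psi x != 0 -> a <= x.2 <= b].

Definition is_weak_partial (d : R) (i : 'I_3) (u g : space R -> R) : Prop :=
  L2Omega d g /\ forall psi, test_function d psi ->
    \int[vol]_(x in Omega d) (u x * partial i psi x) =
    - \int[vol]_(x in Omega d) (g x * psi x).

Definition H1 (d : R) (u : space R -> R) : Prop :=
  L2Omega d u /\ forall i, exists g, is_weak_partial d i u g.

(* Unique up to null sets when it exists; it is only used under integrals. *)
Definition wpartial (d : R) (i : 'I_3) (u : space R -> R) : space R -> R :=
  xget (cst 0) [set g | is_weak_partial d i u g].

Definition H1_cvg (d : R) (u_ : nat -> space R -> R) (u : space R -> R) : Prop :=
  (L2norm vol (Omega d) (u_ n \- u) @[n --> \oo] --> 0%E) /\
  forall i, L2norm vol (Omega d) (partial i (u_ n) \- wpartial d i u)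
              @[n --> \oo] --> 0%E.

(* The trace on {x3 = s} (used for s = 0 and s = d) is the continuous extension
   to H^1 of the restriction operator on functions that are C^1 up to the
   boundary; t is the trace of u when (u, t) is in the closure of its graph. *)
Definition is_trace (d s : R) (u : space R -> R) (t : plane R -> R) : Prop :=
  L2T2 t /\ exists u_ : nat -> space R -> R,
    [/\ forall n, C1 (u_ n), H1_cvg d u_ u &
        L2norm area cell (fun p => u_ n (p, s) - t p) @[n --> \oo] --> 0%E].

Definition trace (d s : R) (u : space R -> R) : plane R -> R :=
  xget (cst 0) [set t | is_trace d s u t].

Definition H1P (d : R) (u : space R -> R) : Prop :=
  H1 d u /\ is_trace d d u (cst 0).

Definition eq_Omega (d : R) (u v : space R -> R) : Prop :=
  ae_eq vol (Omega d) u v.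

Section sine_gordon.
Variables d h LH : R.
Implicit Types phi psi eta : space R -> R.

Definition energy phi : R :=
  \int[vol]_(x in Omega d)
     (2^-1 * (\sum_(i < 3) wpartial d i phi x ^+ 2)
      + h ^+ 2 / 4 * (cos (2 * phi x) + 1))
  + LH / 4 * \int[area]_(p in cell) (cos (2 * trace d 0 phi p) + 1).

Definition critical_point phi : Prop :=
  H1P d phi /\ forall eta, H1P d eta ->
    is_derive (0 : R) (1 : R)
      (fun t : R => energy (fun x => phi x + t * eta x)) (0 : R).

(* Weak formulation of
     - Laplacian phi = h^2 sin phi cos phi in Omega,
     phi = 0 on P,  d_nu phi = LH sin phi cos phi on H. *)
Definition SG_solution phi : Prop :=
  H1P d phi /\ forall eta, H1P d eta ->
    \int[vol]_(x in Omega d)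
       (\sum_(i < 3) wpartial d i phi x * wpartial d i eta x) =
    h ^+ 2 * (\int[vol]_(x in Omega d) (sin (phi x) * cos (phi x) * eta x))
    + LH * \int[area]_(p in cell)
        (sin (trace d 0 phi p) * cos (trace d 0 phi p) * trace d 0 eta p).

Definition least_energy_solution phi : Prop :=
  SG_solution phi /\ forall psi, H1P d psi -> energy phi <= energy psi.

(* phi is only defined up to null sets: strict positivity at every point of
   T^2 x [0, d) is that of its continuous representative. *)
Definition positive phi : Prop :=
  exists v : space R -> R,
    [/\ periodic3 v, {within [set x | 0 <= x.2 < d], continuous v},
        eq_Omega d phi v & forall x, 0 <= x.2 < d -> 0 < v x].

Definition positive_least_energy_solution phi : Prop :=
  least_energy_solution phi /\ positive phi.

Definition depends_only_on_x3 phi : Prop :=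
  exists f : R -> R, eq_Omega d phi (fun x => f x.2).

Definition critical_depth : R := h^-1 * atan (h / LH).

End sine_gordon.
End torus.

(* Main.v *)
From HB Require Import structures.
From mathcomp Require Import all_boot all_order all_algebra.
From mathcomp Require Import ring lra.
From mathcomp Require Import all_classical all_reals all_analysis.
From mathcomp Require Import measurable_realfun lebesgue_integral_under.
Require Import Defs.

(** The theorem rests on one inequality for functions u in H^1_P, proved without
    compactness or rearrangement (Jacobi). Suppose phi depends on the height
    x3 only, is positive on [0, d), and solves a linear problem
    phi'' = - kappa phi, phi'(0) = - lambda phi(0). Then
<<
      int_Omega kappa u^2 + lambda int_H u^2  <=  int_Omega (d_3 u)^2,
>>
    because with p = phi' / phi the difference is the integral of
    (d_3 u - p u)^2; the boundary term of Green's formula on P vanishes with u.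

    For d <= d_c the comparison function phi = sin (b - h x3), tan b = h / L_H,
    is positive on [0, d) and has kappa = h^2 and lambda = L_H. If u is a
    critical point, testing its equation with u itself gives
    int |grad u|^2 = h^2 int sin u cos u u + L_H int_H sin u cos u u. Since
    u sin u cos u <= u^2 with equality only for u = 0, Jacobi's inequality
    forces u = 0 (shallow_unique). That 0 is critical, and that critical
    points satisfy the weak equation, follows from a second-order expansion of
    the energy with a quadratic remainder (energy_expansion).

    For d > d_c the one-dimensional problem has a solution f with
    0 < f < pi / 2 on [0, d) (vertical_profile). The first integral
    f'^2 + h^2 sin^2 f reduces it to a quadrature: a solution starting at
    f(0) = arcsin b with the boundary condition on H reaches 0 at the height
    time_map b. This function is continuous, equals d_c at b = 0 and tends to
    infinity as b tends to 1, so that it takes the value d.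

    The profile f solves a linear problem of the kind above, with
    kappa = h^2 sin f cos f / f and the analogous lambda. Jacobi's inequality
    therefore bounds the energy of any u from below by the integral of a
    pointwise function of u and f, namely half of
    h^2 ((sin f cos f / f) u^2 + cos^2 u), and its analogue on H. As
    sin f cos f / f decreases in f, this function is minimal exactly at
    |u| = f (gap_ge0, gap_eq0), where the bound is the energy of f. Hence f is
    a minimizer, every minimizer has the absolute value f almost everywhere,
    and a positive one coincides with f: this gives existence, uniqueness and
    the dependence on x3 alone (profile_minimizes, minimizer_abs).

    Weak derivatives being defined by duality and traces by density, some
    preparation is needed: weak derivatives are unique almost everywhere
    (weak_partial_unique), functions in H^1_P have a unique trace on H
    (trace_exists, trace_unique), and Green's formula in the vertical
    direction holds in H^1 (green). *)

Set Implicit Arguments.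
Unset Strict Implicit.
Unset Printing Implicit Defensive.

Import Order.TTheory GRing.Theory Num.Theory.
Import numFieldNormedType.Exports.

Local Open Scope classical_set_scope.
Local Open Scope ring_scope.

(** * Square integrable functions *)

Section L2.
Context dd (T : measurableType dd) {R : realType}.
Variable mu : {measure set T -> \bar R}.
Variable D : set T.
Hypothesis mD : measurable D.
Implicit Types (f g c : T -> R).

Local Notation rint f := (mu.-integrable D (EFin \o f)).

(** Square integrability in terms of real-valued integrals; square_integrableP
    and L2norm_cvg0 translate from the norm. *)
Definition L2 f := measurable_fun D f /\ rint (fun x => f x ^+ 2).

Lemma rint_measurable f : rint f -> measurable_fun D f.
Proof. by move=> /measurable_int/measurable_EFinP. Qed.

Lemma rint_le f g : measurable_fun D f -> rint g ->
  (forall x, D x -> `|f x| <= g x) -> rint f.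
Proof.
move=> mf ig fg; apply: (le_integrable mD _ _ ig); first exact/measurable_EFinP.
move=> x Dx /=; rewrite lee_fin (le_trans (fg x Dx))//; exact: ler_norm.
Qed.

Lemma rintD f g : rint f -> rint g -> rint (fun x => f x + g x).
Proof.
move=> fi gi; have := integrableD mD fi gi.
by apply: eq_integrable => // x _ /=; rewrite EFinD.
Qed.

Lemma rintZ (k : R) f : rint f -> rint (fun x => k * f x).
Proof.
move=> fi; have := integrableZl mD k fi.
by apply: eq_integrable => // x _ /=; rewrite EFinM.
Qed.

Lemma rintN f : rint f -> rint (fun x => - f x).
Proof.
move=> fi; have := integrableN fi.
by apply: eq_integrable => // x _ /=; rewrite EFinN.
Qed.

Lemma rintB f g : rint f -> rint g -> rint (fun x => f x - g x).
Proof. by move=> fi /rintN gi; exact: rintD. Qed.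

Lemma L2_mul f g : L2 f -> L2 g -> rint (fun x => f x * g x).
Proof.
move=> [mf f2] [mg g2]; apply: (rint_le _ (rintD f2 g2)).
  exact: measurable_funM.
move=> x _; rewrite normrM -(real_normK (num_real (f x))) -(real_normK (num_real (g x))).
have := sqr_ge0 (`|f x| - `|g x|); have := sqr_ge0 (`|f x|); have := sqr_ge0 (`|g x|).
nra.
Qed.

Lemma L2D f g : L2 f -> L2 g -> L2 (fun x => f x + g x).
Proof.
move=> lf lg; have [mf f2] := lf; have [mg g2] := lg.
split; first exact: measurable_funD.
have := rintD (rintD f2 g2) (rintZ 2 (L2_mul lf lg)).
by apply: eq_integrable => // x _ /=; congr EFin; ring.
Qed.

Lemma L2_bM c f (M : R) : measurable_fun D c ->
  (forall x, D x -> `|c x| <= M) -> L2 f -> L2 (fun x => c x * f x).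
Proof.
move=> mc cM [mf f2]; split; first exact: measurable_funM.
apply: (rint_le _ (rintZ (M ^+ 2) f2)).
  by apply: measurable_funX; exact: measurable_funM.
move=> x Dx; rewrite normrX normrM exprMn -[f x ^+ 2]ger0_norm ?sqr_ge0// normrX.
by rewrite ler_wpM2r ?exprn_ge0// lerXn2r ?nnegrE// ?cM// (le_trans (normr_ge0 _) (cM _ Dx)).
Qed.

Lemma L2Z (k : R) f : L2 f -> L2 (fun x => k * f x).
Proof. by apply: (@L2_bM (cst k) f `|k|) => //; exact: measurable_cst. Qed.

Lemma L2N f : L2 f -> L2 (fun x => - f x).
Proof.
move=> lf; have := L2Z (-1) lf.
by rewrite (_ : (fun x => _) = (fun x => - f x))//; apply/funext => x; rewrite mulN1r.
Qed.

Lemma L2B f g : L2 f -> L2 g -> L2 (fun x => f x - g x).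
Proof. by move=> lf /L2N lg; exact: L2D. Qed.

Lemma rint_sum (I : Type) (r : seq I) (F : I -> T -> R) :
  (forall i, rint (F i)) -> rint (fun x => \sum_(i <- r) F i x).
Proof.
move=> LF; elim: r => [|i r IH].
  rewrite (_ : (EFin \o _) = cst 0%E); first exact: integrable0.
  by apply/funext => x /=; rewrite big_nil.
rewrite (_ : (EFin \o _) = EFin \o (fun x => F i x + \sum_(i <- r) F i x)); first exact: rintD.
by apply/funext => x /=; rewrite big_cons.
Qed.

(** The quadratic polynomial t |-> ||t f + g||^2 is nonnegative, so its
    discriminant is not positive. *)
Lemma Cauchy_Schwarz f g : L2 f -> L2 g ->
  (\int[mu]_(x in D) (f x * g x)) ^+ 2 <=
  (\int[mu]_(x in D) (f x ^+ 2)) * \int[mu]_(x in D) (g x ^+ 2).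
Proof.
move=> lf lg; set A := \int[mu]_(x in D) (f x ^+ 2); set C := \int[mu]_(x in D) (g x ^+ 2).
set B := \int[mu]_(x in D) (f x * g x).
have A0 : 0 <= A by apply: Rintegral_ge0 => x _; exact: sqr_ge0.
have C0 : 0 <= C by apply: Rintegral_ge0 => x _; exact: sqr_ge0.
have q t : 0 <= t ^+ 2 * A + 2 * t * B + C.
  rewrite -!RintegralZl//; [|exact: L2_mul|exact: lf.2].
  rewrite -RintegralD//; [|exact: rintZ lf.2|exact/rintZ/L2_mul].
  rewrite -RintegralD//; last exact: lg.2.
    apply: Rintegral_ge0 => x _; rewrite (_ : _ + _ = (t * f x + g x) ^+ 2) ?sqr_ge0//.
    by ring.
  by apply: rintD; [exact: rintZ lf.2|exact/rintZ/L2_mul].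
move: A0; rewrite le_eqVlt => /predU1P[A0|A0].
  suff -> : B = 0 by rewrite expr0n/= mulr_ge0// -A0.
  apply/eqP/negPn/negP => B0; have := q (- (C + 1) / (2 * B)).
  rewrite -A0 mulr0 add0r (_ : 2 * _ * B = - (C + 1)); last by field.
  by lra.
have := q (- B / A).
rewrite (_ : _ + _ + _ = (A * C - B ^+ 2) / A); last by field; rewrite gt_eqF.
by rewrite pmulr_lge0 ?invr_gt0// subr_ge0.
Qed.

Definition cvgL2 (u_ : nat -> T -> R) f :=
  [/\ forall n, L2 (u_ n), L2 f &
      \int[mu]_(x in D) (u_ n x - f x) ^+ 2 @[n --> \oo] --> 0].

Lemma cvg0_Cauchy_Schwarz (a b : nat -> T -> R) (c : R) :
  (forall n, L2 (a n)) -> (forall n, L2 (b n)) ->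
  \int[mu]_(x in D) (a n x ^+ 2) @[n --> \oo] --> c ->
  \int[mu]_(x in D) (b n x ^+ 2) @[n --> \oo] --> 0 ->
  \int[mu]_(x in D) (a n x * b n x) @[n --> \oo] --> 0.
Proof.
move=> la lb ac b0.
have h : Num.sqrt ((\int[mu]_(x in D) (a n x ^+ 2)) * \int[mu]_(x in D) (b n x ^+ 2))
    @[n --> \oo] --> 0.
  rewrite -(sqrtr0 R); apply: continuous_cvg; first exact: sqrt_continuous.
  by rewrite -(mulr0 c); exact: cvgM.
apply/norm_cvg0P; apply: (squeeze_cvgr _ (cvg_cst 0) h).
near=> n; rewrite normr_ge0/= -sqrtr_sqr ler_wsqrtr//.
exact: Cauchy_Schwarz.
Unshelve. all: by end_near. Qed.

(** Integrals of products pass to the limit: expand u v - f g and apply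
    Cauchy-Schwarz to each term. *)
Lemma cvgL2_mul (u_ v_ : nat -> T -> R) f g : cvgL2 u_ f -> cvgL2 v_ g ->
  \int[mu]_(x in D) (u_ n x * v_ n x) @[n --> \oo] --> \int[mu]_(x in D) (f x * g x).
Proof.
move=> [lu lf uf] [lv lg vg].
have lud n : L2 (fun x => u_ n x - f x) by exact: L2B.
have lvd n : L2 (fun x => v_ n x - g x) by exact: L2B.
have h1 : \int[mu]_(x in D) ((u_ n x - f x) * (v_ n x - g x)) @[n --> \oo] --> 0.
  exact: cvg0_Cauchy_Schwarz uf vg.
have h2 : \int[mu]_(x in D) (f x * (v_ n x - g x)) @[n --> \oo] --> 0.
  by apply: (cvg0_Cauchy_Schwarz _ lvd (cvg_cst (\int[mu]_(x in D) (f x ^+ 2)))).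
have h3 : \int[mu]_(x in D) (g x * (u_ n x - f x)) @[n --> \oo] --> 0.
  by apply: (cvg0_Cauchy_Schwarz _ lud (cvg_cst (\int[mu]_(x in D) (g x ^+ 2)))).
have h4 := cvgD (cvgD (cvgD h1 h2) h3) (cvg_cst (\int[mu]_(x in D) (f x * g x))).
rewrite (_ : (fun n => _) = (fun n => \int[mu]_(x in D) ((u_ n x - f x) * (v_ n x - g x)) +
  \int[mu]_(x in D) (f x * (v_ n x - g x)) + \int[mu]_(x in D) (g x * (u_ n x - f x)) +
  \int[mu]_(x in D) (f x * g x))).
  by rewrite -[X in _ --> X]add0r -[X in _ --> X + _]addr0 -[X in _ --> X + _ + _]addr0; exact: h4.
apply/funext => n.
have i1 := L2_mul (lud n) (lvd n); have i2 := L2_mul lf (lvd n).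
have i3 := L2_mul lg (lud n); have i4 := L2_mul lf lg.
rewrite -RintegralD// -RintegralD//; last exact: rintD.
rewrite -RintegralD//; last by do 2?apply: rintD.
by apply: eq_Rintegral => x _; ring.
Qed.

Lemma cvgL2_bM c (u_ : nat -> T -> R) f (M : R) : measurable_fun D c ->
  (forall x, D x -> `|c x| <= M) -> cvgL2 u_ f ->
  cvgL2 (fun n x => c x * u_ n x) (fun x => c x * f x).
Proof.
move=> mc cM [lu lf uf]; split; [by move=> n; exact: L2_bM cM _|exact: L2_bM cM _|].
have h : M ^+ 2 * (\int[mu]_(x in D) (u_ n x - f x) ^+ 2) @[n --> \oo] --> 0.
  by rewrite -(mulr0 (M ^+ 2)); apply: cvgM => //; exact: cvg_cst.
apply: (squeeze_cvgr _ (cvg_cst 0) h); near=> n; apply/andP; split.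
  by apply: Rintegral_ge0 => x _; exact: sqr_ge0.
have lB : L2 (fun x => u_ n x - f x) by exact: L2B.
rewrite -RintegralZl//; last exact: lB.2.
apply: le_Rintegral => //.
- have := (L2_bM mc cM lB).2; apply: eq_integrable => // x _ /=.
  by congr EFin; ring.
- exact: rintZ lB.2.
- move=> x Dx; rewrite -mulrBr exprMn ler_wpM2r ?sqr_ge0//.
  rewrite -(real_normK (num_real (c x))) lerXn2r ?nnegrE ?cM//.
  exact: le_trans (cM _ Dx).
Unshelve. all: by end_near. Qed.

Lemma cvgL2D (u_ v_ : nat -> T -> R) f g : cvgL2 u_ f -> cvgL2 v_ g ->
  cvgL2 (fun n x => u_ n x + v_ n x) (fun x => f x + g x).
Proof.
move=> cu cv; have [lu lf uf] := cu; have [lv lg vg] := cv.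
have lud n : L2 (fun x => u_ n x - f x) by exact: L2B.
have lvd n : L2 (fun x => v_ n x - g x) by exact: L2B.
split; [by move=> n; exact: L2D|exact: L2D|].
have h : 2 * (\int[mu]_(x in D) (u_ n x - f x) ^+ 2 +
    \int[mu]_(x in D) (v_ n x - g x) ^+ 2) @[n --> \oo] --> 0.
  rewrite -(mulr0 2); apply: cvgM; first exact: cvg_cst.
  by rewrite -(addr0 0); exact: cvgD.
apply: (squeeze_cvgr _ (cvg_cst 0) h); near=> n; apply/andP; split.
  by apply: Rintegral_ge0 => x _; exact: sqr_ge0.
rewrite -RintegralD//; [|exact: (lud n).2|exact: (lvd n).2].
rewrite -RintegralZl//; last exact: rintD (lud n).2 (lvd n).2.
apply: le_Rintegral => //.
- exact: (L2B (L2D (lu n) (lv n)) (L2D lf lg)).2.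
- exact: rintZ (rintD (lud n).2 (lvd n).2).
- move=> x Dx; have := sqr_ge0 ((u_ n x - f x) - (v_ n x - g x)).
  set a := u_ n x; set b := v_ n x; nra.
Unshelve. all: by end_near. Qed.

Lemma cvgL2Z k (u_ : nat -> T -> R) f : cvgL2 u_ f -> cvgL2 (fun n x => k * u_ n x) (fun x => k * f x).
Proof. by apply: (@cvgL2_bM (cst k) u_ f `|k|) => //; exact: measurable_cst. Qed.

Lemma cvgL2B (u_ v_ : nat -> T -> R) f g : cvgL2 u_ f -> cvgL2 v_ g ->
  cvgL2 (fun n x => u_ n x - v_ n x) (fun x => f x - g x).
Proof.
move=> cu /(cvgL2Z (-1)) cv; have := cvgL2D cu cv.
by congr (cvgL2 _ _); [apply/funext => n|]; apply/funext => x; rewrite mulN1r.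
Qed.

Lemma cvgL2_cst f : L2 f -> cvgL2 (fun=> f) f.
Proof.
move=> lf; split => //; apply: cvg_near_cst; near=> n.
rewrite (@eq_Rintegral _ _ _ _ _ (cst 0)) => [|x _]; last by rewrite subrr expr0n.
by rewrite Rintegral_cst// mul0r.
Unshelve. all: by end_near. Qed.

Lemma ae_eq_L2 f g : ae_eq mu D f g -> measurable_fun D g -> L2 f -> L2 g.
Proof.
move=> fg mg [mf /integrableP[mf2 if2]]; split => //; apply/integrableP; split.
  by apply/measurable_EFinP; exact: measurable_funX.
apply: le_lt_trans if2; rewrite le_eqVlt; apply/orP; left; apply/eqP.
apply: ae_eq_integral => //.
- by apply: measurableT_comp => //; apply/measurable_EFinP; exact: measurable_funX.
- by apply: measurableT_comp.
- by apply: filterS fg => x /= fg Dx; rewrite fg.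
Qed.

Lemma eq_Rintegral_ae f g : measurable_fun D f -> measurable_fun D g ->
  ae_eq mu D f g -> \int[mu]_(x in D) f x = \int[mu]_(x in D) g x.
Proof.
move=> mf mg fg; congr fine; apply: ae_eq_integral => //; try exact/measurable_EFinP.
by apply: filterS fg => x /= fg Dx; rewrite fg.
Qed.

Lemma Rintegral_ge0_eq0 f : rint f -> (forall x, D x -> 0 <= f x) ->
  \int[mu]_(x in D) f x <= 0 -> ae_eq mu D f (cst 0).
Proof.
move=> fi f0 if0.
have e0 : (\int[mu]_(x in D) `|(f x)%:E| = 0)%E.
  rewrite (eq_integral (EFin \o f)) => [|x]; last first.
    by rewrite inE => Dx /=; rewrite ger0_norm// f0.
  rewrite -(fineK (integrable_fin_num mD fi)); congr EFin; apply/eqP.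
  by rewrite eq_le if0/=; exact: Rintegral_ge0.
have := ae_eq_integral_abs mu mD (measurable_int _ fi) .
move=> [+ _] => /(_ e0).
by apply: filterS => x h Dx; have [] := h Dx.
Qed.

Hypothesis fD : (mu D < +oo)%E.

Lemma rint_cst k : rint (cst k).
Proof.
apply/integrableP; split; first exact/measurable_EFinP/measurable_cst.
by rewrite /= integral_cst// lte_mul_pinfty.
Qed.

Lemma rint_bounded f (M : R) : measurable_fun D f -> (forall x, D x -> `|f x| <= M) -> rint f.
Proof. by move=> mf fM; apply: (rint_le mf (rint_cst M)). Qed.

Lemma L2_bounded f (M : R) : measurable_fun D f -> (forall x, D x -> `|f x| <= M) -> L2 f.
Proof.
move=> mf fM; split => //; apply: (@rint_bounded _ (M ^+ 2)); first exact: measurable_funX.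
by move=> x Dx; rewrite normrX lerXn2r ?nnegrE ?fM// (le_trans _ (fM _ Dx)).
Qed.

Lemma L2_cst k : L2 (cst k).
Proof. by apply: (@L2_bounded _ `|k|) => //; exact: measurable_cst. Qed.

Lemma L2_rint f : L2 f -> rint f.
Proof.
move=> lf; have := L2_mul lf (L2_cst 1); apply: eq_integrable => // x _ /=.
by rewrite mulr1.
Qed.

End L2.

Section L2_norm.
Context dd (T : measurableType dd) {R : realType}.
Variable mu : {measure set T -> \bar R}.
Variable D : set T.
Hypothesis mD : measurable D.
Implicit Types (f g : T -> R).

Lemma L2normE f : (L2norm mu D f = (\int[mu]_(x in D) (f x ^+ 2)%:E) `^ (2^-1))%E.
Proof.
rewrite /L2norm unlock; congr (_ `^ _)%E; rewrite [RHS]integral_mkcond.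
apply: eq_integral => x _; rewrite /= !patchE; case: ifPn => _.
  by rewrite powR_mulrn ?normr_ge0// real_normK ?num_real.
by rewrite normr0 powR0.
Qed.

Lemma square_integrableP f : square_integrable mu D f <-> L2 mu D f.
Proof.
split=> [lf|[mf f2]].
  have := Lfun2_integrable_sqr lf; move: lf; rewrite /square_integrable inE => /andP[].
  rewrite inE/= => mf _ i2; split; first by apply/(measurable_restrictT _ mD).
  apply/(integrable_mkcond _ mD); apply: eq_integrable i2 => // x _ /=.
  by rewrite !patchE; case: ifPn => //=; rewrite expr0n.
rewrite /square_integrable inE; apply/andP; split; rewrite inE/=.
  by apply/(measurable_restrictT _ mD).
rewrite /finite_norm -/(L2norm mu D f) L2normE; apply: poweR_lty.
exact: integrable_lty f2.
Qed.

Lemma L2norm_cvg0 (u_ : nat -> T -> R) f :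
  (forall n, L2 mu D (u_ n)) -> L2 mu D f ->
  (L2norm mu D (fun x => u_ n x - f x) @[n --> \oo] --> 0%E) <-> cvgL2 mu D u_ f.
Proof.
move=> lu lf.
have lB n : L2 mu D (fun x => u_ n x - f x) by exact: L2B.
pose I n := \int[mu]_(x in D) (u_ n x - f x) ^+ 2.
have I0 n : 0 <= I n by apply: Rintegral_ge0 => x _; exact: sqr_ge0.
have NE n : L2norm mu D (fun x => u_ n x - f x) = (I n `^ 2^-1)%:E.
  rewrite L2normE -poweR_EFin; congr (_ `^ _)%E.
  by rewrite fineK//; exact: integrable_fin_num (lB n).2.
have -> : (fun n => L2norm mu D (fun x => u_ n x - f x)) = EFin \o (fun n => I n `^ 2^-1).
  by apply/funext => n; rewrite NE.
have IE n : I n = (I n `^ 2^-1) ^+ 2.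
  by rewrite -powR_mulrn ?powR_ge0// -powRrM mulVf// powRr1.
split.
- move=> /fine_cvgP[_ h]; split => //; rewrite -/I.
  rewrite (_ : I = (fun n => I n `^ 2^-1 * I n `^ 2^-1)); last first.
    by apply/funext => n; rewrite {1}IE.
  by rewrite -(mulr0 0); apply: cvgM; exact: h.
- move=> [_ _ h]; apply/fine_cvgP; split; first by near=> n.
  rewrite (_ : fine \o _ = (fun n => Num.sqrt (I n))); last first.
    by apply/funext => n /=; rewrite powR12_sqrt.
  by rewrite -(sqrtr0 R); apply: continuous_cvg => //; exact: sqrt_continuous.
Unshelve. all: by end_near. Qed.

End L2_norm.

(** * Measurability of continuous functions and Fubini's theorem *)

Lemma continuous_curry1 (U V W : topologicalType) (f : U * V -> W) (y : V) :
  continuous f -> continuous (fun x => f (x, y)).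
Proof.
move=> cf x; apply: (@continuous_comp _ _ _ (fun z => (z, y)) f); last exact: cf.
by apply: cvg_pair; [exact: cvg_id|exact: cvg_cst].
Qed.

Lemma continuous_curry2 (U V W : topologicalType) (f : U * V -> W) (x : U) :
  continuous f -> continuous (fun y => f (x, y)).
Proof.
move=> cf y; apply: (@continuous_comp _ _ _ (fun z => (x, z)) f); last exact: cf.
by apply: cvg_pair; [exact: cvg_cst|exact: cvg_id].
Qed.

Section measurability.
Context {R : realType}.
Notation mR := (measurableTypeR R).

Let grid (n : nat) (y : R) : R := (Num.floor (y * n.+1%:R))%:~R / n.+1%:R.

Let grid_cvg (y : R) : grid n y @[n --> \oo] --> y.
Proof.
apply/cvgrPdist_le => /= e e0; near=> n.
have n0 : (0 : R) < n.+1%:R by [].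
have -> : y - grid n y = (y * n.+1%:R - (Num.floor (y * n.+1%:R))%:~R) / n.+1%:R.
  by rewrite /grid; field; rewrite gt_eqF.
rewrite normrM normfV (ger0_norm (ltW n0)) ger0_norm; last first.
  by rewrite subr_ge0 floor_le_tmp.
apply: (@le_trans _ _ (n.+1%:R^-1)).
  rewrite ler_piMl ?invr_ge0//; rewrite lerBlDl -[X in _ + X]/(1%:~R) -intrD.
  by rewrite ltW// floorD1_gt.
near: n; have := @cvg_harmonic R => /cvgrPdist_le /(_ _ e0); apply: filterS => n /=.
by rewrite sub0r normrN ger0_norm.
Unshelve. all: by end_near. Qed.

(** A function measurable in t and continuous in y is the pointwise limit of
    its values at y rounded down to a grid, which are measurable because they
    are countable gluings. Products of the real line carry here the product of
    two Borel algebras, so that this is how continuous functions of several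
    variables are seen to be measurable. *)
Lemma measurable_caratheodory dd (T : measurableType dd) (f : T * mR -> R) :
  (forall y, measurable_fun setT (fun t => f (t, y))) ->
  (forall t (y : R), (f (t, z) : R) @[z --> y] --> f (t, y)) ->
  measurable_fun setT f.
Proof.
move=> mf cf.
apply: (@measurable_fun_cvg _ _ _ setT (fun n z => f (z.1, grid n z.2))); last first.
  move=> [t y] _ /=; apply: (cvg_comp (grid ^~ y) (fun z => f (t, z))); first exact: grid_cvg.
  exact: cf.
move=> n _ B mB; rewrite setTI.
have -> : (fun z : T * mR => f (z.1, grid n z.2)) @^-1` B =
    \bigcup_(k : int) (((fun t => f (t, k%:~R / n.+1%:R)) @^-1` B) `*`
      ((fun y : mR => Num.floor (y * n.+1%:R)) @^-1` [set k])).
  apply/seteqP; split => [[t y] /= By|[t y] [k _ [/= Bt ek]]].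
    by exists (Num.floor (y * n.+1%:R)).
  by rewrite /grid ek.
apply: countable_bigcupT_measurable => // k; apply: measurableX.
  by rewrite -[X in measurable X]setTI; exact: mf.
rewrite (_ : _ @^-1` _ = `[k%:~R / n.+1%:R, (k + 1)%:~R / n.+1%:R[%classic).
  exact: measurable_itv.
apply/seteqP; split => y /=; rewrite in_itv/= ler_pdivrMr// ltr_pdivlMr//.
- by move=> <-; rewrite floor_le_tmp floorD1_gt.
- by move=> ?; exact: floor_def.
Qed.

Lemma continuous_measurable2 (f : R * R -> R) : continuous f ->
  measurable_fun setT (f : mR * mR -> mR).
Proof.
move=> cf; apply: measurable_caratheodory => [y|t y].
  exact: continuous_measurable_fun (@continuous_curry1 R R R f y cf).
exact: (@continuous_curry2 R R R f t cf).
Qed.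

Lemma continuous_measurable3 (f : R * R * R -> R) : continuous f ->
  measurable_fun setT (f : mR * mR * mR -> mR).
Proof.
move=> cf; apply: measurable_caratheodory => [y|t y].
  exact: continuous_measurable2 (@continuous_curry1 (R * R)%type R R f y cf).
exact: (@continuous_curry2 (R * R)%type R R f t cf).
Qed.

Lemma continuous_bounded_box (f : R * R * R -> R) (d : R) : continuous f ->
  exists M, forall a b c, 0 <= a <= 1 -> 0 <= b <= 1 -> 0 <= c <= d -> `|f (a, b, c)| <= M.
Proof.
move=> cf.
have K : compact ((`[0, 1] `*` `[0, 1]) `*` `[0, d] : set (R * R * R)).
  by apply: compact_setX; [apply: compact_setX|]; exact: segment_compact.
have cfK : compact (f @` ((`[0, 1] `*` `[0, 1]) `*` `[0, d] : set (R * R * R))).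
  by apply: continuous_compact => //; exact: continuous_subspaceT.
have [M [_ HM]] := compact_bounded cfK.
exists (M + 1) => a b c ha hb hc; apply: (HM (M + 1)); first by rewrite ltrDl.
by exists (a, b, c) => //=; rewrite !in_itv/=.
Qed.

End measurability.

Lemma sigma_finite_product d1 d2 (T1 : measurableType d1) (T2 : measurableType d2) (R : realType)
    (m1 : {sigma_finite_measure set T1 -> \bar R}) (m2 : {sigma_finite_measure set T2 -> \bar R}) :
  sigma_finite setT (m1 \x m2)%E.
Proof.
have /sigma_finiteP[F [TF ndF Foo]] := sigma_finiteT m1.
have /sigma_finiteP[G [TG ndG Goo]] := sigma_finiteT m2.
exists (fun n => F n `*` G n).
  rewrite -setXTT TF TG; apply/seteqP; split => [[x y] [[n _ Fx] [k _ Gy]]|[x y] [n _ [? ?]]].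
    exists (maxn n k) => //; split => /=.
    - have /subsetPset := ndF _ _ (leq_maxl n k); exact.
    - have /subsetPset := ndG _ _ (leq_maxr n k); exact.
  by split; exists n.
move=> k; have [? ?] := Foo k; have [? ?] := Goo k; split; first exact: measurableX.
by rewrite product_measure1E// lte_mul_pinfty// ge0_fin_numE.
Qed.

(** ** Fubini's theorem on a rectangle, for real-valued integrals *)
Section Fubini.
Context d1 d2 (T1 : measurableType d1) (T2 : measurableType d2) {R : realType}.
Variable m1 : {sigma_finite_measure set T1 -> \bar R}.
Variable m2 : {sigma_finite_measure set T2 -> \bar R}.
Variables (A : set T1) (B : set T2).
Hypotheses (mA : measurable A) (mB : measurable B).
Variable F : T1 * T2 -> R.
Hypothesis iF : ((m1 \x m2)%E).-integrable (A `*` B) (EFin \o F).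

Let iF' : ((m1 \x m2)%E).-integrable setT ((EFin \o F) \_ (A `*` B)).
Proof. by apply/(integrable_mkcond _ (measurableX mA mB)). Qed.

Let sec1 x : A x -> (fun y => ((EFin \o F) \_ (A `*` B)) (x, y)) = (fun y => (F (x, y))%:E) \_ B.
Proof.
move=> Ax; apply/funext => y; rewrite !patchE.
by have [By|By] := pselect (B y); [rewrite !mem_set|rewrite !memNset//= => -[]].
Qed.

Let sec2 y : B y -> (fun x => ((EFin \o F) \_ (A `*` B)) (x, y)) = (fun x => (F (x, y))%:E) \_ A.
Proof.
move=> By; apply/funext => x; rewrite !patchE.
by have [Ax|Ax] := pselect (A x); [rewrite !mem_set|rewrite !memNset//= => -[]].
Qed.

Let FE : fubini_F m2 ((EFin \o F) \_ (A `*` B)) =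
  (fun x => \int[m2]_(y in B) (F (x, y))%:E)%E \_ A.
Proof.
apply/funext => x; rewrite /fubini_F patchE; case: ifPn => Ax.
  by rewrite sec1 -?integral_mkcond//; exact: set_mem.
rewrite integral0_eq// => y _; rewrite patchE memNset//= => -[?].
by move: Ax; rewrite notin_setE.
Qed.

Let GE : fubini_G m1 ((EFin \o F) \_ (A `*` B)) =
  (fun y => \int[m1]_(x in A) (F (x, y))%:E)%E \_ B.
Proof.
apply/funext => y; rewrite /fubini_G patchE; case: ifPn => By.
  by rewrite sec2 -?integral_mkcond//; exact: set_mem.
rewrite integral0_eq// => x _; rewrite patchE memNset//= => -[_ ?].
by move: By; rewrite notin_setE.
Qed.

Lemma integrable_section1 : {ae m1, forall x, A x -> m2.-integrable B (fun y => (F (x, y))%:E)}.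
Proof.
have := ae_integrable1 iF'; apply: filterS => x + Ax.
by rewrite sec1// => /(integrable_mkcond _ mB).
Qed.

Lemma integrable_section2 : {ae m2, forall y, B y -> m1.-integrable A (fun x => (F (x, y))%:E)}.
Proof.
have := ae_integrable2 iF'; apply: filterS => y + By.
by rewrite sec2// => /(integrable_mkcond _ mA).
Qed.

Lemma integrable_inner1 : m1.-integrable A (fun x => \int[m2]_(y in B) (F (x, y))%:E)%E.
Proof. by apply/(integrable_mkcond _ mA); rewrite -FE; exact: integrable_fubini_F. Qed.

Let iI2 : m2.-integrable B (fun y => \int[m1]_(x in A) (F (x, y))%:E)%E.
Proof.
have mf := measurable_int _ iF'.
apply/(integrable_mkcond _ mB); rewrite -GE; apply/integrableP; split.
  exact: (measurable_fubini_G iF').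
have [/(_ iF') + _] := integrable21ltyP m1 m2 mf.
apply: le_lt_trans; apply: ge0_le_integral => //.
- by apply: measurableT_comp => //; exact: (measurable_fubini_G iF').
- have mg : measurable_fun setT (fun z => `|((EFin \o F) \_ (A `*` B)) z|)%E.
    exact: measurableT_comp mf.
  by apply: (@measurable_fun_fubini_tonelli_G _ _ _ _ _ m1 _ mg) => z; exact: abse_ge0.
- move=> y _; apply: le_abse_integral => //.
  exact: (measurable_fun_pair1 _ mf).
Qed.

Lemma integrable_Rintegral1 :
  m1.-integrable A (EFin \o (fun x => \int[m2]_(y in B) F (x, y))).
Proof.
have mI : measurable_fun A (EFin \o (fun x => \int[m2]_(y in B) F (x, y))).
  by apply/measurable_EFinP; apply: (measurableT_comp (@fine_measurable R setT measurableT)) => //;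
    exact: measurable_int integrable_inner1.
apply: (le_integrable mA mI _ integrable_inner1) => x Ax /=.
by rewrite /Rintegral; case: (integral _ _ _) => [r| |] /=; rewrite ?normr0 ?leey ?lexx.
Qed.

Lemma integrable_Rintegral2 :
  m2.-integrable B (EFin \o (fun y => \int[m1]_(x in A) F (x, y))).
Proof.
have mI : measurable_fun B (EFin \o (fun y => \int[m1]_(x in A) F (x, y))).
  by apply/measurable_EFinP; apply: (measurableT_comp (@fine_measurable R setT measurableT)) => //;
    exact: measurable_int iI2.
apply: (le_integrable mB mI _ iI2) => x Ax /=.
by rewrite /Rintegral; case: (integral _ _ _) => [r| |] /=; rewrite ?normr0 ?leey ?lexx.
Qed.

Lemma Rintegral_prod1 : \int[(m1 \x m2)%E]_(z in A `*` B) F z =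
  \int[m1]_(x in A) \int[m2]_(y in B) F (x, y).
Proof.
rewrite {1}/Rintegral integral_mkcond -(integral12_prod_meas1 iF') FE -integral_mkcond.
congr fine; apply: ae_eq_integral => //; [exact: measurable_int integrable_inner1|exact: measurable_int integrable_Rintegral1|].
have := integrable_section1; apply: filterS => x h Ax /=.
by rewrite /Rintegral fineK//; exact: (integrable_fin_num mB (h Ax)).
Qed.

Lemma Rintegral_prod2 : \int[(m1 \x m2)%E]_(z in A `*` B) F z =
  \int[m2]_(y in B) \int[m1]_(x in A) F (x, y).
Proof.
rewrite {1}/Rintegral integral_mkcond -(integral21_prod_meas1 iF') GE -integral_mkcond.
congr fine; apply: ae_eq_integral => //; [exact: measurable_int iI2|exact: measurable_int integrable_Rintegral2|].
have := integrable_section2; apply: filterS => x h Ax /=.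
by rewrite /Rintegral fineK//; exact: (integrable_fin_num mA (h Ax)).
Qed.

End Fubini.

(** * Integration over Omega *)

Section geometry.
Context {R : realType}.
Notation leb := (@lebesgue_measure R).

Lemma measurable_cell : measurable (cell : set (measurableTypeR R * measurableTypeR R)).
Proof. by apply: measurableX; exact: measurable_itv. Qed.

Lemma measurable_Omega (d : R) :
  measurable (Omega d : set (measurableTypeR R * measurableTypeR R * measurableTypeR R)).
Proof. by apply: measurableX; [exact: measurable_cell|exact: measurable_itv]. Qed.

Lemma area_cell : (area (cell : set (plane R)) < +oo)%E.
Proof.
have h : (leb `[0%R, 1%R[%classic < +oo)%E.
  by rewrite lebesgue_measure_itv/= lte_fin ltr01 -EFinB ltry.
rewrite /area/= product_measure1E; try exact: measurable_itv.
by apply: lte_mul_pinfty => //; rewrite ge0_fin_numE.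
Qed.

Lemma vol_Omega (d : R) : (vol (Omega d) < +oo)%E.
Proof.
have h : (leb `]0%R, d[%classic < +oo)%E.
  by rewrite lebesgue_measure_itv/=; case: ifP => _; rewrite ?ltry// -EFinB ltry.
rewrite /vol/= product_measure1E; [|exact: measurable_cell|exact: measurable_itv].
by apply: lte_mul_pinfty => //; rewrite ge0_fin_numE// area_cell.
Qed.

(** Fubini's theorem asks for a sigma-finite measure, while a product of two
    measures is only known to be a measure; this copy of area carries the proof. *)
Definition area_fun : set (measurableTypeR R * measurableTypeR R)%type -> \bar R := area.
HB.instance Definition _ := Measure.on area_fun.
HB.instance Definition _ := Measure_isSigmaFinite.Build _ _ _ area_fun (sigma_finite_product leb leb).

Lemma Rintegral_Omega (d : R) (F : space R -> R) : vol.-integrable (Omega d) (EFin \o F) ->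
  \int[vol]_(x in Omega d) F x = \int[area]_(y in cell) \int[leb]_(s in `]0, d[) F (y, s).
Proof.
move=> iF.
exact: (@Rintegral_prod1 _ _ _ _ R area_fun leb cell `]0, d[%classic
  measurable_cell (measurable_itv _) F iF).
Qed.

Lemma continuous_bounded_Omega (d : R) (f : space R -> R) : continuous f ->
  exists M, forall x, Omega d x -> `|f x| <= M.
Proof.
move=> cf; have [M HM] := continuous_bounded_box d cf.
exists M => -[[a b] c] [[/= ha hb] hc]; move: ha hb hc; rewrite !in_itv/=.
move=> /andP[a0 a1] /andP[b0 b1] /andP[c0 c1].
by apply: HM; rewrite ?a0 ?b0 ?ltW.
Qed.

Lemma continuous_L2_Omega (d : R) (f : space R -> R) : continuous f -> L2 vol (Omega d) f.
Proof.
move=> cf; have [M HM] := continuous_bounded_Omega d cf.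
apply: (L2_bounded (measurable_Omega d) (vol_Omega d) _ HM).
by apply: measurable_funTS; exact: continuous_measurable3.
Qed.

Lemma continuous_L2_cell (t : plane R -> R) : continuous t -> L2 area cell t.
Proof.
move=> ct.
have c3 : continuous (fun x : space R => t x.1).
  by move=> x; apply: (@continuous_comp _ _ _ (fst : space R -> _) t); [exact: cvg_fst|exact: ct].
have [M HM] := continuous_bounded_box 1 c3.
apply: (@L2_bounded _ _ _ _ _ measurable_cell area_cell _ M).
  by apply: measurable_funTS; exact: continuous_measurable2.
move=> [a b] [] /=; rewrite !in_itv/= => /andP[a0 a1] /andP[b0 b1].
by apply: (HM a b 0); rewrite ?a0 ?b0 ?lexx ?ler01 ?ltW.
Qed.

Lemma FTC_itv (d : R) (f F : R -> R) : 0 < d -> continuous f -> continuous F ->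
  (forall s, 0 < s < d -> is_derive s (1 : R) F (f s)) ->
  \int[leb]_(s in `]0, d[) f s = F d - F 0.
Proof.
move=> d0 cf cF dF; have mf : measurable_fun `]0, d[ (EFin \o f).
  by apply/measurable_EFinP; apply: measurable_funTS; exact: continuous_measurable_fun.
rewrite /Rintegral -(@integral_itv_bndoo R 0 d _ true false mf) (@continuous_FTC2 _ f F)//.
- exact: continuous_subspaceT.
- split=> [s|/=|/=].
  + by rewrite in_itv/= => /dF[].
  + by apply: cvg_within_filter; exact: cF.
  + by apply: cvg_within_filter; exact: cF.
- by move=> s; rewrite in_itv/= => /dF[? <-]; rewrite derive1E.
Qed.

Lemma is_derive_continuous (f f' : R -> R) :
  (forall t, is_derive t (1 : R) f (f' t)) -> continuous f.
Proof.
move=> df t; apply: differentiable_continuous; apply/derivable1_diffP.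
by have [] := df t.
Qed.

Definition e1 : 'I_3 := ord0.
Definition e2 : 'I_3 := @Ordinal 3 1 isT.
Definition e3 : 'I_3 := ord_max.

Lemma ord3E (i : 'I_3) : [\/ i = e1, i = e2 | i = e3].
Proof.
case: i => [[|[|[|//]]] h]; [apply: Or31|apply: Or32|apply: Or33]; exact: val_inj.
Qed.

Lemma sum_ord3 (F : 'I_3 -> R) : \sum_(i < 3) F i = F e1 + F e2 + F e3.
Proof.
by rewrite !big_ord_recr big_ord0/= add0r; congr (F _ + F _ + F _); exact: val_inj.
Qed.

Lemma is_derive_line (u : space R -> R) (y : plane R) (s : R) : differentiable u (y, s) ->
  is_derive s (1 : R) (fun s => u (y, s)) (partial e3 u (y, s)).
Proof.
move=> du; have [dv dE] : derivable u (y, s) (basis3 e3) /\ True by split => //; exact: diff_derivable.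
have E : (fun h : R => h^-1 *: ((u \o shift (y, s)) (h *: basis3 e3) - u (y, s))) =
   (fun h : R => h^-1 *: (((fun s => u (y, s)) \o shift s) (h *: 1) - u (y, s))).
  apply/funext => h /=; congr (_ *: (u _ - _)); case: y {du dv} => a b.
  rewrite /basis3/= /GRing.add/= /GRing.scale/= /add_pair /scale_pair/=.
  rewrite scaler0 add0r.
  by congr (_, _).
split.
  by rewrite /derivable -E.
by rewrite /partial /derive E.
Qed.

End geometry.

(** * Green's formula in the vertical direction *)

Section green.
Context {R : realType}.
Variable d : R.
Hypothesis d_gt0 : 0 < d.
Implicit Types (u v g k : space R -> R) (t r : plane R -> R) (p q : R -> R).

Lemma C1_continuous u : C1 u -> continuous u.
Proof. by move=> [_ du _] x; exact: differentiable_continuous. Qed.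

Lemma continuous_x3 p : continuous p -> continuous (fun x : space R => p x.2).
Proof.
by move=> cp x; apply: (@continuous_comp _ _ _ (snd : space R -> R) p); [exact: cvg_snd|exact: cp].
Qed.

Lemma continuous_slice u (s : R) : continuous u -> continuous (fun y : plane R => u (y, s)).
Proof. exact: (@continuous_curry1 (R * R)%type R R u s). Qed.

Lemma continuous_mul (T : topologicalType) (f g : T -> R) :
  continuous f -> continuous g -> continuous (fun x => f x * g x).
Proof. by move=> cf cg x; apply: cvgM; [exact: cf|exact: cg]. Qed.

Lemma continuous_add (T : topologicalType) (f g : T -> R) :
  continuous f -> continuous g -> continuous (fun x => f x + g x).
Proof. by move=> cf cg x; apply: cvgD; [exact: cf|exact: cg]. Qed.

(** Green's formula with a weight p depending on the height only: the
    fundamental theorem of calculus for s |-> p(s) u(y,s) v(y,s) on each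
    vertical line, integrated over the cell. *)
Lemma green_C1 u v p q : continuous p -> continuous q ->
  (forall s, 0 < s < d -> is_derive s (1 : R) p (q s)) -> C1 u -> C1 v ->
  \int[vol]_(x in Omega d) (p x.2 * u x * partial e3 v x + p x.2 * v x * partial e3 u x
     + q x.2 * u x * v x) =
  \int[area]_(y in cell) (p d * u (y, d) * v (y, d) - p 0 * u (y, 0) * v (y, 0)).
Proof.
move=> cp cq dp Cu Cv.
have [_ du cdu] := Cu; have [_ dv cdv] := Cv.
have cu := C1_continuous Cu; have cv := C1_continuous Cv.
pose F := fun x : space R => p x.2 * u x * partial e3 v x + p x.2 * v x * partial e3 u x
     + q x.2 * u x * v x.
have cF : continuous F.
  do !apply: continuous_add; do !apply: continuous_mul => //; exact: continuous_x3.
rewrite Rintegral_Omega; last first.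
  exact: (L2_rint (measurable_Omega d) (vol_Omega d) (continuous_L2_Omega d cF)).
apply: eq_Rintegral => y _.
apply: (@FTC_itv R d (fun s => F (y, s)) (fun s => p s * u (y, s) * v (y, s))) => //.
- exact: (@continuous_curry2 (R * R)%type R R F y cF).
- by do !apply: continuous_mul => //; [exact: (@continuous_curry2 (R * R)%type R R u y cu)|
    exact: (@continuous_curry2 (R * R)%type R R v y cv)].
- move=> s s0d; have h1 := dp s s0d.
  have h2 := is_derive_line (du (y, s)); have h3 := is_derive_line (dv (y, s)).
  apply: is_derive_eq; rewrite /F /= /GRing.scale/=; ring.
Qed.

(** What Green's formula uses of a function u with weak vertical derivative g
    and trace t at height s. *)
Definition approximable (s : R) u g t := exists u_ : nat -> space R -> R,
  [/\ forall n, C1 (u_ n), cvgL2 vol (Omega d) u_ u,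
      cvgL2 vol (Omega d) (fun n => partial e3 (u_ n)) g &
      cvgL2 area cell (fun n y => u_ n (y, s)) t].

(** Both sides of Green's formula are continuous for the convergence in the
    definition of traces, provided that only one end contributes. *)
Lemma green_lim s u g t v k r p q (c : R) : continuous p -> continuous q ->
  (forall u v, C1 u -> C1 v ->
    \int[vol]_(x in Omega d) (p x.2 * u x * partial e3 v x + p x.2 * v x * partial e3 u x
       + q x.2 * u x * v x) = c * \int[area]_(y in cell) (u (y, s) * v (y, s))) ->
  approximable s u g t -> approximable s v k r ->
  \int[vol]_(x in Omega d) (p x.2 * u x * k x + p x.2 * v x * g x + q x.2 * u x * v x) =
  c * \int[area]_(y in cell) (t y * r y).
Proof.
move=> cp cq H [u_ [Cu uu ug ut]] [v_ [Cv vv vk vr]].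
have mO := measurable_Omega d.
have mp : measurable_fun (Omega d) (fun x => p x.2).
  by apply: measurable_funTS; apply: continuous_measurable3; exact: continuous_x3.
have mq : measurable_fun (Omega d) (fun x => q x.2).
  by apply: measurable_funTS; apply: continuous_measurable3; exact: continuous_x3.
have [Mp HMp] := continuous_bounded_Omega d (continuous_x3 cp).
have [Mq HMq] := continuous_bounded_Omega d (continuous_x3 cq).
have pu := cvgL2_bM mO mp HMp uu; have pv := cvgL2_bM mO mp HMp vv.
have qu := cvgL2_bM mO mq HMq uu.
have l1 := cvgL2_mul mO pu vk; have l2 := cvgL2_mul mO pv ug; have l3 := cvgL2_mul mO qu vv.
have split3 (f1 f2 f3 g1 g2 g3 : space R -> R) :
    L2 vol (Omega d) f1 -> L2 vol (Omega d) f2 -> L2 vol (Omega d) f3 ->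
    L2 vol (Omega d) g1 -> L2 vol (Omega d) g2 -> L2 vol (Omega d) g3 ->
    \int[vol]_(x in Omega d) (f1 x * g1 x + f2 x * g2 x + f3 x * g3 x) =
    \int[vol]_(x in Omega d) (f1 x * g1 x) + \int[vol]_(x in Omega d) (f2 x * g2 x) +
    \int[vol]_(x in Omega d) (f3 x * g3 x).
  move=> a1 a2 a3 b1 b2 b3.
  have i1 := L2_mul mO a1 b1; have i2 := L2_mul mO a2 b2; have i3 := L2_mul mO a3 b3.
  by rewrite RintegralD//; [rewrite RintegralD|exact: rintD].
have [lpu1 lpu2 _] := pu; have [lpv1 lpv2 _] := pv; have [lqu1 lqu2 _] := qu.
have [lk1 lk2 _] := vk; have [lg1 lg2 _] := ug; have [lv1 lv2 _] := vv.
rewrite split3//.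
have := cvgD (cvgD l1 l2) l3.
set L := _ + _ + \int[vol]_(x in Omega d) (q x.2 * u x * v x).
rewrite (_ : _ + _ = fun n => c * \int[area]_(y in cell) (u_ n (y, s) * v_ n (y, s))); last first.
  by apply/funext => n; rewrite -H// split3.
move=> h1; have h2 := cvgM (cvg_cst c) (cvgL2_mul measurable_cell ut vr).
by apply: (cvg_unique _ (h1 _ _) (h2 _ _)); exact: Rhausdorff.
Qed.

Lemma green_at0 u g t v k r p q : continuous p -> continuous q ->
  (forall s, 0 < s < d -> is_derive s (1 : R) p (q s)) -> p d = 0 ->
  approximable 0 u g t -> approximable 0 v k r ->
  \int[vol]_(x in Omega d) (p x.2 * u x * k x + p x.2 * v x * g x + q x.2 * u x * v x) =
  - p 0 * \int[area]_(y in cell) (t y * r y).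
Proof.
move=> cp cq dp pd; apply: green_lim => // u1 v1 Cu Cv; rewrite green_C1// -RintegralZl.
- by apply: eq_Rintegral => y _; rewrite pd; ring.
- exact: measurable_cell.
- by apply: L2_mul; [exact: measurable_cell|
    apply: continuous_L2_cell; apply: continuous_slice; exact: C1_continuous..].
Qed.

Lemma green_atd u g t v k r p q : continuous p -> continuous q ->
  (forall s, 0 < s < d -> is_derive s (1 : R) p (q s)) -> p 0 = 0 ->
  approximable d u g t -> approximable d v k r ->
  \int[vol]_(x in Omega d) (p x.2 * u x * k x + p x.2 * v x * g x + q x.2 * u x * v x) =
  p d * \int[area]_(y in cell) (t y * r y).
Proof.
move=> cp cq dp pd; apply: green_lim => // u1 v1 Cu Cv; rewrite green_C1// -RintegralZl.
- by apply: eq_Rintegral => y _; rewrite pd; ring.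
- exact: measurable_cell.
- by apply: L2_mul; [exact: measurable_cell|
    apply: continuous_L2_cell; apply: continuous_slice; exact: C1_continuous..].
Qed.

Lemma approximable_L2 s u g t : approximable s u g t ->
  [/\ L2 vol (Omega d) u, L2 vol (Omega d) g & L2 area cell t].
Proof. by move=> [u_ [_ [_ ? _] [_ ? _] [_ ? _]]]. Qed.

(** Traces at the two ends may come from different approximating sequences;
    splitting p into an affine part vanishing at d and a part vanishing at 0
    uses each of them separately. *)
Lemma green u g t v k r p q td rd : continuous p -> continuous q ->
  (forall s, 0 < s < d -> is_derive s (1 : R) p (q s)) ->
  approximable 0 u g t -> approximable 0 v k r ->
  approximable d u g td -> approximable d v k rd ->
  \int[vol]_(x in Omega d) (p x.2 * u x * k x + p x.2 * v x * g x + q x.2 * u x * v x) =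
  p d * \int[area]_(y in cell) (td y * rd y) - p 0 * \int[area]_(y in cell) (t y * r y).
Proof.
move=> cp cq dp au av aud avd.
pose p1 s := p 0 * (1 - s / d); pose q1 := fun _ : R => - (p 0 / d).
pose p2 s := p s - p1 s; pose q2 s := q s - q1 s.
have d0 : d != 0 by rewrite gt_eqF.
have cp1 : continuous p1.
  move=> s; apply: cvgM; first exact: cvg_cst.
  apply: cvgB; first exact: cvg_cst.
  by apply: cvgM; [exact: cvg_id|exact: cvg_cst].
have cq1 : continuous q1 by move=> s; exact: cvg_cst.
have dp1 s : is_derive s (1 : R) p1 (q1 s).
  by apply: is_derive_eq; rewrite /q1 /GRing.scale/=; field.
have cp2 : continuous p2 by move=> s; apply: cvgB; [exact: cp|exact: cp1].
have cq2 : continuous q2 by move=> s; apply: cvgB; [exact: cq|exact: cq1].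
have dp2 s : 0 < s < d -> is_derive s (1 : R) p2 (q2 s).
  by move=> /dp h; have h1 := dp1 s; apply: is_deriveB.
have h1 := green_at0 cp1 cq1 (fun s _ => dp1 s) _ au av.
have h2 := green_atd cp2 cq2 dp2 _ aud avd.
have p1d : p1 d = 0 by rewrite /p1 divff// subrr mulr0.
have p10 : p1 0 = p 0 by rewrite /p1 mul0r subr0 mulr1.
have p20 : p2 0 = 0 by rewrite /p2 p10 subrr.
have p2d : p2 d = p d by rewrite /p2 p1d subr0.
have {}h1 := h1 p1d; have {}h2 := h2 p20.
rewrite -[X in _ = X * _ - _]p2d -h2 -mulNr -[X in _ = _ + - X * _]p10 -h1.
have [lu lg lt] := approximable_L2 au; have [lv lk lr] := approximable_L2 av.
have mO := measurable_Omega d.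
have iP (a : R -> R) f1 f2 : continuous a -> L2 vol (Omega d) f1 -> L2 vol (Omega d) f2 ->
    vol.-integrable (Omega d) (EFin \o (fun x => a x.2 * f1 x * f2 x)).
  move=> ca l1 l2; apply: (L2_mul mO _ l2).
  have [M HM] := continuous_bounded_Omega d (continuous_x3 ca).
  apply: (L2_bM mO _ HM l1).
  by apply: measurable_funTS; apply: continuous_measurable3; exact: continuous_x3.
rewrite -RintegralD//; [|by do 2?[apply: (rintD mO)]; exact: iP..].
by apply: eq_Rintegral => x _; rewrite /p2 /q2; ring.
Qed.

End green.

(** * Product test functions *)

Section product_functions.
Context {R : realType}.

Lemma differentiable_proj1 (x : space R) : differentiable (fun x : space R => x.1.1) x.
Proof.
apply: (@linear_differentiable R _ _ (fst \o fst)) => y.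
by apply: (@continuous_comp _ _ _ (fst : space R -> _) fst); exact: cvg_fst.
Qed.

Lemma differentiable_proj2 (x : space R) : differentiable (fun x : space R => x.1.2) x.
Proof.
apply: (@linear_differentiable R _ _ (snd \o fst)) => y.
by apply: (@continuous_comp _ _ _ (fst : space R -> _) snd); [exact: cvg_fst|exact: cvg_snd].
Qed.

Lemma differentiable_proj3 (x : space R) : differentiable (fun x : space R => x.2) x.
Proof. by apply: (@linear_differentiable R _ _ snd) => y; exact: cvg_snd. Qed.

Lemma is_derive_dir (A : R -> R) (t w l : R) : is_derive t (1 : R) A l -> is_derive t w A (w * l).
Proof.
move=> [dA Al]; have DA : differentiable A t by apply/derivable1_diffP.
split; first exact: diff_derivable.
by rewrite deriveE// -Al deriveE// -[in LHS](mulr1 w) -[w * 1]/(w *: 1) linearZ.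
Qed.

Lemma is_derive_coord (pr : space R -> R) (A : R -> R) (x v : space R) (l : R) :
  (forall (h : R) y z, pr (h *: y + z) = h *: pr y + pr z) ->
  is_derive (pr x) (1 : R) A l -> is_derive x v (A \o pr) (pr v * l).
Proof.
move=> prl /(is_derive_dir (pr v))[dA Al].
have E : (fun h : R => h^-1 *: (((A \o pr) \o shift x) (h *: v) - (A \o pr) x)) =
   (fun h : R => h^-1 *: ((A \o shift (pr x)) (h *: pr v) - A (pr x))).
  by apply/funext => h /=; rewrite prl.
by split; [rewrite /derivable E|rewrite -Al /derive E].
Qed.

Section C1_prod.
Variables (A B C A' B' C' : R -> R).
Hypotheses (dA : forall t : R, is_derive t (1 : R) A (A' t))
  (dB : forall t : R, is_derive t (1 : R) B (B' t))
  (dC : forall t : R, is_derive t (1 : R) C (C' t)).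
Hypotheses (cA' : continuous A') (cB' : continuous B') (cC' : continuous C').
Hypotheses (pA : forall t, A (t + 1) = A t) (pB : forall t, B (t + 1) = B t).

(** Tensor products A(x1) B(x2) C(x3) are rich enough a family of test functions. *)
Definition prodf (x : space R) : R := A x.1.1 * B x.1.2 * C x.2.

Let is_derive_prodf (x v : space R) : is_derive x v prodf
  (v.1.1 * (A' x.1.1 * B x.1.2 * C x.2) + v.1.2 * (A x.1.1 * B' x.1.2 * C x.2)
   + v.2 * (A x.1.1 * B x.1.2 * C' x.2)).
Proof.
have h1 : is_derive x v (A \o (fun x => x.1.1)) (v.1.1 * A' x.1.1) by exact: is_derive_coord.
have h2 : is_derive x v (B \o (fun x => x.1.2)) (v.1.2 * B' x.1.2) by exact: is_derive_coord.
have h3 : is_derive x v (C \o (fun x => x.2)) (v.2 * C' x.2) by exact: is_derive_coord.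
have h := is_deriveM (is_deriveM h1 h2) h3.
apply: (@is_derive_eq _ _ _ _ _ _ _ _ h).
transitivity (A x.1.1 * B x.1.2 * (v.2 * C' x.2) +
  C x.2 * (A x.1.1 * (v.1.2 * B' x.1.2) + B x.1.2 * (v.1.1 * A' x.1.1))); first by [].
by ring.
Qed.

Lemma prodf_partial i x : partial i prodf x = match val i with
  | 0%N => A' x.1.1 * B x.1.2 * C x.2
  | 1%N => A x.1.1 * B' x.1.2 * C x.2
  | _ => A x.1.1 * B x.1.2 * C' x.2 end.
Proof.
by rewrite /partial; have [_ ->] := is_derive_prodf x (basis3 i);
  case: (ord3E i) => -> /=; rewrite !(mul0r, mul1r, addr0, add0r).
Qed.

Lemma C1_prodf : C1 prodf.
Proof.
have c1 (f : R -> R) : continuous f -> continuous (fun x : space R => f x.1.1).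
  by move=> cf x; apply: (@continuous_comp _ _ _ (fun x : space R => x.1.1) f);
    [exact: differentiable_continuous (differentiable_proj1 x)|exact: cf].
have c2 (f : R -> R) : continuous f -> continuous (fun x : space R => f x.1.2).
  by move=> cf x; apply: (@continuous_comp _ _ _ (fun x : space R => x.1.2) f);
    [exact: differentiable_continuous (differentiable_proj2 x)|exact: cf].
have cA := is_derive_continuous dA; have cB := is_derive_continuous dB; have cC := is_derive_continuous dC.
split.
- by move=> a b c; rewrite /prodf/= pA pB.
- move=> x.
  have D (f f' : R -> R) (pr : space R -> R) : (forall t : R, is_derive t (1 : R) f (f' t)) ->
      differentiable pr x -> differentiable (f \o pr) x.
    by move=> df dpr; apply: differentiable_comp => //; apply/derivable1_diffP; have [] := df (pr x).
  apply: differentiableM; last exact: D dC (differentiable_proj3 x).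
  by apply: differentiableM; [exact: D dA (differentiable_proj1 x)|exact: D dB (differentiable_proj2 x)].
- move=> i; rewrite (_ : partial i prodf = fun x => match val i with
  | 0%N => A' x.1.1 * B x.1.2 * C x.2
  | 1%N => A x.1.1 * B' x.1.2 * C x.2
  | _ => A x.1.1 * B x.1.2 * C' x.2 end); last by apply/funext => x; exact: prodf_partial.
  by case: (ord3E i) => -> /=; do !apply: continuous_mul; try exact: continuous_x3;
    try exact: c1; exact: c2.
Qed.

End C1_prod.

(** As n grows, these C^1 functions converge to the indicator of the positive
    half-line; max s 0 is squared to make the corner at 0 differentiable. *)
Definition ramp (n : nat) (s : R) : R := 1 - expR (- (n%:R * Num.max s 0 ^+ 2)).

Lemma ramp_le0 n s : s <= 0 -> ramp n s = 0.
Proof. by move=> s0; rewrite /ramp max_r// expr0n/= mulr0 oppr0 expR0 subrr. Qed.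

Lemma ramp_ge0 n s : 0 <= ramp n s.
Proof. by rewrite subr_ge0 expR_le1 oppr_le0 mulr_ge0// sqr_ge0. Qed.

Lemma ramp_le1 n s : ramp n s <= 1.
Proof. by rewrite gerBl expR_ge0. Qed.

Lemma ramp_cvg (s_ : nat -> R) (e : R) : 0 < e -> (\forall n \near \oo, e <= s_ n) ->
  ramp n (s_ n) @[n --> \oo] --> (1 : R).
Proof.
move=> e0 es.
have h : 1 - e ^- 2 * n.+1%:R^-1 @[n --> \oo] --> (1 : R).
  rewrite -[X in _ --> X]subr0; apply: cvgB; first exact: cvg_cst.
  by rewrite -(mulr0 (e ^- 2)); apply: cvgM; [exact: cvg_cst|exact: cvg_harmonic].
have <- := cvg_shiftS (fun n => ramp n (s_ n)) (nbhs (1 : R)).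
suff H : ramp n.+1 (s_ n.+1) @[n --> \oo] --> (1 : R) by exact: H.
apply: (squeeze_cvgr _ h (cvg_cst (1 : R))); near=> n => /=.
rewrite ramp_le1 andbT /ramp.
have es' : e <= s_ n.+1.
  by near: n; case: es => N _ HN; exists N => // n /= Nn; apply: HN => /=; exact: leqW.
have s0 : 0 < s_ n.+1 by exact: lt_le_trans es'.
rewrite max_l; last exact: ltW.
set t := s_ n.+1; set N : R := n.+1%:R.
have N0 : 0 < N by rewrite ltr0n.
have e2 : 0 < e ^+ 2 * N by rewrite mulr_gt0 ?exprn_gt0.
rewrite lerB// -invfM expRN lef_pV2 ?posrE ?expR_gt0//.
have h2 : e ^+ 2 <= t ^+ 2 by rewrite lerXn2r// nnegrE ltW.
apply: (@le_trans _ _ (N * t ^+ 2)); first by rewrite mulrC ler_pM2l.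
by apply: le_trans (expR_ge1Dx _); rewrite lerDr.
Unshelve. all: by end_near. Qed.

Definition ramp' (n : nat) (s : R) : R :=
  n%:R * (2 * Num.max s 0) * expR (- (n%:R * Num.max s 0 ^+ 2)).

Let is_derive_maxsq (s : R) : is_derive s (1 : R) (fun s => Num.max s 0 ^+ 2) (2 * Num.max s 0).
Proof.
have [s0|s0|->] := ltgtP s 0.
- rewrite mulr0; apply: (@near_eq_is_derive _ _ _ (cst 0)).
  near=> t; rewrite max_r ?expr0n//; near: t.
  by have := lt_nbhsl s0; apply: filterS => t /ltW.
- apply: (@near_eq_is_derive _ _ _ (fun t : R => t ^+ 2 : R)).
  + near=> t; rewrite max_l//; near: t.
    by have := lt_nbhsr s0; apply: filterS => t /ltW.
  + by apply: is_derive_eq; rewrite /GRing.scale/=; ring.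
- rewrite mulr0.
  have h : (fun h : R => h^-1 *: (((fun s : R => Num.max s 0 ^+ 2) \o shift (0 : R)) (h *: (1 : R)) -
     Num.max (0 : R) 0 ^+ 2)) h @[h --> (0 : R)^'] --> (0 : R).
    apply/cvgrPdist_le => /= e e0; near=> t.
    rewrite sub0r normrN maxxx expr0n/= subr0 addr0 /GRing.scale/= mulr1 normrM normfV.
    have t0 : 0 < `|t| by rewrite normr_gt0; near: t; exact: nbhs_dnbhs_neq.
    rewrite mulrC ler_pdivrMr//.
    apply: (@le_trans _ _ (`|t| * `|t|)).
      by rewrite normrX expr2; have [t1|t1] := leP t 0; rewrite ?normr0 ?mulr0 ?mulr_ge0.
    by rewrite ler_pM2r//; near: t; exact: dnbhs0_le.
  by split; [apply/cvg_ex; exists 0; exact: h|apply: cvg_lim => //; exact: h].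
Unshelve. all: by end_near. Qed.

Lemma is_derive_ramp n (s : R) : is_derive s (1 : R) (ramp n) (ramp' n s).
Proof.
have h := is_derive_maxsq s.
have h2 : is_derive s (1 : R) (fun s => - (n%:R * Num.max s 0 ^+ 2)) (- (n%:R * (2 * Num.max s 0))).
  by apply: is_derive_eq; rewrite /GRing.scale/=; ring.
have h3 := @is_derive1_comp R expR (fun s => - (n%:R * Num.max s 0 ^+ 2)) s _ _ (is_derive_expR _) h2.
rewrite /ramp; apply: is_derive_eq; rewrite /ramp' /=; ring.
Qed.

Lemma continuous_ramp' n : continuous (ramp' n).
Proof.
have cm : continuous (fun s : R => Num.max s 0).
  by move=> s; apply: (@continuous_max _ _ (fun x : R => x) (cst 0)); [exact: cvg_id|exact: cvg_cst].
have cm2 : continuous (fun s : R => n%:R * Num.max s 0 ^+ 2).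
  by do !apply: continuous_mul => //; move=> s; exact: cvg_cst.
do !apply: continuous_mul => //; try by move=> s; exact: cvg_cst.
move=> s; apply: (@continuous_comp _ _ _ (fun s : R => - (n%:R * Num.max s 0 ^+ 2)) expR).
  by apply: cvgN; exact: cm2.
exact: continuous_expR.
Qed.

End product_functions.

(** * Approximation of rays by test functions *)

Lemma Rdominated_cvg dd (T : measurableType dd) (R : realType) (mu : {measure set T -> \bar R})
    (D : set T) (f_ : nat -> T -> R) (f g : T -> R) : measurable D ->
  (forall n, measurable_fun D (f_ n)) -> measurable_fun D f ->
  (forall x, D x -> f_ n x @[n --> \oo] --> f x) ->
  mu.-integrable D (EFin \o g) -> (forall n x, D x -> `|f_ n x| <= g x) ->
  \int[mu]_(x in D) f_ n x @[n --> \oo] --> \int[mu]_(x in D) f x.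
Proof.
move=> mD mf_ mf cvf ig fg.
have mEf_ n : measurable_fun D (EFin \o f_ n) by exact/measurable_EFinP.
have mEf : measurable_fun D (EFin \o f) by exact/measurable_EFinP.
have cE : {ae mu, forall x, D x -> (EFin \o f_ n) x @[n --> \oo] --> (EFin \o f) x}.
  by apply: aeW => x Dx; apply/fine_cvgP; split; [exact: nearW|exact: cvf].
have fE : {ae mu, forall x n, D x -> (`|(EFin \o f_ n) x| <= (EFin \o g) x)%E}.
  by apply: aeW => x n Dx; rewrite /= lee_fin fg.
have [i1 _ i2] := dominated_convergence mD mEf_ mEf cE ig fE.
apply: fine_cvg; rewrite fineK; first exact: i2.
exact: integrable_fin_num.
Qed.

Section ray_approximation.
Context {R : realType}.

Let is_derive_ramp_comp n (S : R -> R) (S' t : R) : is_derive t (1 : R) S S' ->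
  is_derive t (1 : R) (fun t => ramp n (S t)) (ramp' n (S t) * S').
Proof. by move=> dS; exact: (@is_derive1_comp R (ramp n) S t _ _ (is_derive_ramp n (S t)) dS). Qed.

Let continuous_ramp'_comp n (S : R -> R) : continuous S -> continuous (fun t => ramp' n (S t)).
Proof. by move=> cS t; apply: (@continuous_comp _ _ _ S (ramp' n)); [exact: cS|exact: continuous_ramp']. Qed.

(** On the period cell the indicator of a ray is a limit of periodic C^1
    functions bounded by 1. *)
Lemma ray_periodic (a : R) : exists A_ A'_ : nat -> R -> R,
  [/\ forall n (t : R), is_derive t (1 : R) (A_ n) (A'_ n t), forall n, continuous (A'_ n),
      forall n t, A_ n (t + 1) = A_ n t, forall n t, 0 <= A_ n t <= 1 &
      forall t, 0 <= t < 1 -> A_ n t @[n --> \oo] --> (\1_(`]a, +oo[%classic) t : R)].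
Proof.
have cstcase (k : R) : 0 <= k <= 1 -> (forall t, 0 <= t < 1 -> (\1_(`]a, +oo[%classic) t : R) = k) ->
    exists A_ A'_ : nat -> R -> R,
  [/\ forall n (t : R), is_derive t (1 : R) (A_ n) (A'_ n t), forall n, continuous (A'_ n),
      forall n t, A_ n (t + 1) = A_ n t, forall n t, 0 <= A_ n t <= 1 &
      forall t, 0 <= t < 1 -> A_ n t @[n --> \oo] --> (\1_(`]a, +oo[%classic) t : R)].
  move=> k01 hk; exists (fun=> cst k), (fun=> cst 0); split => //.
  - by move=> n t; exact: is_derive_cst.
  - by move=> n t; exact: cvg_cst.
  - by move=> t /hk ->; exact: cvg_cst.
have [a0|a0] := ltP a 0.
  apply: (cstcase 1); first by rewrite ler01 lexx.
  by move=> t /andP[t0 _]; rewrite indicE mem_set//= in_itv/= andbT (lt_le_trans a0).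
have [a1|a1] := leP 1 a.
  apply: (cstcase 0); first by rewrite ler01 lexx.
  by move=> t /andP[_ t1]; rewrite indicE memNset//= in_itv/= andbT; apply/negP; rewrite -leNgt (le_trans (ltW t1)).
(* S has period 1 and is positive exactly on (a, 1) in the period cell. *)
pose S (t : R) := sin (pi * (t - a)) * sin (pi * (1 - t)).
pose S' (t : R) := pi * cos (pi * (t - a)) * sin (pi * (1 - t)) - sin (pi * (t - a)) * (pi * cos (pi * (1 - t))).
have dS t : is_derive t (1 : R) S (S' t).
  have h1 : is_derive t (1 : R) (fun t => pi * (t - a)) pi.
    by apply: is_derive_eq; rewrite /GRing.scale/=; ring.
  have h2 : is_derive t (1 : R) (fun t => pi * (1 - t)) (- pi).
    by apply: is_derive_eq; rewrite /GRing.scale/=; ring.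
  have h3 := @is_derive1_comp R sin _ t _ _ (is_derive_sin _) h1.
  have h4 := @is_derive1_comp R sin _ t _ _ (is_derive_sin _) h2.
  have h := is_deriveM h3 h4.
  apply: (@is_derive_eq _ _ _ _ _ _ _ _ h).
  by rewrite /S' /GRing.scale/=; ring.
have cl1 : continuous (fun t : R => pi * (t - a)).
  move=> t; apply: cvgM; first exact: cvg_cst.
  by apply: cvgB; [exact: cvg_id|exact: cvg_cst].
have cl2 : continuous (fun t : R => pi * (1 - t)).
  move=> t; apply: cvgM; first exact: cvg_cst.
  by apply: cvgB; [exact: cvg_cst|exact: cvg_id].
have cs (f l : R -> R) : continuous f -> continuous l -> continuous (fun t => f (l t)).
  by move=> cf cl t; apply: (@continuous_comp _ _ _ l f); [exact: cl|exact: cf].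
have c1 := cs sin _ (@continuous_sin R) cl1; have c2 := cs sin _ (@continuous_sin R) cl2.
have c3 := cs cos _ (@continuous_cos R) cl1; have c4 := cs cos _ (@continuous_cos R) cl2.
have cpi : continuous (fun _ : R => pi : R) by move=> t; exact: cvg_cst.
have cS : continuous S by exact: continuous_mul.
have cS' : continuous S'.
  move=> t; apply: cvgB; apply: cvgM.
  - by apply: cvgM; [exact: cpi|exact: c3].
  - exact: c2.
  - exact: c1.
  - by apply: cvgM; [exact: cpi|exact: c4].
have SP t : S (t + 1) = S t.
  rewrite /S (_ : pi * (t + 1 - a) = pi * (t - a) + pi); last by ring.
  rewrite (_ : pi * (1 - t) = pi * (1 - (t + 1)) + pi); last by ring.
  by rewrite !sinDpi; ring.
exists (fun n t => ramp n (S t)), (fun n t => ramp' n (S t) * S' t); split.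
- by move=> n t; exact: is_derive_ramp_comp.
- by move=> n; apply: continuous_mul => //; exact: continuous_ramp'_comp.
- by move=> n t; rewrite SP.
- by move=> n t; rewrite ramp_ge0 ramp_le1.
- move=> t /andP[t0 t1].
  have pi0 := @pi_gt0 R.
  have hpi (x : R) : 0 <= x -> x <= 1 -> 0 <= pi * x <= pi by move=> ? ?; apply/andP; split; nra.
  have s2 : 0 <= sin (pi * (1 - t)).
    by apply/sin_ge0_pi/hpi; lra.
  have [ta|ta] := leP t a.
    rewrite indicE memNset/=; last by rewrite in_itv/= andbT; apply/negP; rewrite -leNgt.
    have S0 : S t <= 0.
      rewrite mulr_le0_ge0// -oppr_ge0 -sinN; apply: sin_ge0_pi; rewrite -mulrN opprB.
      by apply: hpi; lra.
    by under eq_fun do rewrite ramp_le0//; exact: cvg_cst.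
  rewrite indicE mem_set/=; last by rewrite in_itv/= andbT.
  have S0 : 0 < S t.
    apply: mulr_gt0; apply: sin_gt0_pi; apply/andP; split.
    + by rewrite mulr_gt0//; lra.
    + by rewrite gtr_pMr//; lra.
    + by rewrite mulr_gt0//; lra.
    + by rewrite gtr_pMr//; lra.
  by apply: (ramp_cvg S0); apply: nearW.
Qed.

(** The same in the vertical direction, with compact support in (0, d) instead
    of periodicity. *)
Lemma ray_compact (d a : R) : 0 < d -> exists A_ A'_ : nat -> R -> R,
  [/\ forall n (t : R), is_derive t (1 : R) (A_ n) (A'_ n t), forall n, continuous (A'_ n),
      forall n, exists lo hi, [/\ 0 < lo, hi < d & forall t, A_ n t != 0 -> lo <= t <= hi],
      forall n t, 0 <= A_ n t <= 1 &
      forall t, 0 < t < d -> A_ n t @[n --> \oo] --> (\1_(`]a, +oo[%classic) t : R)].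
Proof.
move=> d0.
pose lo n := Num.max a 0 + d / n.+2%:R; pose hi n := d - d / n.+2%:R.
have dn0 n : 0 < d / n.+2%:R by rewrite divr_gt0.
have cvdn : d / n.+2%:R @[n --> \oo] --> (0 : R).
  rewrite -(mulr0 d); apply: cvgM; first exact: cvg_cst.
  have := cvg_shiftS (@harmonic R) (nbhs (0 : R)) => h.
  suff : harmonic n.+1 @[n --> \oo] --> (0 : R) by exact.
  by rewrite h; exact: cvg_harmonic.
pose f1 n t : R := ramp n (t - lo n); pose f2 n t : R := ramp n (hi n - t).
have d1 n (t : R) : is_derive t (1 : R) (f1 n) (ramp' n (t - lo n)).
  have h1 : is_derive t (1 : R) (fun t => t - lo n) 1.
    by apply: is_derive_eq; rewrite subr0.
  by have := is_derive_ramp_comp n h1; rewrite mulr1.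
have d2 n (t : R) : is_derive t (1 : R) (f2 n) (- ramp' n (hi n - t)).
  have h1 : is_derive t (1 : R) (fun t => hi n - t) (- 1).
    by apply: is_derive_eq; rewrite add0r mul1r.
  by have := is_derive_ramp_comp n h1; rewrite mulrN1.
have cf1 n : continuous (f1 n) by exact: is_derive_continuous (d1 n).
have cf2 n : continuous (f2 n) by exact: is_derive_continuous (d2 n).
exists (fun n t => f1 n t * f2 n t),
  (fun n t => f1 n t * - ramp' n (hi n - t) + f2 n t * ramp' n (t - lo n)); split.
- by move=> n t; exact: is_deriveM (d1 n t) (d2 n t).
- move=> n; apply: continuous_add; apply: continuous_mul => //.
    move=> t; apply: cvgN; apply: (@continuous_ramp'_comp n (fun t => hi n - t)) => {}t.
    by apply: cvgB; [exact: cvg_cst|exact: cvg_id].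
  apply: (@continuous_ramp'_comp n (fun t => t - lo n)) => t.
  by apply: cvgB; [exact: cvg_id|exact: cvg_cst].
- move=> n; exists (lo n), (hi n); split.
  + by rewrite ltr_wpDl// le_max lexx orbT.
  + by rewrite gtrBl.
  + move=> t; apply: contraNT; rewrite negb_and -!ltNge /f1 /f2 => /orP[h|h].
      by rewrite ramp_le0 ?mul0r// subr_le0 ltW.
    by rewrite [X in _ * X]ramp_le0 ?mulr0// subr_le0 ltW.
- by move=> n t; rewrite mulr_ge0 ?ramp_ge0// mulr_ile1 ?ramp_ge0 ?ramp_le1.
- move=> t /andP[t0 td]; have [ta|ta] := leP t a.
    rewrite indicE memNset/=; last by rewrite in_itv/= andbT; apply/negP; rewrite -leNgt.
    have h n : f1 n t = 0.
      rewrite /f1 ramp_le0// subr_le0 (le_trans ta)// (@le_trans _ _ (Num.max a 0))//.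
        by rewrite le_max lexx.
      by rewrite lerDl ltW.
    by under eq_fun do rewrite h mul0r; exact: cvg_cst.
  rewrite indicE mem_set/=; last by rewrite in_itv/= andbT.
  have tm : Num.max a 0 < t by rewrite gt_max ta t0.
  rewrite -(mulr1 (1 : R)); apply: cvgM.
  + apply: (@ramp_cvg R _ ((t - Num.max a 0) / 2)); first by rewrite divr_gt0// subr_gt0.
    have e0 : 0 < (t - Num.max a 0) / 2 by rewrite divr_gt0// subr_gt0.
    move/cvgrPdist_le : cvdn => /(_ _ e0); apply: filterS => n.
    rewrite sub0r normrN (ger0_norm (ltW (dn0 n))) /lo.
    by move: (d / _) (Num.max _ _) => q m; lra.
  + apply: (@ramp_cvg R _ ((d - t) / 2)); first by rewrite divr_gt0// subr_gt0.
    have e0 : 0 < (d - t) / 2 by rewrite divr_gt0// subr_gt0.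
    move/cvgrPdist_le : cvdn => /(_ _ e0); apply: filterS => n.
    rewrite sub0r normrN (ger0_norm (ltW (dn0 n))) /hi.
    by move: (d / _) => q; lra.
Qed.

End ray_approximation.

(** * Uniqueness of weak derivatives *)

Section density_charge.
Context {R : realType}.
Context dd (T : measurableType dd) (mu : {measure set T -> \bar R}) (D : set T).
Hypothesis mD : measurable D.
Variable w : T -> R.
Hypothesis iw : mu.-integrable D (EFin \o w).

Definition density_charge (E : set T) : R := \int[mu]_(x in D) (w x * \1_E x).

Lemma charge_integrable (E : set T) : measurable E ->
  mu.-integrable D (EFin \o (fun x => w x * \1_E x)).
Proof.
move=> mE; have mw := rint_measurable iw.
apply: (rint_le mD _ (integrable_norm iw)).
  by apply: measurable_funM => //; exact: measurable_indic.
by move=> x Dx; rewrite normrM ler_piMr// indicE normr_nat; case: (_ \in _).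
Qed.

(** Dynkin's argument: the sets whose image under Phi is not charged form a
    lambda-system. The map Phi inserts one factor into a product of sets, so
    that a product can be treated one coordinate at a time. *)
Lemma charge_pilambda dX (X : measurableType dX) (G : set (set X)) (Phi : set X -> set T) :
  setI_closed G -> @measurable _ X = <<s G >> ->
  (forall E, measurable E -> measurable (Phi E)) ->
  (forall A B, Phi (A `\` B) = Phi A `\` Phi B) ->
  (forall F : nat -> set X, Phi (\bigcup_n F n) = \bigcup_n Phi (F n)) ->
  density_charge (Phi setT) = 0 -> (forall E, G E -> density_charge (Phi E) = 0) ->
  forall E, measurable E -> density_charge (Phi E) = 0.
Proof.
move=> IG genG mPhi PhiD PhiU PhiT PhiG.
have mw := rint_measurable iw.
have PhiS A B : A `<=` B -> Phi A `<=` Phi B.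
  move=> AB; suff -> : Phi A = Phi B `\` Phi (B `\` A) by apply: subDsetl.
  by rewrite -PhiD setDD setIidr.
pose H := [set E : set X | measurable E /\ density_charge (Phi E) = 0].
suff : <<s setT, G >> `<=` H by move=> GH E; rewrite genG => /GH[].
apply: lambda_system_subset => //; last first.
  by move=> E GE; split; [rewrite genG; exact: sub_sigma_algebra|exact: PhiG].
split=> //.
- move=> A B BA [mA A0] [mB B0]; split; first exact: measurableD.
  rewrite PhiD -[RHS](subrr 0) -[X in _ = X - _]A0 -[X in _ = _ - X]B0 -RintegralB//;
    try exact: charge_integrable (mPhi _ _).
  apply: eq_Rintegral => x _; rewrite -mulrBr; congr (_ * _); rewrite !indicE.
  have h := PhiS _ _ BA x.
  have [Bx|Bx] := pselect (Phi B x).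
    by rewrite (memNset (_ : ~ (Phi A `\` Phi B) x)) ?mem_set ?subrr//; [exact: h|move=> []].
  rewrite (memNset Bx) subr0; have [Ax|Ax] := pselect (Phi A x).
    by rewrite !mem_set.
  by rewrite !memNset// => -[].
- move=> F ndF HF; split; first by apply: bigcupT_measurable => n; have [] := HF n.
  rewrite PhiU.
  have mF n : measurable (Phi (F n)) by apply: mPhi; have [] := HF n.
  have c : density_charge (Phi (F n)) @[n --> \oo] --> density_charge (\bigcup_n Phi (F n)).
    apply: (@Rdominated_cvg _ _ _ _ _ _ _ (fun x => `|w x|)) => //.
    + by move=> n; exact: rint_measurable (charge_integrable (mF n)).
    + by apply: rint_measurable; apply: charge_integrable; exact: bigcupT_measurable.
    + move=> x Dx; apply: cvgM; first exact: cvg_cst.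
      have [[N _ FNx]|nx] := pselect ((\bigcup_n Phi (F n)) x).
        apply: cvg_near_cst; exists N => // n /= Nn; rewrite !indicE !mem_set//.
          by exists N.
        by apply: (PhiS (F N)) FNx; apply/subsetPset/ndF.
      apply: cvg_near_cst; apply: nearW => n; rewrite !indicE !memNset// => Fx.
      by apply: nx; exists n.
    + exact: integrable_norm iw.
    + by move=> n x Dx; rewrite normrM ler_piMr// indicE normr_nat; case: (_ \in _).
  have c0 : density_charge (Phi (F n)) @[n --> \oo] --> (0 : R).
    by apply: cvg_near_cst; apply: nearW => n; have [] := HF n.
  by apply: (cvg_unique _ c c0); exact: Rhausdorff.
Qed.

Lemma charge0_ae0 : (forall E, measurable E -> density_charge E = 0) -> ae_eq mu D w (cst 0).
Proof.
move=> c0; have mw := rint_measurable iw.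
suff : ae_eq mu D (EFin \o w) (cst 0%E).
  by apply: filterS => x h Dx; have [] := h Dx.
apply: integral_ae_eq => // E ED mE; rewrite integral0.
have := c0 E mE; rewrite /density_charge => h.
have h0 : \int[mu]_(x in E) w x = 0.
  rewrite -h -[in LHS](setIidr ED) Rintegral_mkcondr; apply: eq_Rintegral => x _.
  by rewrite patchE indicE; case: ifP => _; rewrite ?mulr1 ?mulr0.
have fin : (\int[mu]_(x in E) (EFin \o w) x)%E \is a fin_num.
  by apply: integrable_fin_num => //; exact: integrableS iw.
by rewrite -(fineK fin); congr EFin.
Qed.

End density_charge.

Section weak_partial_unique.
Context {R : realType}.
Variable d : R.
Hypothesis d_gt0 : 0 < d.
Notation mR := (measurableTypeR R).

Lemma rays_setI_closed : setI_closed (@RGenOInfty.G R).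
Proof.
move=> _ _ [a ->] [b ->]; exists (Num.max a b); apply/seteqP; split => x /=;
  rewrite !in_itv/= !andbT gt_max.
- by move=> [-> ->].
- by move=> /andP.
Qed.

Lemma rays_generate : @measurable _ mR = <<s @RGenOInfty.G R >>.
Proof. exact: RGenOInfty.measurableE. Qed.

Lemma setX_bigcupr (X Y : Type) (A : set X) (F : nat -> set Y) :
  A `*` (\bigcup_n F n) = \bigcup_n (A `*` F n).
Proof.
by apply/seteqP; split => [[x y] [/= Ax [n _ Fy]]|[x y] [n _ [/= Ax Fy]]];
  [exists n|split=> //; exists n].
Qed.

Lemma setX_bigcupl (X Y : Type) (A : set Y) (F : nat -> set X) :
  (\bigcup_n F n) `*` A = \bigcup_n (F n `*` A).
Proof.
by apply/seteqP; split => [[x y] [/= [n _ Fy] Ax]|[x y] [n _ [/= Ax Fy]]];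
  [exists n|split=> //; exists n].
Qed.

Lemma setX_setDr (X Y : Type) (A : set X) (B C : set Y) :
  A `*` (B `\` C) = (A `*` B) `\` (A `*` C).
Proof.
apply/seteqP; split => [[x y] [/= Ax [By Cy]]|[x y] [[/= Ax By] h]].
  by split=> // -[].
by split=> //; split => // Cy; apply: h.
Qed.

Lemma setX_setDl (X Y : Type) (A : set Y) (B C : set X) :
  (B `\` C) `*` A = (B `*` A) `\` (C `*` A).
Proof.
apply/seteqP; split => [[x y] [/= [By Cy] Ax]|[x y] [[/= Ax By] h]].
  by split=> // -[].
by split=> //; split => // Cy; apply: h.
Qed.

Variable w : space R -> R.
Hypothesis iw : vol.-integrable (Omega d) (EFin \o w).
Hypothesis w0 : forall psi, test_function d psi -> \int[vol]_(x in Omega d) (w x * psi x) = 0.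

Let nu := density_charge vol (Omega d) w.
Notation ray a := (`]a, +oo[%classic : set R).

Lemma nu_ext (E F : set (space R)) : E `&` Omega d = F `&` Omega d -> nu E = nu F.
Proof.
move=> EF; apply: eq_Rintegral => x /set_mem Ox; congr (_ * _); rewrite !indicE; congr (_%:R).
congr nat_of_bool; apply/idP/idP => /set_mem h; apply/mem_set.
- by have [] : (F `&` Omega d) x by rewrite -EF.
- by have [] : (E `&` Omega d) x by rewrite EF.
Qed.

(** The indicator of a product of rays is a bounded limit of test functions. *)
Let nu_rays a b c : nu (ray a `*` ray b `*` ray c) = 0.
Proof.
have [A_ [A'_ [dA cA' pA A01 cA]]] := ray_periodic a.
have [B_ [B'_ [dB cB' pB B01 cB]]] := ray_periodic b.
have [C_ [C'_ [dC cC' sC C01 cC]]] := ray_compact c d_gt0.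
pose psi n := prodf (A_ n) (B_ n) (C_ n).
have C1psi n : C1 (psi n) by apply: C1_prodf (dA n) (dB n) (dC n) _ _ _ _ _.
have tpsi n : test_function d (psi n).
  split=> //; have [lo [hi [lo0 hid h]]] := sC n; exists lo, hi; split => // x.
  by rewrite /psi /prodf !mulf_eq0 !negb_or => /andP[_ /h].
have psi1 n x : `|psi n x| <= 1.
  have /andP[a0 a1] := A01 n x.1.1; have /andP[b0 b1] := B01 n x.1.2; have /andP[c0 c1] := C01 n x.2.
  by rewrite ger0_norm /psi /prodf; [do ?apply: mulr_ile1|]; rewrite ?mulr_ge0.
have mw := rint_measurable iw.
have mbox : measurable (ray a `*` ray b `*` ray c : set (mR * mR * mR)).
  by apply: measurableX; [apply: measurableX|]; exact: measurable_itv.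
have c1 : \int[vol]_(x in Omega d) (w x * psi n x) @[n --> \oo] --> nu (ray a `*` ray b `*` ray c).
  apply: (@Rdominated_cvg _ _ R vol (Omega d) (fun n x => w x * psi n x)
    (fun x => w x * \1_(ray a `*` ray b `*` ray c) x) (fun x => `|w x|)).
  - exact: measurable_Omega.
  - move=> n; apply: measurable_funM => //.
    by apply: measurable_funTS; apply: continuous_measurable3; exact: C1_continuous.
  - exact: rint_measurable (charge_integrable (measurable_Omega d) iw mbox).
  - move=> -[[x y] z] [[/=]]; rewrite !in_itv/= => hx hy hz.
    apply: cvgM; first exact: cvg_cst.
    have -> : \1_(ray a `*` ray b `*` ray c) (x, y, z) = \1_(ray a) x * \1_(ray b) y * \1_(ray c) z :> R.
      rewrite !indicE !in_setX/=; case: (x \in _); case: (y \in _); case: (z \in _);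
        by rewrite /= ?mulr1 ?mulr0 ?mul0r.
    by apply: cvgM; [apply: cvgM; [exact: cA|exact: cB]|exact: cC].
  - exact: integrable_norm iw.
  - by move=> n x _; rewrite normrM ler_piMr.
have c0 : \int[vol]_(x in Omega d) (w x * psi n x) @[n --> \oo] --> (0 : R).
  by apply: cvg_near_cst; apply: nearW => n; exact: w0.
by apply: (cvg_unique _ c1 c0); exact: Rhausdorff.
Qed.

Let mrects (A B C : set mR) : measurable A -> measurable B -> measurable C ->
  measurable (A `*` B `*` C : set (mR * mR * mR)).
Proof. by move=> mA mB mC; apply: measurableX => //; exact: measurableX. Qed.

Let ray_N1 (t : R) : 0 <= t -> t \in `]-1, +oo[. Proof. by move=> t0; rewrite in_itv/= andbT; lra. Qed.

(* From nu1 to nu4 one factor at a time is extended from rays to Borel sets,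
   then from rectangles to measurable sets of the plane. The ray above -1
   serves as the whole line, because Omega lies above it in each coordinate. *)
Let nu1 a b (C : set mR) : measurable C -> nu (ray a `*` ray b `*` C) = 0.
Proof.
apply: (charge_pilambda (measurable_Omega d) iw rays_setI_closed rays_generate
  (Phi := fun C : set mR => (ray a `*` ray b `*` C : set (mR * mR * mR)))).
- by move=> E mE; exact: mrects.
- by move=> A B; exact: setX_setDr.
- by move=> F; exact: setX_bigcupr.
- rewrite -(nu_rays a b (-1)); apply: nu_ext; apply/seteqP; split => -[[x y] z] /=.
    move=> [[[xa yb] _] [hc hz]]; split => //; split => //=.
    by move: hz; rewrite /= in_itv/= => /andP[z0 _]; exact/ray_N1/ltW.
  by move=> [[h _] ?].
- by move=> _ [c ->]; exact: nu_rays.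
Qed.

Let nu2 a (B C : set mR) : measurable B -> measurable C -> nu (ray a `*` B `*` C) = 0.
Proof.
move=> + mC; move: B.
apply: (charge_pilambda (measurable_Omega d) iw rays_setI_closed rays_generate
  (Phi := fun B : set mR => (ray a `*` B `*` C : set (mR * mR * mR)))).
- by move=> E mE; exact: mrects.
- by move=> A B; rewrite setX_setDr setX_setDl.
- by move=> F; rewrite setX_bigcupr setX_bigcupl.
- rewrite -(nu1 a (-1) mC); apply: nu_ext; apply/seteqP; split => -[[x y] z] /=.
    move=> [[[xa _] Cz] [[hx hy] hz]]; split => //; split => //=; split => //=.
    by move: hy; rewrite /= in_itv/= => /andP[y0 _]; exact: ray_N1.
  by move=> [[[h _] ?] ?].
- by move=> _ [c ->]; exact: nu1.
Qed.

Let nu3 (A B C : set mR) : measurable A -> measurable B -> measurable C -> nu (A `*` B `*` C) = 0.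
Proof.
move=> + mB mC; move: A.
apply: (charge_pilambda (measurable_Omega d) iw rays_setI_closed rays_generate
  (Phi := fun A : set mR => (A `*` B `*` C : set (mR * mR * mR)))).
- by move=> E mE; exact: mrects.
- by move=> A1 A2; rewrite !setX_setDl.
- by move=> F; rewrite !setX_bigcupl.
- rewrite -(nu2 (-1) mB mC); apply: nu_ext; apply/seteqP; split => -[[x y] z] /=.
    move=> [[[_ yb] Cz] [[hx hy] hz]]; split => //; split => //=; split => //=.
    by move: hx; rewrite /= in_itv/= => /andP[y0 _]; exact: ray_N1.
  by move=> [[[_ h] ?] ?].
- by move=> _ [c ->]; exact: nu2.
Qed.

Let rect dX dY (X : measurableType dX) (Y : measurableType dY) : set (set (X * Y)) :=
  [set A `*` B | A in measurable & B in measurable].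

Let rectI dX dY (X : measurableType dX) (Y : measurableType dY) : setI_closed (@rect _ _ X Y).
Proof.
move=> _ _ [A mA [B mB <-]] [A' mA' [B' mB' <-]]; rewrite -setXI.
exists (A `&` A'); first exact: measurableI.
by exists (B `&` B') => //; exact: measurableI.
Qed.

Let nu4 (P : set (mR * mR)) (C : set mR) : measurable P -> measurable C -> nu (P `*` C) = 0.
Proof.
move=> + mC; move: P.
apply: (charge_pilambda (measurable_Omega d) iw (@rectI _ _ mR mR)
  (@measurable_prod_measurableType _ _ mR mR)
  (Phi := fun P : set (mR * mR) => (P `*` C : set (mR * mR * mR)))).
- by move=> E mE; exact: measurableX.
- by move=> A1 A2; rewrite !setX_setDl.
- by move=> F; rewrite !setX_bigcupl.
- by rewrite -setXTT; exact: nu3.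
- by move=> _ [A mA [B mB <-]]; exact: nu3.
Qed.

Lemma test_orthogonal_ae0 : ae_eq vol (Omega d) w (cst 0).
Proof.
apply: (charge0_ae0 (measurable_Omega d) iw).
apply: (charge_pilambda (measurable_Omega d) iw (@rectI _ _ (mR * mR)%type mR)
  (@measurable_prod_measurableType _ _ (mR * mR)%type mR) (Phi := id)) => //.
- by rewrite -setXTT; exact: nu4.
- by move=> _ [A mA [B mB <-]]; exact: nu4.
Qed.

End weak_partial_unique.

(** The fundamental lemma of the calculus of variations. It makes the choice of
    a weak derivative made by wpartial harmless. *)
Lemma weak_partial_unique (R : realType) (d : R) (i : 'I_3) (u g g' : space R -> R) : 0 < d ->
  is_weak_partial d i u g -> is_weak_partial d i u g' -> ae_eq vol (Omega d) g g'.
Proof.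
move=> d0 [[_ lg] Hg] [[_ lg'] Hg']; have mO := measurable_Omega d.
move/(square_integrableP vol mO) : lg => lg; move/(square_integrableP vol mO) : lg' => lg'.
have lB := L2B mO lg lg'.
have : ae_eq vol (Omega d) (fun x => g x - g' x) (cst 0).
  apply: test_orthogonal_ae0 => //; first exact: (L2_rint mO (vol_Omega d)).
  move=> psi tpsi; have [C1psi _] := tpsi.
  have lpsi := continuous_L2_Omega d (C1_continuous C1psi).
  under eq_Rintegral do rewrite mulrBl.
  rewrite RintegralB//; [|exact: L2_mul..].
  by apply/eqP; rewrite subr_eq0 -eqr_opp -Hg// -Hg'.
by apply: filterS => x h Ox; have /eqP := h Ox; rewrite subr_eq0 => /eqP.
Qed.

(** * Linearity and uniqueness of traces *)

Section traces.
Context {R : realType}.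
Variable d : R.
Hypothesis d_gt0 : 0 < d.
Implicit Types (u v g k : space R -> R) (t r : plane R -> R) (i : 'I_3) (c s : R).
Let mO := measurable_Omega d.
Let mC := @measurable_cell R.

Lemma wpartialP u i : H1 d u -> is_weak_partial d i u (wpartial d i u).
Proof. by move=> [_ /(_ i)[g hg]]; exact: (xgetPex (cst 0) (ex_intro [set g | is_weak_partial d i u g] g hg)). Qed.

Lemma H1_L2 u : H1 d u -> L2 vol (Omega d) u.
Proof. by move=> [[_ /(square_integrableP vol mO)]]. Qed.

Lemma weak_partial_L2 u g i : is_weak_partial d i u g -> L2 vol (Omega d) g.
Proof. by move=> [[_ /(square_integrableP vol mO)]]. Qed.

Lemma wpartial_L2 u i : H1 d u -> L2 vol (Omega d) (wpartial d i u).
Proof. by move=> /(wpartialP i); exact: weak_partial_L2. Qed.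

Lemma L2Omega_lin u v c : L2Omega d u -> L2Omega d v -> L2Omega d (fun x => u x + c * v x).
Proof.
move=> [pu /(square_integrableP vol mO) lu] [pv /(square_integrableP vol mO) lv]; split.
  by move=> a b e; have [-> ->] := pu a b e; have [-> ->] := pv a b e.
by apply/(square_integrableP vol mO); apply: L2D => //; exact: L2Z.
Qed.

Lemma weak_partial_lin u v g k c i : L2 vol (Omega d) u -> L2 vol (Omega d) v ->
  is_weak_partial d i u g -> is_weak_partial d i v k ->
  is_weak_partial d i (fun x => u x + c * v x) (fun x => g x + c * k x).
Proof.
move=> lu lv hg hk; have lg := weak_partial_L2 hg; have lk := weak_partial_L2 hk.
move: hg hk => [Lg Hg] [Lk Hk].
split; first exact: L2Omega_lin.
move=> psi tpsi; have [C1psi _] := tpsi; have [_ _ cD] := C1psi.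
have lpsi := continuous_L2_Omega d (C1_continuous C1psi).
have lpi := continuous_L2_Omega d (cD i).
have lin f1 f2 f3 : L2 vol (Omega d) f1 -> L2 vol (Omega d) f2 -> L2 vol (Omega d) f3 ->
    \int[vol]_(x in Omega d) ((f1 x + c * f2 x) * f3 x) =
    \int[vol]_(x in Omega d) (f1 x * f3 x) + c * \int[vol]_(x in Omega d) (f2 x * f3 x).
  move=> l1 l2 l3; rewrite -RintegralZl//; last exact: L2_mul.
  rewrite -RintegralD//; [|exact: L2_mul|by apply: rintZ => //; exact: L2_mul].
  by apply: eq_Rintegral => x _; ring.
by rewrite !lin// Hg// Hk//; ring.
Qed.

Lemma H1_lin u v c : H1 d u -> H1 d v -> H1 d (fun x => u x + c * v x).
Proof.
move=> hu hv; split; first by apply: L2Omega_lin; [exact: hu.1|exact: hv.1].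
move=> i; exists (fun x => wpartial d i u x + c * wpartial d i v x).
by apply: weak_partial_lin; [exact: H1_L2|exact: H1_L2|exact: wpartialP|exact: wpartialP].
Qed.

Lemma wpartial_eq u g i : is_weak_partial d i u g -> ae_eq vol (Omega d) (wpartial d i u) g.
Proof.
move=> hg; apply: (@weak_partial_unique R d i u) => //.
exact: (xgetPex (cst 0) (ex_intro [set g | is_weak_partial d i u g] g hg)).
Qed.

Lemma wpartial_lin u v c i : H1 d u -> H1 d v ->
  ae_eq vol (Omega d) (wpartial d i (fun x => u x + c * v x))
    (fun x => wpartial d i u x + c * wpartial d i v x).
Proof.
move=> hu hv; apply: wpartial_eq.
by apply: weak_partial_lin; [exact: H1_L2|exact: H1_L2|exact: wpartialP|exact: wpartialP].
Qed.

Lemma partial_lin u v c i x : differentiable u x -> differentiable v x ->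
  partial i (fun x => u x + c * v x) x = partial i u x + c * partial i v x.
Proof.
move=> du dv; rewrite /partial.
have h1 := @diff_derivable R _ _ u x (basis3 i) du.
have h2 := @diff_derivable R _ _ v x (basis3 i) dv.
have := @deriveD R _ _ u (c \*: v) x (basis3 i) h1 (derivableZ (k := c) h2).
by rewrite deriveZ.
Qed.

Lemma C1_lin u v c : C1 u -> C1 v -> C1 (fun x => u x + c * v x).
Proof.
move=> [pu du cu] [pv dv cv]; split.
- by move=> a b e; have [-> ->] := pu a b e; have [-> ->] := pv a b e.
- by move=> x; apply: differentiableD => //; exact: differentiableZ.
- move=> i; rewrite (_ : partial i _ = fun x => partial i u x + c * partial i v x); last first.
    by apply/funext => x; exact: partial_lin.
  by apply: continuous_add => //; apply: continuous_mul => // x; exact: cvg_cst.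
Qed.

(** Convergence of extended-valued norms is traded for convergence of
    real-valued integrals, to which cvgL2_mul applies. *)
Lemma is_traceP s u t : H1 d u -> is_trace d s u t <->
  periodic2 t /\ exists u_ : nat -> space R -> R,
    [/\ forall n, C1 (u_ n), cvgL2 vol (Omega d) u_ u,
        forall i, cvgL2 vol (Omega d) (fun n => partial i (u_ n)) (wpartial d i u) &
        cvgL2 area cell (fun n y => u_ n (y, s)) t].
Proof.
move=> hu; have lu := H1_L2 hu.
have LC (u_ : nat -> space R -> R) : (forall n, C1 (u_ n)) -> [/\ forall n, L2 vol (Omega d) (u_ n),
    forall i n, L2 vol (Omega d) (partial i (u_ n)) & forall n, L2 area cell (fun y => u_ n (y, s))].
  move=> Cu; split => [n|i n|n].
  - exact: continuous_L2_Omega (C1_continuous (Cu n)).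
  - by apply: continuous_L2_Omega; have [_ _] := Cu n; apply.
  - by apply: continuous_L2_cell; apply: continuous_slice; exact: C1_continuous.
split.
- move=> [[pt /(square_integrableP area mC) lt] [u_ [Cu [cu cpu] ct]]]; split => //.
  have [l1 l2 l3] := LC u_ Cu; exists u_; split => //.
  + by apply/(L2norm_cvg0 mO).
  + by move=> i; apply/(L2norm_cvg0 mO) => //; [exact: wpartial_L2|exact: cpu].
  + by apply/(L2norm_cvg0 mC).
- move=> [pt [u_ [Cu cu cpu ct]]]; have [l1 l2 l3] := LC u_ Cu.
  have [_ lt _] := ct.
  split; first by split => //; apply/(square_integrableP area mC).
  exists u_; split => //; first split.
  + by apply/(L2norm_cvg0 mO).
  + by move=> i; apply/(L2norm_cvg0 mO) => //; exact: wpartial_L2.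
  + by apply/(L2norm_cvg0 mC).
Qed.

Lemma is_trace_approximable s u t : H1 d u -> is_trace d s u t ->
  approximable d s u (wpartial d e3 u) t.
Proof. by move=> hu /(is_traceP _ _ hu)[_ [u_ [Cu cu cpu ct]]]; exists u_; split. Qed.

Lemma cvgL2_ae dd (T : measurableType dd) (mu : {measure set T -> \bar R}) (D : set T)
    (u_ : nat -> T -> R) (f g : T -> R) : measurable D -> ae_eq mu D f g -> measurable_fun D g ->
  cvgL2 mu D u_ f -> cvgL2 mu D u_ g.
Proof.
move=> mD fg mg [lu lf uf]; have lg := ae_eq_L2 mD fg mg lf; split=> //.
rewrite (_ : (fun n => _) = (fun n => \int[mu]_(x in D) (u_ n x - f x) ^+ 2))//.
apply/funext => n; apply: eq_Rintegral_ae => //.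
- exact: rint_measurable (L2B mD (lu n) lg).2.
- exact: rint_measurable (L2B mD (lu n) lf).2.
- by apply: filterS fg => x h Dx; rewrite h.
Qed.

Lemma is_trace_lin s u v t r c : H1 d u -> H1 d v -> is_trace d s u t -> is_trace d s v r ->
  is_trace d s (fun x => u x + c * v x) (fun y => t y + c * r y).
Proof.
move=> hu hv /(is_traceP _ _ hu)[pt [u_ [Cu cu cpu ct]]] /(is_traceP _ _ hv)[pr [v_ [Cv cv cpv cr]]].
have huv := H1_lin c hu hv.
apply/(is_traceP _ _ huv); split.
  by move=> a b; have [-> ->] := pt a b; have [-> ->] := pr a b.
exists (fun n x => u_ n x + c * v_ n x); split.
- by move=> n; exact: C1_lin.
- by apply: cvgL2D => //; exact: cvgL2Z.
- move=> i; apply: (cvgL2_ae mO (ae_eq_sym (wpartial_lin c i hu hv))).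
    by have [] := wpartial_L2 i huv.
  rewrite (_ : (fun n => _) = fun n x => partial i (u_ n) x + c * partial i (v_ n) x).
    by apply: cvgL2D => //; exact: cvgL2Z.
  apply/funext => n; apply/funext => x; apply: partial_lin.
    by have [_ du _] := Cu n.
  by have [_ dv _] := Cv n.
- by apply: (@cvgL2D _ _ _ area cell); [exact: mC|exact: ct|exact: (cvgL2Z mC)].
Qed.

(** The difference of two traces is a trace of the zero function. Green's
    formula with the weight d - x3, which vanishes at the other end, expresses
    the square integral of a trace by the function and its derivative. *)
Lemma trace_unique u t t' : H1 d u -> is_trace d 0 u t -> is_trace d 0 u t' ->
  ae_eq area cell t t'.
Proof.
move=> hu tt tt'.
have at_ : approximable d 0 (fun=> 0) (fun=> 0) (fun y => t y - t' y).
  have [u_ [Cu cu cpu ct]] := is_trace_approximable hu tt.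
  have [v_ [Cv cv cpv cr]] := is_trace_approximable hu tt'.
  exists (fun n x => u_ n x + -1 * v_ n x); split.
  - by move=> n; exact: C1_lin.
  - have := cvgL2B mO cu cv; congr (cvgL2 _ _ _ _).
      by apply/funext => n; apply/funext => x; rewrite mulN1r.
    by apply/funext => x; rewrite subrr.
  - have := cvgL2B mO cpu cpv; congr (cvgL2 _ _ _ _).
      apply/funext => n; apply/funext => x; rewrite partial_lin ?mulN1r//.
        by have [_ du _] := Cu n.
      by have [_ dv _] := Cv n.
    by apply/funext => x; rewrite subrr.
  - have := cvgL2B mC ct cr; congr (cvgL2 _ _ _ _).
    by apply/funext => n; apply/funext => x; rewrite mulN1r.
pose p (s : R) := d - s; pose q (s : R) := (-1 : R).
have cp : continuous p by move=> s; apply: cvgB; [exact: cvg_cst|exact: cvg_id].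
have cq : continuous q by move=> s; exact: cvg_cst.
have dp s : 0 < s < d -> is_derive s (1 : R) p (q s).
  by move=> _; apply: is_derive_eq; rewrite ?(add0r, mul1r, mulN1r).
have := green_at0 d_gt0 cp cq dp (subrr d) at_ at_.
rewrite (@eq_Rintegral _ _ _ _ _ (cst 0)) => [|x _]; last by rewrite /=; ring.
rewrite Rintegral_cst// mul0r /p subr0 => /esym/eqP; rewrite mulf_eq0 oppr_eq0 gt_eqF//=.
move=> /eqP e0; have [_ _ lt] := approximable_L2 at_.
have := @Rintegral_ge0_eq0 _ _ _ area cell mC (fun y => (t y - t' y) ^+ 2) lt.2 (fun _ _ => sqr_ge0 _).
rewrite (_ : \int[area]_(x in cell) _ = 0) ?lexx; last first.
  by rewrite -[RHS]e0; apply: eq_Rintegral => y _; rewrite expr2.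
move=> /(_ isT); apply: filterS => y h Cy.
by have /eqP := h Cy; rewrite sqrf_eq0 subr_eq0 => /eqP.
Qed.

End traces.

(** * Existence of the trace on the bottom *)

Section columns.
Context {R : realType}.
Variable d : R.
Hypothesis d_gt0 : 0 < d.
Notation leb := (@lebesgue_measure R).
Notation mR := (measurableTypeR R).
Let mO := measurable_Omega d.
Let mC := @measurable_cell R.
Let mI : measurable (`]0, d[%classic : set mR). Proof. exact: measurable_itv. Qed.
Let fO := vol_Omega d.

Lemma leb_itv : leb (`]0, d[%classic : set mR) = d%:E.
Proof. by rewrite lebesgue_measure_itv/= lte_fin d_gt0 oppr0 adde0. Qed.

Lemma leb_itv_lty : (leb (`]0%R, d[%classic : set mR) < +oo)%E.
Proof. by rewrite leb_itv ltry. Qed.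

(** The integral over a vertical line; it is square integrable on the cell by
    Cauchy-Schwarz on each line. *)
Definition column (f : space R -> R) (y : plane R) : R := \int[leb]_(s in `]0, d[) f (y, s).

Lemma measurable_section (f : space R -> R) y : measurable_fun (Omega d) f -> cell y ->
  measurable_fun (`]0, d[%classic : set mR) (fun s => f (y, s)).
Proof.
move=> mf Cy.
have : measurable_fun setT (f \_ (Omega d)) by apply/(measurable_restrictT _ mO).
move=> /(@measurable_fun_pair2 _ _ _ (mR * mR)%type mR _ _ y) => mfy.
apply/(measurable_restrictT _ mI).
apply: eq_measurable_fun mfy => s _.
rewrite !patchE; have [Is|Is] := pselect (`]0, d[%classic s).
  by rewrite !mem_set.
by rewrite !memNset//= => -[].
Qed.

Lemma integrable_column f : vol.-integrable (Omega d) (EFin \o f) ->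
  area.-integrable cell (EFin \o column f).
Proof. by move=> fi; exact: (@integrable_Rintegral1 _ _ _ _ R area_fun leb cell `]0, d[%classic mC mI f). Qed.

Lemma column_section_integrable f : vol.-integrable (Omega d) (EFin \o f) ->
  {ae area, forall y, cell y -> leb.-integrable `]0, d[ (fun s => (f (y, s))%:E)}.
Proof. by move=> fi; exact: (@integrable_section1 _ _ _ _ R area_fun leb cell `]0, d[%classic mC mI f). Qed.

Lemma column_bound f : L2 vol (Omega d) f ->
  L2 area cell (column f) /\
  \int[area]_(y in cell) (column f y ^+ 2) <= d * \int[vol]_(x in Omega d) (f x ^+ 2).
Proof.
move=> lf; have fi := L2_rint mO fO lf; have [mf f2] := lf.
have mc : measurable_fun cell (column f) by exact: rint_measurable (integrable_column fi).
pose H y := (\int[leb]_(s in `]0%R, d[) (f (y, s) ^+ 2)%:E)%E.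
have iH : area.-integrable cell H.
  exact: (@integrable_inner1 _ _ _ _ R area_fun leb cell `]0, d[%classic mC mI (fun x => f x ^+ 2) f2).
have H0 y : (0 <= H y)%E by apply: integral_ge0 => s _; rewrite lee_fin sqr_ge0.
have cH y : cell y -> ((column f y ^+ 2)%:E <= d%:E * H y)%E.
  move=> Cy; have ms := measurable_section mf Cy.
  have [Hy|Hy] := eqVneq (H y) +oo%E.
    by rewrite Hy mulry gtr0_sg// mul1e leey.
  have Hfin : (H y < +oo)%E by rewrite ltey.
  have l2s : L2 leb `]0, d[ (fun s => f (y, s)).
    split => //; apply/integrableP; split.
      by apply/measurable_EFinP; exact: measurable_funX.
    rewrite (eq_integral (fun s => (f (y, s) ^+ 2)%:E))//= => s _.
    by rewrite ger0_norm// sqr_ge0.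
  have l21 := @L2_cst _ _ R leb `]0, d[%classic mI leb_itv_lty 1.
  have := Cauchy_Schwarz mI l2s l21.
  rewrite (@eq_Rintegral _ _ _ leb _ (fun s => f (y, s))) => [|s _]; last by rewrite mulr1.
  rewrite (@eq_Rintegral _ _ _ leb _ (cst 1) (fun s => cst 1 s ^+ 2)) => [|s _]; last by rewrite expr1n.
  have -> : \int[leb]_(s in `]0, d[) cst 1 s = d.
    by rewrite Rintegral_cst// mul1r; exact: (congr1 fine leb_itv).
  have HE : H y = (\int[leb]_(s in `]0%R, d[) (f (y, s) ^+ 2)%R)%:E.
    rewrite /Rintegral fineK; first by [].
    by rewrite ge0_fin_numE; [exact: Hfin|exact: H0].
  by rewrite HE -EFinM lee_fin mulrC.
have idH : area.-integrable cell (fun y => d%:E * H y)%E by exact: integrableZl.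
have c2 : area.-integrable cell (EFin \o (fun y => column f y ^+ 2)).
  apply: (le_integrable mC _ _ idH).
    by apply/measurable_EFinP; exact: measurable_funX.
  move=> y Cy /=; rewrite ger0_norm ?sqr_ge0// gee0_abs; first exact: cH.
  by rewrite mule_ge0// lee_fin ltW.
split; first by split.
have d2 : (0 <= d%:E)%E by rewrite lee_fin ltW.
rewrite -lee_fin EFinM /Rintegral !fineK; try exact: integrable_fin_num.
have -> : (\int[vol]_(x in Omega d) (f x ^+ 2)%:E = \int[area]_(y in cell) H y)%E.
  have := @Rintegral_prod1 _ _ _ _ R area_fun leb cell `]0, d[%classic mC mI (fun x => f x ^+ 2) f2.
  move=> e; rewrite -(fineK (integrable_fin_num mO f2)) -(fineK (integrable_fin_num mC iH)); congr EFin.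
  apply: (etrans e); congr fine.
  apply: ae_eq_integral => //.
  - exact: measurable_int (integrable_column f2).
  - exact: measurable_int iH.
  - have hae := column_section_integrable f2.
    apply: (@filterS _ _ (ae_filter_ringOfSetsType area) _ _ _ hae) => y h Cy /=.
    by rewrite /Rintegral fineK//; exact: (integrable_fin_num mI (h Cy)).
rewrite -integralZl//; apply: ge0_le_integral => //.
- by move=> y _; rewrite lee_fin sqr_ge0.
- exact: measurable_int c2.
- exact: measurable_int idH.
Qed.

Lemma column_cvgL2 (f_ : nat -> space R -> R) f : cvgL2 vol (Omega d) f_ f ->
  cvgL2 area cell (fun n => column (f_ n)) (column f).
Proof.
move=> [lf_ lf cf]; have [lc _] := column_bound lf.
split=> [n||//]; [by have [] := column_bound (lf_ n)|exact: lc|].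
have h : d * \int[vol]_(x in Omega d) (f_ n x - f x) ^+ 2 @[n --> \oo] --> 0.
  by rewrite -(mulr0 d); apply: cvgM => //; exact: cvg_cst.
apply: (squeeze_cvgr _ (cvg_cst 0) h); near=> n; apply/andP; split.
  by apply: Rintegral_ge0 => x _; exact: sqr_ge0.
have [lcn _] := column_bound (lf_ n).
have [lB bB] := column_bound (L2B mO (lf_ n) lf).
apply: le_trans bB; rewrite le_eqVlt; apply/orP; left; apply/eqP.
apply: eq_Rintegral_ae => //.
- exact: rint_measurable (L2B mC lcn lc).2.
- exact: rint_measurable lB.2.
- have h1 := column_section_integrable (L2_rint mO fO lf).
  have h2 := column_section_integrable (L2_rint mO fO (lf_ n)).
  apply: (@filterS2 _ _ (ae_filter_ringOfSetsType area) _ _ _ _ h1 h2) => y {}h1 {}h2 Cy.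
  by rewrite /column RintegralB//; [exact: h2|exact: h1].
Unshelve. all: by end_near. Qed.

(** By the fundamental theorem of calculus on vertical lines, the values at 0 of
    the approximating functions are their values at d minus the columns of
    their vertical derivatives, and both terms converge. *)
Lemma trace_exists u t1 : H1 d u -> is_trace d d u t1 -> exists t, is_trace d 0 u t.
Proof.
move=> hu /(is_traceP d t1 hu)[pt1 [u_ [Cu cu cpu ct]]].
exists (fun y => t1 y - column (wpartial d e3 u) y).
apply/(is_traceP 0 _ hu); split.
  move=> a b; have [-> ->] := pt1 a b.
  have [[pg _] _] := wpartialP e3 hu.
  by split; congr (_ - _); apply: eq_Rintegral => s _; have [h1 h2] := pg a b s; rewrite ?h1 ?h2.
exists u_; split => //.
have := cvgL2B mC ct (column_cvgL2 (cpu e3)); congr (cvgL2 _ _ _ _).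
apply/funext => n; apply/funext => y; have [_ du cd] := Cu n.
have cun := C1_continuous (Cu n).
suff -> : column (partial e3 (u_ n)) y = u_ n (y, d) - u_ n (y, 0) by rewrite subKr.
apply: (@FTC_itv R d (fun s => partial e3 (u_ n) (y, s)) (fun s => u_ n (y, s))) => //.
- exact: (@continuous_curry2 (R * R)%type R R _ y (cd e3)).
- exact: (@continuous_curry2 (R * R)%type R R _ y cun).
- by move=> s _; exact: is_derive_line.
Qed.

End columns.

(** * Functions of the height *)

Section vertical_functions.
Context {R : realType}.
Variable d : R.
Hypothesis d_gt0 : 0 < d.
Notation leb := (@lebesgue_measure R).
Notation mR := (measurableTypeR R).
Let mO := measurable_Omega d.
Let mC := @measurable_cell R.
Let fO := vol_Omega d.
Let fC := @area_cell R.

Let mI (a b : R) (l r : bool) : measurable ([set` Interval (BSide l a) (BSide r b)] : set mR).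
Proof. exact: measurable_itv. Qed.

Lemma is_derive_line1 (u : space R -> R) (t b s : R) : differentiable u (t, b, s) ->
  is_derive t (1 : R) (fun t => u (t, b, s)) (partial e1 u (t, b, s)).
Proof.
move=> du; have dv := @diff_derivable R _ _ u (t, b, s) (basis3 e1) du.
have E : (fun h : R => h^-1 *: ((u \o shift (t, b, s)) (h *: basis3 e1) - u (t, b, s))) =
   (fun h : R => h^-1 *: (((fun t => u (t, b, s)) \o shift t) (h *: 1) - u (t, b, s))).
  apply/funext => h /=; congr (_ *: (u _ - _)).
  rewrite /basis3/= /GRing.add/= /GRing.scale/= /add_pair /scale_pair/= /GRing.add/= /GRing.scale/= /add_pair /scale_pair/=.
  have z (x : R) : h * 0 + x = x by rewrite mulr0 add0r.
  by congr (_, _, _); exact: z.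
by split; [rewrite /derivable -E|rewrite /partial /derive E].
Qed.

Lemma is_derive_line2 (u : space R -> R) (a t s : R) : differentiable u (a, t, s) ->
  is_derive t (1 : R) (fun t => u (a, t, s)) (partial e2 u (a, t, s)).
Proof.
move=> du; have dv := @diff_derivable R _ _ u (a, t, s) (basis3 e2) du.
have E : (fun h : R => h^-1 *: ((u \o shift (a, t, s)) (h *: basis3 e2) - u (a, t, s))) =
   (fun h : R => h^-1 *: (((fun t => u (a, t, s)) \o shift t) (h *: 1) - u (a, t, s))).
  apply/funext => h /=; congr (_ *: (u _ - _)).
  rewrite /basis3/= /GRing.add/= /GRing.scale/= /add_pair /scale_pair/= /GRing.add/= /GRing.scale/= /add_pair /scale_pair/=.
  have z (x : R) : h * 0 + x = x by rewrite mulr0 add0r.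
  by congr (_, _, _); exact: z.
by split; [rewrite /derivable -E|rewrite /partial /derive E].
Qed.

Lemma FTC_co (f F : R -> R) : continuous f -> continuous F ->
  (forall s, is_derive s (1 : R) F (f s)) -> F 1 = F 0 ->
  \int[leb]_(s in `[0, 1[) f s = 0.
Proof.
move=> cf cF dF F10.
have mf : measurable_fun (`]0, 1[%classic : set mR) (EFin \o f).
  by apply/measurable_EFinP; apply: measurable_funTS; exact: continuous_measurable_fun.
have := @FTC_itv R 1 f F ltr01 cf cF (fun s _ => dF s).
rewrite F10 subrr => e0; rewrite -[RHS]e0.
by rewrite /Rintegral (@integral_itv_bndoo R 0 1 _ true true mf).
Qed.

Lemma continuous_integrable_Omega f : continuous f -> vol.-integrable (Omega d) (EFin \o f).
Proof. by move=> cf; exact: (L2_rint mO fO (continuous_L2_Omega d cf)). Qed.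

(** A horizontal derivative integrates to zero over a period, on each line. *)
Lemma horizontal_orthogonal (f : R -> R) psi (i : 'I_3) : continuous f -> C1 psi -> i != e3 ->
  \int[vol]_(x in Omega d) (f x.2 * partial i psi x) = 0.
Proof.
move=> cf Cpsi i3; have [ppsi dpsi cpsi] := Cpsi; have cpsi0 := C1_continuous Cpsi.
have cF : continuous (fun x => f x.2 * partial i psi x).
  by apply: continuous_mul => //; exact: continuous_x3.
have iF := continuous_integrable_Omega cF.
rewrite (@Rintegral_prod2 _ _ _ _ R area_fun leb cell `]0, d[%classic mC (mI _ _ _ _) _ iF).
rewrite (@eq_Rintegral _ _ _ _ _ (cst 0)); first by rewrite Rintegral_cst// mul0r.
move=> s _ /=.
have ci : area_fun.-integrable cell (EFin \o (fun y => f s * partial i psi (y, s))).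
  apply: (L2_rint mC fC); apply: continuous_L2_cell; apply: continuous_mul.
    by move=> y; exact: cvg_cst.
  exact: continuous_slice.
have ci' : area_fun.-integrable cell (EFin \o (fun y => partial i psi (y, s))).
  by apply: (L2_rint mC fC); apply: continuous_L2_cell; exact: continuous_slice.
rewrite (@RintegralZl _ _ _ _ _ _ _ mC ci').
suff -> : \int[area_fun]_(y in cell) partial i psi (y, s) = 0 by rewrite mulr0.
have := cpsi i; have := i3.
case: (ord3E i) ci' => -> ci' // _ cdi.
- rewrite (@Rintegral_prod2 _ _ _ _ R leb leb `[0, 1[%classic `[0, 1[%classic (mI _ _ _ _) (mI _ _ _ _) _ ci').
  rewrite (@eq_Rintegral _ _ _ _ _ (cst 0)); first by rewrite Rintegral_cst// mul0r.
  move=> b _ /=; apply: (@FTC_co _ (fun t => psi (t, b, s))).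
  + apply: (@continuous_curry1 R R R (fun y : plane R => partial e1 psi (y, s))).
    exact: continuous_slice.
  + apply: (@continuous_curry1 R R R (fun y : plane R => psi (y, s))); exact: continuous_slice.
  + by move=> t; exact: is_derive_line1.
  + by have [h _] := ppsi 0 b s; rewrite -h add0r.
- rewrite (@Rintegral_prod1 _ _ _ _ R leb leb `[0, 1[%classic `[0, 1[%classic (mI _ _ _ _) (mI _ _ _ _) _ ci').
  rewrite (@eq_Rintegral _ _ _ _ _ (cst 0)); first by rewrite Rintegral_cst// mul0r.
  move=> b _ /=; apply: (@FTC_co _ (fun t => psi (b, t, s))).
  + apply: (@continuous_curry2 R R R (fun y : plane R => partial e2 psi (y, s))).
    exact: continuous_slice.
  + apply: (@continuous_curry2 R R R (fun y : plane R => psi (y, s))); exact: continuous_slice.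
  + by move=> t; exact: is_derive_line2.
  + by have [_ h] := ppsi b 0 s; rewrite -h add0r.
Qed.

Section vertical.
Variables f f' : R -> R.
Hypothesis df : forall t : R, is_derive t (1 : R) f (f' t).
Hypothesis cf' : continuous f'.

Let fE : (fun x : space R => f x.2) = prodf (cst 1) (cst 1) f.
Proof. by apply/funext => x; rewrite /prodf !mul1r. Qed.

Let d1 (t : R) : is_derive t (1 : R) (cst (1 : R)) (cst 0 t). Proof. exact: is_derive_cst. Qed.
Let c0 : continuous (cst (0 : R) : R -> R). Proof. by move=> t; exact: cvg_cst. Qed.

Lemma vertical_C1 : C1 (fun x => f x.2).
Proof. by rewrite fE; exact: (C1_prodf d1 d1 df c0 c0 cf'). Qed.

Definition vertical_partial (i : 'I_3) (x : space R) : R := if i == e3 then f' x.2 else 0.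

Lemma vertical_partialE i : partial i (fun x => f x.2) = vertical_partial i.
Proof.
apply/funext => x; rewrite fE (prodf_partial d1 d1 df) /vertical_partial.
by case: (ord3E i) => -> /=; rewrite !(mul0r, mulr0, mul1r).
Qed.

Lemma test_function_bounds psi (y : plane R) : test_function d psi -> psi (y, 0) = 0 /\ psi (y, d) = 0.
Proof.
move=> [_ [a [b [a0 bd h]]]]; split; apply/eqP/negPn/negP => /h /=.
  by rewrite leNgt a0.
by rewrite [X in _ && X]leNgt bd andbF.
Qed.

Lemma vertical_weak_partial i : is_weak_partial d i (fun x => f x.2) (vertical_partial i).
Proof.
split.
  split; first by move=> a b c; rewrite /vertical_partial.
  apply/(square_integrableP vol mO); apply: continuous_L2_Omega.
  by rewrite -vertical_partialE; have [_ _] := vertical_C1; apply.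
move=> psi tpsi; have [Cpsi _] := tpsi.
have [i3|i3] := eqVneq i e3; last first.
  rewrite horizontal_orthogonal//; last exact: is_derive_continuous df.
  rewrite (@eq_Rintegral _ _ _ _ _ (cst 0)); first by rewrite Rintegral_cst// mul0r oppr0.
  by move=> x _; rewrite /vertical_partial (negbTE i3) mul0r.
have c1 : continuous (cst (1 : R) : R -> R) by move=> t; exact: cvg_cst.
have := green_C1 d_gt0 c1 c0 (fun s _ => d1 s) vertical_C1 Cpsi.
rewrite vertical_partialE /vertical_partial eqxx i3 => h.
have cpsi := C1_continuous Cpsi; have [_ _ cdpsi] := Cpsi.
have cf3 := continuous_x3 (is_derive_continuous df); have cf'3 := continuous_x3 cf'.
apply/eqP; rewrite -subr_eq0 opprK -RintegralD//; try exact: continuous_integrable_Omega (continuous_mul _ _).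
rewrite (@eq_Rintegral _ _ _ vol _ (fun x => cst 1 x.2 * f x.2 * partial e3 psi x +
  cst 1 x.2 * psi x * f' x.2 + cst 0 x.2 * f x.2 * psi x)); last by move=> x _ /=; ring.
rewrite h (@eq_Rintegral _ _ _ _ _ (cst 0)); first by rewrite Rintegral_cst// mul0r.
by move=> y _; have [-> ->] := test_function_bounds y tpsi; rewrite !mulr0 subrr.
Qed.

Lemma vertical_H1 : H1 d (fun x => f x.2).
Proof.
split; last by move=> i; exists (vertical_partial i); exact: vertical_weak_partial.
split; first by [].
apply/(square_integrableP vol mO); apply: continuous_L2_Omega.
exact: continuous_x3 (is_derive_continuous df).
Qed.

Lemma vertical_trace s : is_trace d s (fun x => f x.2) (fun=> f s).
Proof.
apply/(is_traceP s _ vertical_H1); split; first by [].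
exists (fun=> (fun x => f x.2)); split.
- by move=> _; exact: vertical_C1.
- by apply: (cvgL2_cst mO); apply: H1_L2; exact: vertical_H1.
- move=> i; rewrite vertical_partialE.
  have [lw _] := wpartial_L2 i vertical_H1.
  apply: (cvgL2_ae mO (ae_eq_sym (wpartial_eq d_gt0 (vertical_weak_partial i)))) => //.
  by apply: (cvgL2_cst mO); exact: weak_partial_L2 (vertical_weak_partial i).
- by apply: (cvgL2_cst mC); exact: (L2_cst mC fC (f s)).
Qed.

Lemma vertical_H1P : f d = 0 -> H1P d (fun x => f x.2).
Proof. by move=> fd; split; [exact: vertical_H1|have := vertical_trace d; rewrite fd]. Qed.

End vertical.

Section H1P_facts.
Implicit Types (u v : space R -> R).

Lemma H1P_trace u : H1P d u -> is_trace d 0 u (trace d 0 u).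
Proof.
move=> [hu td]; have [t ht] := trace_exists d_gt0 hu td.
exact: (xgetPex (cst 0) (ex_intro [set t | is_trace d 0 u t] t ht)).
Qed.

Lemma trace_L2 u : H1P d u -> L2 area cell (trace d 0 u).
Proof. by move=> /H1P_trace[[_ /(square_integrableP area mC)]]. Qed.

Lemma trace_eq u t : H1P d u -> is_trace d 0 u t -> ae_eq area cell (trace d 0 u) t.
Proof. by move=> hu; apply: trace_unique => //; [exact: hu.1|exact: H1P_trace]. Qed.

Lemma H1P_lin u v c : H1P d u -> H1P d v -> H1P d (fun x => u x + c * v x).
Proof.
move=> [hu tu] [hv tv]; split; first exact: H1_lin.
have := is_trace_lin d_gt0 c hu hv tu tv; congr is_trace.
by apply/funext => y; rewrite /= mulr0 addr0.
Qed.

Lemma trace_lin u v c : H1P d u -> H1P d v ->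
  ae_eq area cell (trace d 0 (fun x => u x + c * v x)) (fun y => trace d 0 u y + c * trace d 0 v y).
Proof.
move=> hu hv; apply: trace_eq; first exact: H1P_lin.
by apply: is_trace_lin; [exact: d_gt0|exact: hu.1|exact: hv.1|exact: H1P_trace..].
Qed.

Variables p q : R -> R.
Hypotheses (cp : continuous p) (cq : continuous q)
  (dp : forall s, 0 < s < d -> is_derive s (1 : R) p (q s)).

(** The boundary terms of Green's formula on the Dirichlet side vanish. *)
Lemma green_H1P_sqr u : H1P d u ->
  \int[vol]_(x in Omega d) (2 * (p x.2 * u x * wpartial d e3 u x) + q x.2 * u x ^+ 2) =
  - p 0 * \int[area]_(y in cell) (trace d 0 u y ^+ 2).
Proof.
move=> hu.
have a0 := is_trace_approximable hu.1 (H1P_trace hu).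
have ad := is_trace_approximable hu.1 hu.2.
have := green d_gt0 cp cq dp a0 a0 ad ad.
rewrite (@eq_Rintegral _ _ _ area _ (cst 0) (fun y => cst 0 y * cst 0 y)); last by move=> y _; rewrite /= mulr0.
rewrite Rintegral_cst// mul0r mulr0 sub0r -mulNr => <-.
by apply: eq_Rintegral => x _; ring.
Qed.

Lemma green_H1P_lin u : H1P d u ->
  \int[vol]_(x in Omega d) (p x.2 * wpartial d e3 u x + q x.2 * u x) =
  - p 0 * \int[area]_(y in cell) trace d 0 u y.
Proof.
move=> hu.
have a0 := is_trace_approximable hu.1 (H1P_trace hu).
have ad := is_trace_approximable hu.1 hu.2.
have d1 (t : R) : is_derive t (1 : R) (cst (1 : R)) (cst 0 t) by exact: is_derive_cst.
have c0 : continuous (cst (0 : R) : R -> R) by move=> t; exact: cvg_cst.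
have k1 s : approximable d s (fun=> 1) (fun=> 0) (fun=> 1).
  have C1c := vertical_C1 d1 c0.
  exists (fun=> (fun=> 1)); split => //.
  - by apply: (cvgL2_cst mO); exact: L2_cst.
  - rewrite (vertical_partialE d1) /vertical_partial eqxx.
    by apply: (cvgL2_cst mO); exact: L2_cst.
  - by apply: (cvgL2_cst mC); exact: L2_cst.
have := green d_gt0 cp cq dp (k1 0) a0 (k1 d) ad.
rewrite (@eq_Rintegral _ _ _ area _ (cst 0) (fun y => 1 * cst 0 y)); last by move=> y _; rewrite /= mulr0.
rewrite Rintegral_cst// mul0r mulr0 sub0r -mulNr.
under [X in _ = _ * X -> _]eq_Rintegral do rewrite mul1r.
by move=> <-; apply: eq_Rintegral => x _; ring.
Qed.

End H1P_facts.

End vertical_functions.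

(** * Jacobi's inequality *)

Section Jacobi.
Context {R : realType}.
Variable d : R.
Hypothesis d_gt0 : 0 < d.
Let mO := measurable_Omega d.

(** Functions given on [0, d] are composed with clamp to make them continuous
    on the whole line. *)
Definition clamp (s : R) : R := Num.max 0 (Num.min s d).

Lemma clamp_itv s : 0 <= clamp s <= d.
Proof. by rewrite /clamp le_max lexx/= ge_max (ltW d_gt0) ge_min lexx orbT. Qed.

Lemma clamp_id s : 0 <= s <= d -> clamp s = s.
Proof. by move=> /andP[s0 sd]; rewrite /clamp min_l// max_r. Qed.

Lemma continuous_clamp : continuous clamp.
Proof.
move=> s; apply: (@continuous_max _ _ (cst 0) (fun s => Num.min s d)); first exact: cvg_cst.
by apply: (@continuous_min _ _ (fun s => s) (cst d)); [exact: cvg_id|exact: cvg_cst].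
Qed.

Lemma near_clamp_id s : 0 < s < d -> \near s, clamp s = s.
Proof.
move=> /andP[s0 sd]; near=> t; apply: clamp_id; apply/andP; split; apply: ltW; near: t.
  exact: lt_nbhsr.
exact: lt_nbhsl.
Unshelve. all: by end_near. Qed.

Variables (phi phi' phi'' kappa : R -> R) (lambda K : R).
Hypotheses (cphi : continuous phi) (cphi' : continuous phi') (cphi'' : continuous phi'').
Hypothesis dphi : forall s, 0 < s < d -> is_derive s (1 : R) phi (phi' s).
Hypothesis dphi' : forall s, 0 < s < d -> is_derive s (1 : R) phi' (phi'' s).
Hypothesis phi_ge0 : forall s, 0 <= s <= d -> 0 <= phi s.
Hypothesis phi_gt0 : forall s, 0 <= s < d -> 0 < phi s.
Hypothesis kappaE : forall s, 0 < s < d -> phi'' s = - (kappa s * phi s).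
Hypothesis kappaK : forall s, 0 < s < d -> 0 <= kappa s <= K.
Hypothesis lambdaE : phi' 0 = - (lambda * phi 0).

Section eps.
Variable e : R.
Hypothesis e_gt0 : 0 < e.

Let den_gt0 s : 0 <= s <= d -> 0 < phi s + e.
Proof. by move=> hs; rewrite ltr_wpDl// phi_ge0. Qed.

Let p0 s := phi' s / (phi s + e).
Let q0 s := (phi'' s * (phi s + e) - phi' s ^+ 2) / (phi s + e) ^+ 2.

Let cden : continuous (fun s => phi s + e).
Proof. by move=> s; apply: cvgD; [exact: cphi|exact: cvg_cst]. Qed.

Let continuous_clamped (f : R -> R) : (forall s, 0 <= s <= d -> {for s, continuous f}) ->
  continuous (fun s => f (clamp s)).
Proof.
move=> cf s; apply: (@continuous_comp _ _ _ clamp f); first exact: continuous_clamp.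
exact: cf (clamp_itv s).
Qed.

Let cp : continuous (fun s => p0 (clamp s)).
Proof.
apply: continuous_clamped => s hs; apply: cvgM; first exact: cphi'.
by apply: cvgV; [rewrite gt_eqF// den_gt0|exact: cden].
Qed.

Let cq : continuous (fun s => q0 (clamp s)).
Proof.
apply: continuous_clamped => s hs; apply: cvgM.
  apply: cvgB; first by apply: cvgM; [exact: cphi''|exact: cden].
  by apply: cvgM; exact: cphi'.
apply: cvgV; first by rewrite expf_neq0// gt_eqF// den_gt0.
by apply: cvgM; exact: cden.
Qed.

Let dp s : 0 < s < d -> is_derive s (1 : R) (fun s => p0 (clamp s)) (q0 (clamp s)).
Proof.
move=> hs; have /andP[s0 sd] := hs; have hs' : 0 <= s <= d by rewrite (ltW s0) (ltW sd).
rewrite clamp_id//; apply: (@near_eq_is_derive _ _ _ p0).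
  by have := near_clamp_id hs; apply: filterS => t /= ->.
have dn : phi s + e != 0 by rewrite gt_eqF// den_gt0.
have h1 := dphi hs; have h2 := dphi' hs.
have h3 : is_derive s (1 : R) (fun s => phi s + e) (phi' s).
  by apply: is_derive_eq; rewrite addr0.
have h4 := is_deriveM h2 (@is_deriveV R _ s _ _ dn h3).
apply: (@is_derive_eq _ _ _ _ _ _ _ _ h4).
rewrite /q0 /GRing.scale/=; field; exact: dn.
Qed.

Let quot s := - phi'' s / (phi s + e).

Lemma quot_measurable : measurable_fun (Omega d) (fun x : space R => quot x.2).
Proof.
have : measurable_fun (Omega d) (fun x : space R => quot (clamp x.2)).
  have cquot : continuous (fun s => quot (clamp s)).
    apply: continuous_clamped => s hs; apply: cvgM; first by apply: cvgN; exact: cphi''.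
    by apply: cvgV; [rewrite gt_eqF// den_gt0|exact: cden].
  apply: measurable_funTS; apply: continuous_measurable3; exact: (continuous_x3 cquot).
apply: eq_measurable_fun => -[y s] /set_mem[_ /=]; rewrite in_itv/= => /andP[s0 sd].
by rewrite clamp_id// (ltW s0) (ltW sd).
Qed.

Lemma quotE s : 0 < s < d -> quot s = kappa s * (phi s / (phi s + e)).
Proof. by move=> hs; rewrite /quot kappaE// opprK mulrA. Qed.

Lemma ratio_itv s : 0 < s < d -> 0 <= phi s / (phi s + e) <= 1.
Proof.
move=> /andP[s0 sd]; have hs : 0 <= s <= d by rewrite (ltW s0) (ltW sd).
rewrite divr_ge0 ?phi_ge0//=; last exact: ltW (den_gt0 hs).
by rewrite ler_pdivrMr ?den_gt0// mul1r lerDl ltW.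
Qed.

Lemma quot_itv s : 0 < s < d -> 0 <= quot s <= K.
Proof.
move=> hs; rewrite quotE//; have /andP[k0 kK] := kappaK hs; have /andP[r0 r1] := ratio_itv hs.
rewrite mulr_ge0//=; apply: le_trans kK; exact: ler_piMr.
Qed.

Lemma Omega_x3 x : Omega d x -> 0 < x.2 < d.
Proof. by move=> [_ /=]; rewrite in_itv. Qed.

Lemma quot_L2 u : L2 vol (Omega d) u -> L2 vol (Omega d) (fun x => quot x.2 * u x).
Proof.
move=> lu; apply: (L2_bM mO quot_measurable (M := K) _ lu) => x /Omega_x3 hx.
by have /andP[q_0 qK] := quot_itv hx; rewrite ger0_norm.
Qed.

(** Green's formula for p u ^ 2 with p = phi' / (phi + e) turns the integral of
    (w - p u) ^ 2 >= 0, w being the vertical derivative of u, into this bound. *)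
Lemma Jacobi_eps u : H1P d u ->
  \int[vol]_(x in Omega d) (quot x.2 * u x * u x) +
  lambda * (phi 0 / (phi 0 + e)) * \int[area]_(y in cell) (trace d 0 u y ^+ 2) <=
  \int[vol]_(x in Omega d) (wpartial d e3 u x ^+ 2).
Proof.
move=> hu; have lu := H1_L2 hu.1; have lw := wpartial_L2 e3 hu.1.
have h := green_H1P_sqr d_gt0 cp cq dp hu.
have c00 : clamp 0 = 0 by rewrite clamp_id// lexx ltW.
have -> : lambda * (phi 0 / (phi 0 + e)) = - p0 (clamp 0).
  by rewrite c00 /p0 lambdaE mulNr opprK mulrA.
rewrite -h.
have mb (f : R -> R) : continuous f -> forall v, L2 vol (Omega d) v -> L2 vol (Omega d) (fun x => f x.2 * v x).
  move=> cf v lv; have [M HM] := continuous_bounded_Omega d (continuous_x3 cf).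
  apply: (L2_bM mO _ HM lv).
  by apply: measurable_funTS; apply: continuous_measurable3; exact: continuous_x3.
have lpu := mb _ cp _ lu; have lqu := mb _ cq _ lu.
have i1 := L2_mul mO (quot_L2 lu) lu.
have i2 : vol.-integrable (Omega d) (EFin \o (fun x => 2 * (p0 (clamp x.2) * u x * wpartial d e3 u x)
    + q0 (clamp x.2) * u x ^+ 2)).
  apply: rintD => //; first by apply: rintZ => //; exact: L2_mul lpu lw.
  have := L2_mul mO lqu lu; apply: eq_integrable => // x _ /=.
  by rewrite expr2 mulrA.
rewrite -RintegralD//; apply: le_Rintegral => //; [exact: rintD|exact: lw.2|].
move=> x Ox; have := Omega_x3 Ox => /andP[s0 sd].
have hs : 0 <= x.2 <= d by rewrite (ltW s0) (ltW sd).
rewrite clamp_id//; have := sqr_ge0 (wpartial d e3 u x - p0 x.2 * u x).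
have -> : quot x.2 = - (q0 x.2 + p0 x.2 ^+ 2).
  rewrite /quot /q0 /p0; field; rewrite gt_eqF// den_gt0//.
move: (wpartial _ _ _ _) (p0 _) (q0 _) (u x) => w p q v; nra.
Qed.

End eps.

Let eps (n : nat) : R := n.+1%:R^-1.
Let eps_gt0 n : 0 < eps n. Proof. by rewrite invr_gt0. Qed.

Let ratio_cvg s : 0 <= s < d -> phi s / (phi s + eps n) @[n --> \oo] --> (1 : R).
Proof.
move=> hs; have p0 := phi_gt0 hs.
rewrite -[X in _ --> X](divff (lt0r_neq0 p0)); apply: cvgM; first exact: cvg_cst.
apply: cvgV; first exact: lt0r_neq0.
rewrite -[X in _ --> X]addr0; apply: cvgD; first exact: cvg_cst.
exact: cvg_harmonic.
Qed.

Let quot_cvg s : 0 < s < d -> - phi'' s / (phi s + eps n) @[n --> \oo] --> kappa s.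
Proof.
move=> hs; rewrite -[X in _ --> X]mulr1.
under eq_fun do rewrite quotE//.
apply: cvgM; first exact: cvg_cst.
by apply: ratio_cvg; case/andP: hs => /ltW -> ->.
Qed.

Lemma kappa_measurable : measurable_fun (Omega d) (fun x : space R => kappa x.2).
Proof.
apply: (@measurable_fun_cvg _ _ _ (Omega d) (fun n x => - phi'' x.2 / (phi x.2 + eps n))).
  by move=> n; exact: quot_measurable.
by move=> x Ox; apply: quot_cvg; exact: Omega_x3.
Qed.

Lemma kappa_L2 u : L2 vol (Omega d) u -> L2 vol (Omega d) (fun x => kappa x.2 * u x).
Proof.
move=> lu; apply: (L2_bM mO kappa_measurable (M := K) _ lu) => x /Omega_x3 hx.
by have /andP[q_0 qK] := kappaK hx; rewrite ger0_norm.
Qed.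

(** Jacobi's argument: with p = phi' / phi, which solves the Riccati equation
    p' + p ^ 2 = - kappa and p(0) = - lambda, the difference of the two sides
    is the integral of (w - p u) ^ 2, w being the vertical derivative of u.
    Since phi may vanish at d, phi + e replaces phi in the quotient and e
    tends to 0. *)
Lemma Jacobi u : H1P d u ->
  \int[vol]_(x in Omega d) (kappa x.2 * u x * u x) +
  lambda * \int[area]_(y in cell) (trace d 0 u y ^+ 2) <=
  \int[vol]_(x in Omega d) (wpartial d e3 u x ^+ 2).
Proof.
move=> hu; have lu := H1_L2 hu.1.
set B := \int[area]_(y in cell) _; set W := \int[vol]_(x in Omega d) _ ^+ 2.
have c1 : \int[vol]_(x in Omega d) (- phi'' x.2 / (phi x.2 + eps n) * u x * u x) @[n --> \oo] -->
    \int[vol]_(x in Omega d) (kappa x.2 * u x * u x).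
  apply: (@Rdominated_cvg _ _ R vol (Omega d) _ _ (fun x => K * u x ^+ 2)) => //.
  - by move=> n; apply: rint_measurable (L2_mul mO (quot_L2 (eps_gt0 n) lu) lu).
  - by apply: rint_measurable (L2_mul mO (kappa_L2 lu) lu).
  - move=> x /Omega_x3 hx; apply: cvgM; last exact: cvg_cst.
    by apply: cvgM; [exact: quot_cvg|exact: cvg_cst].
  - exact: rintZ lu.2.
  - move=> n x /Omega_x3 hx; have /andP[q_0 qK] := quot_itv (eps_gt0 n) hx.
    rewrite -mulrA -expr2 ger0_norm; last by rewrite mulr_ge0// sqr_ge0.
    by rewrite ler_wpM2r// sqr_ge0.
have c2 : lambda * (phi 0 / (phi 0 + eps n)) * B @[n --> \oo] --> lambda * B.
  have -> : lambda * B = lambda * 1 * B by rewrite mulr1.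
  apply: cvgM; last exact: cvg_cst.
  by apply: cvgM; [exact: cvg_cst|apply: ratio_cvg; rewrite lexx].
have c3 := cvgD c1 c2.
apply: (cvgr_to_le (c3 _)); apply: nearW => n.
exact: Jacobi_eps (eps_gt0 n) u hu.
Qed.

End Jacobi.

(** * The first variation of the energy *)

Section Taylor.
Context {R : realType}.

Lemma sin_le_id (x : R) : 0 <= x -> sin x <= x.
Proof.
rewrite le_eqVlt => /predU1P[<-|x0]; first by rewrite sin0.
have dsin (t : R) : t \in `]0, x[ -> is_derive t (1 : R) (@sin R) (cos t) by move=> _; exact: is_derive_sin.
have csin : {within `[0, x], continuous (@sin R)}.
  by apply: continuous_subspaceT; exact: continuous_sin.
have [c _] := MVT x0 dsin csin.
rewrite sin0 !subr0 => ->; apply: ler_piMl; [exact: ltW|exact: cos_le1].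
Qed.

Lemma norm_sin_le (x : R) : `|sin x| <= `|x|.
Proof.
have pos (y : R) : 0 <= y -> `|sin y| <= y.
  move=> y0; have [y1|y1] := leP y 1.
    have pi2 := @pi_ge2 R.
    rewrite ger0_norm ?sin_le_id// sin_ge0_pi// y0/=; lra.
  by apply: le_trans (ltW y1); rewrite ler_norml sin_geN1 sin_le1.
have [x0|x0] := leP 0 x; first by rewrite (ger0_norm x0) pos.
by rewrite (ltr0_norm x0) -normrN -sinN pos// oppr_ge0 ltW.
Qed.

(** The derivative sin x - sin (x + t) of t |-> cos (x + t) + t sin x has
    absolute value at most |t|, because the sine is 1-Lipschitz. *)
Lemma cos_Taylor (x y : R) : `|cos (x + y) - cos x + y * sin x| <= y ^+ 2.
Proof.
pose g t := cos (x + t) + t * sin x.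
have dg (t : R) : is_derive t (1 : R) g (sin x - sin (x + t)).
  rewrite /g; have h1 : is_derive t (1 : R) (fun t => x + t) 1.
    by have := is_deriveD (is_derive_cst x t 1) (is_derive_id t (1 : R)); rewrite add0r.
  have h2 := is_derive1_comp (is_derive_cos (x + t)) h1.
  have h3 : is_derive t (1 : R) (fun t => t * sin x) (sin x).
    by apply: is_derive_eq; rewrite /GRing.scale/= mulr0 add0r mulr1.
  have h4 := is_deriveD h2 h3; apply: (is_derive_eq h4).
  by rewrite /GRing.scale/= mulr1 addrC.
have cg a b : {within `[a, b], continuous g}.
  apply: continuous_subspaceT => t; apply: differentiable_continuous.
  by apply/derivable1_diffP; have [] := dg t.
have sinL (a b : R) : `|sin a - sin b| <= `|a - b|.
  have -> : sin a - sin b = 2 * (sin ((a - b) / 2) * cos ((a + b) / 2)).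
    have H (p q : R) : sin (p + q) - sin (p - q) = 2 * (sin q * cos p) by rewrite sinD sinB; ring.
    by rewrite -H; congr (sin _ - sin _); lra.
  rewrite !normrM [`|2|]ger0_norm//.
  have h1 := norm_sin_le ((a - b) / 2).
  have h2 : `|cos ((a + b) / 2)| <= 1 by rewrite ler_norml cos_geN1 cos_le1.
  have h3 : `|(a - b) / 2| = `|a - b| / 2 by rewrite normrM [`|2^-1|]ger0_norm// invr_ge0.
  rewrite h3 in h1.
  have h4 : `|sin ((a - b) / 2)| * `|cos ((a + b) / 2)| <= `|a - b| / 2 * 1 by exact: ler_pM.
  lra.
have g0 : g 0 = cos x by rewrite /g addr0 mul0r addr0.
have -> : cos (x + y) - cos x + y * sin x = g y - g 0 by rewrite g0 /g; ring.
have [y0|y0|<-] := ltgtP 0 y; last by rewrite subrr normr0 expr0n.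
- have [c /andP[]] := MVT y0 (fun t _ => dg t) (cg 0 y).
  rewrite !bnd_simp => c0 cy ->.
  rewrite subr0 normrM (gtr0_norm y0) expr2 ler_wpM2r ?(ltW y0)//.
  apply: le_trans (sinL _ _) _; rewrite opprD addNKr normrN gtr0_norm//; exact: ltW.
- have [c /andP[]] := MVT y0 (fun t _ => dg t) (cg y 0).
  rewrite !bnd_simp => c0 cy E.
  rewrite -normrN opprB E sub0r normrM normrN (ltr0_norm y0) -sqrrN expr2 ler_wpM2r ?oppr_ge0 ?(ltW y0)//.
  apply: le_trans (sinL _ _) _; rewrite opprD addNKr normrN ltr0_norm// lerN2; exact: ltW.
Qed.

(** A quadratic remainder determines the derivative, which is how the energy is
    differentiated without exchanging limits and integrals. *)
Lemma quadratic_is_derive (F : R -> R) A C :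
  (forall t, `|F t - F 0 - t * A| <= C * t ^+ 2) -> is_derive (0 : R) (1 : R) F A.
Proof.
move=> FC.
suff h : (fun k : R => k^-1 *: ((F \o shift 0) (k *: (1 : R)) - F 0)) x @[x --> 0^'] --> A.
  by apply: DeriveDef; [apply/cvg_ex; exists A|exact: (cvg_lim (@Rhausdorff R) h)].
apply/cvgrPdist_le => e e0; near=> k => /=.
have k0 : k != 0 by near: k; exact: nbhs_dnbhs_neq.
rewrite addr0 /GRing.scale/= mulr1.
have -> : A - k^-1 * (F k - F 0) = - k^-1 * (F k - F 0 - k * A) by field.
rewrite normrM normrN normfV; have := FC k.
rewrite -ler_pdivlMl ?invr_gt0 ?normr_gt0// invrK => /le_trans; apply.
rewrite -[k ^+ 2]real_normK ?num_real// expr2 mulrCA ler_pM2l ?normr_gt0//.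
apply: (@le_trans _ _ ((`|C| + 1) * `|k|)).
  by rewrite ler_wpM2r// (le_trans (ler_norm _))// lerDl.
rewrite -ler_pdivlMl//.
near: k; apply: dnbhs0_le; rewrite mulr_gt0// invr_gt0 ltr_wpDl//.
Unshelve. all: by end_near. Qed.

Lemma derivative_unique (F : R -> R) a b : is_derive (0 : R) (1 : R) F a ->
  is_derive (0 : R) (1 : R) F b -> a = b.
Proof. by move=> ha hb; rewrite -(@derive_val _ _ _ _ _ _ _ ha) -(@derive_val _ _ _ _ _ _ _ hb). Qed.

End Taylor.

Section cosine_integral.
Context {R : realType} dd (T : measurableType dd) (mu : {measure set T -> \bar R}) (D : set T).
Hypotheses (mD : measurable D) (fD : (mu D < +oo)%E).
Implicit Types f g : T -> R.

Lemma measurable_cos f : measurable_fun D f -> measurable_fun D (fun x => cos (f x)).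
Proof. by move=> mf; apply: measurableT_comp mf; apply: continuous_measurable_fun; exact: continuous_cos. Qed.

Lemma measurable_sin f : measurable_fun D f -> measurable_fun D (fun x => sin (f x)).
Proof. by move=> mf; apply: measurableT_comp mf; apply: continuous_measurable_fun; exact: continuous_sin. Qed.

Lemma rint_potential f : measurable_fun D f -> mu.-integrable D (EFin \o (fun x => cos (2 * f x) + 1)).
Proof.
move=> mf; apply: (rint_bounded mD fD (M := 2)).
  by apply: measurable_funD => //; apply: measurable_cos; exact: measurable_funM.
by move=> x _; have := cos_le1 (2 * f x); have := cos_geN1 (2 * f x); rewrite ler_norml; lra.
Qed.

Lemma L2_sincos f : measurable_fun D f -> L2 mu D (fun x => sin (f x) * cos (f x)).
Proof.
move=> mf; apply: (L2_bounded mD fD (M := 1)).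
  by apply: measurable_funM; [exact: measurable_sin|exact: measurable_cos].
move=> x _; rewrite normrM -[leRHS]mulr1; apply: ler_pM => //.
  by rewrite ler_norml sin_geN1 sin_le1.
by rewrite ler_norml cos_geN1 cos_le1.
Qed.

Lemma potential_Taylor f g t : L2 mu D f -> L2 mu D g ->
  `|\int[mu]_(x in D) (cos (2 * (f x + t * g x)) + 1) - \int[mu]_(x in D) (cos (2 * f x) + 1)
    + 4 * t * \int[mu]_(x in D) (sin (f x) * cos (f x) * g x)|
  <= 4 * t ^+ 2 * \int[mu]_(x in D) (g x ^+ 2).
Proof.
move=> lf lg; have lfg := L2D mD lf (L2Z mD t lg).
have i1 := rint_potential lfg.1; have i2 := rint_potential lf.1.
have i3 := L2_mul mD (L2_sincos lf.1) lg.
rewrite -RintegralB// -RintegralZl// -RintegralD//; [|exact: rintB|exact: rintZ].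
have i4 : mu.-integrable D (EFin \o (fun x => cos (2 * (f x + t * g x)) + 1 - (cos (2 * f x) + 1)
   + 4 * t * (sin (f x) * cos (f x) * g x))).
  by apply: rintD => //; [exact: rintB|exact: rintZ].
apply: le_trans (le_normr_Rintegral mD i4) _.
rewrite -RintegralZl//; last exact: lg.2.
apply: le_Rintegral => //.
- by have := integrable_abse i4; apply: eq_integrable.
- by apply: rintZ => //; exact: lg.2.
move=> x _; have := cos_Taylor (2 * f x) (2 * (t * g x)).
have -> : sin (2 * f x) = 2 * (sin (f x) * cos (f x)).
  by rewrite mulr2n mulrDl mul1r sinD; ring.
have -> : 2 * f x + 2 * (t * g x) = 2 * (f x + t * g x) by ring.
have alg (a b s r : R) : `|a - b + 2 * (t * r) * (2 * s)| <= (2 * (t * r)) ^+ 2 ->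
    `|a + 1 - (b + 1) + 4 * t * (s * r)| <= 4 * t ^+ 2 * r ^+ 2.
  rewrite [in leLHS](_ : a - b + _ = a + 1 - (b + 1) + 4 * t * (s * r)); last by ring.
  by rewrite (_ : (2 * (t * r)) ^+ 2 = 4 * t ^+ 2 * r ^+ 2); last by ring.
exact: alg.
Qed.

End cosine_integral.

Section energy_expansion.
Context {R : realType}.
Variables d h LH : R.
Hypothesis d_gt0 : 0 < d.
Let mO := measurable_Omega d.
Let mC := @measurable_cell R.
Let fO := vol_Omega d.
Let fC := @area_cell R.
Implicit Types u v phi eta : space R -> R.

Definition dirichlet u v := \int[vol]_(x in Omega d)
  (\sum_(i < 3) wpartial d i u x * wpartial d i v x).

Definition weak_form u v := dirichlet u v
  - h ^+ 2 * \int[vol]_(x in Omega d) (sin (u x) * cos (u x) * v x)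
  - LH * \int[area]_(y in cell) (sin (trace d 0 u y) * cos (trace d 0 u y) * trace d 0 v y).

Lemma rint_dirichlet u v : H1P d u -> H1P d v -> vol.-integrable (Omega d)
  (EFin \o (fun x => \sum_(i < 3) wpartial d i u x * wpartial d i v x)).
Proof.
move=> [hu _] [hv _]; apply: (rint_sum mO) => i.
by apply: L2_mul => //; exact: wpartial_L2.
Qed.

Lemma energyE u : H1P d u -> energy d h LH u = 2^-1 * dirichlet u u
  + h ^+ 2 / 4 * \int[vol]_(x in Omega d) (cos (2 * u x) + 1)
  + LH / 4 * \int[area]_(y in cell) (cos (2 * trace d 0 u y) + 1).
Proof.
move=> hu; rewrite /energy; congr (_ + _).
have iu := rint_dirichlet hu hu.
have iv := rint_potential mO fO (H1_L2 hu.1).1.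
have E : (fun x => \sum_(i < 3) wpartial d i u x ^+ 2) = (fun x => \sum_(i < 3) wpartial d i u x * wpartial d i u x).
  by apply/funext => x; apply: eq_bigr => i _; rewrite expr2.
rewrite /dirichlet -(@RintegralZl _ _ _ _ _ _ _ mO iu) -(@RintegralZl _ _ _ _ _ _ _ mO iv).
rewrite -(@RintegralD _ _ _ _ _ _ _ mO (rintZ mO 2^-1 iu) (rintZ mO (h ^+ 2 / 4) iv)).
by apply: eq_Rintegral => x _; congr (_ * _ + _); apply: eq_bigr => i _; rewrite expr2.
Qed.

Lemma dirichlet_lin u v c : H1P d u -> H1P d v ->
  dirichlet (fun x => u x + c * v x) (fun x => u x + c * v x) =
  dirichlet u u + 2 * c * dirichlet u v + c ^+ 2 * dirichlet v v.
Proof.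
move=> hu hv; have huv := H1P_lin d_gt0 c hu hv.
have iuu := rint_dirichlet hu hu; have iuv := rint_dirichlet hu hv; have ivv := rint_dirichlet hv hv.
rewrite /dirichlet -!RintegralZl//.
rewrite -RintegralD//; last exact: rintZ.
rewrite -RintegralD//; [|by apply: rintD => //; exact: rintZ|exact: rintZ].
apply: (eq_Rintegral_ae mO).
- exact: (rint_measurable (rint_dirichlet huv huv)).
- exact: (rint_measurable (rintD mO (rintD mO iuu (rintZ mO _ iuv)) (rintZ mO _ ivv))).
have a0 := wpartial_lin d_gt0 c e1 hu.1 hv.1.
have a1 := wpartial_lin d_gt0 c e2 hu.1 hv.1.
have a2 := wpartial_lin d_gt0 c e3 hu.1 hv.1.
have alg (w1 w2 w3 r1 r2 r3 b1 b2 b3 : R) : w1 = r1 + c * b1 -> w2 = r2 + c * b2 -> w3 = r3 + c * b3 ->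
    w1 * w1 + w2 * w2 + w3 * w3 = r1 * r1 + r2 * r2 + r3 * r3 +
    2 * c * (r1 * b1 + r2 * b2 + r3 * b3) + c ^+ 2 * (b1 * b1 + b2 * b2 + b3 * b3).
  by move=> -> -> ->; ring.
apply: (@filterS3 _ _ (ae_filter_ringOfSetsType vol) _ _ _ _ _ a0 a1 a2) => x {}a0 {}a1 {}a2 Dx.
rewrite [LHS]sum_ord3 [X in _ = X + _ + _]sum_ord3 [X in _ = _ + _ * X + _]sum_ord3 [X in _ = _ + _ * X]sum_ord3.
exact: alg (a0 Dx) (a1 Dx) (a2 Dx).
Qed.

Let expansion_alg (D1 D2 D' a1 a2 a3 a4 b1 b2 b3 b4 t : R) : 0 <= D' ->
  `|a1 - a2 + 4 * t * a3| <= 4 * t ^+ 2 * a4 -> `|b1 - b2 + 4 * t * b3| <= 4 * t ^+ 2 * b4 ->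
  `|(2^-1 * (D1 + 2 * t * D2 + t ^+ 2 * D') + h ^+ 2 / 4 * b1 + LH / 4 * a1) -
    (2^-1 * D1 + h ^+ 2 / 4 * b2 + LH / 4 * a2) - t * (D2 - h ^+ 2 * b3 - LH * a3)| <=
  (2^-1 * D' + h ^+ 2 * b4 + `|LH| * a4) * t ^+ 2.
Proof.
move=> D3 Ha Hb.
have -> : 2^-1 * (D1 + 2 * t * D2 + t ^+ 2 * D') + h ^+ 2 / 4 * b1 + LH / 4 * a1 -
    (2^-1 * D1 + h ^+ 2 / 4 * b2 + LH / 4 * a2) - t * (D2 - h ^+ 2 * b3 - LH * a3) =
  2^-1 * D' * t ^+ 2 + h ^+ 2 / 4 * (b1 - b2 + 4 * t * b3) + LH / 4 * (a1 - a2 + 4 * t * a3) by field.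
apply: le_trans (ler_normD _ _) _; rewrite 2!(mulrDl _ _ (t ^+ 2)); apply: lerD.
  apply: le_trans (ler_normD _ _) _; apply: lerD.
    by rewrite ger0_norm// mulr_ge0 ?sqr_ge0// mulr_ge0.
  have h0 : 0 <= h ^+ 2 / 4 by rewrite divr_ge0 ?sqr_ge0.
  rewrite normrM (ger0_norm h0); apply: le_trans (ler_wpM2l h0 Hb) _.
  by rewrite le_eqVlt; apply/orP; left; apply/eqP; field.
have n4 : `|4^-1 : R| = 4^-1 by rewrite ger0_norm// invr_ge0.
have L0 : 0 <= `|LH| / 4 by rewrite divr_ge0.
rewrite normrM normrM n4; apply: le_trans (ler_wpM2l L0 Ha) _.
by rewrite le_eqVlt; apply/orP; left; apply/eqP; field.
Qed.

(** The gradient part of the energy is quadratic, and Taylor's formula bounds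
    the remainders of the two potentials. *)
Lemma energy_expansion u v t : H1P d u -> H1P d v ->
  `|energy d h LH (fun x => u x + t * v x) - energy d h LH u - t * weak_form u v| <=
  (2^-1 * dirichlet v v + h ^+ 2 * \int[vol]_(x in Omega d) (v x ^+ 2)
   + `|LH| * \int[area]_(y in cell) (trace d 0 v y ^+ 2)) * t ^+ 2.
Proof.
move=> hu hv; have huv := H1P_lin d_gt0 t hu hv.
have lu := H1_L2 hu.1; have lv := H1_L2 hv.1.
have tu := trace_L2 d_gt0 hu; have tv := trace_L2 d_gt0 hv.
have trE : \int[area]_(y in cell) (cos (2 * trace d 0 (fun x => u x + t * v x) y) + 1) =
    \int[area]_(y in cell) (cos (2 * (trace d 0 u y + t * trace d 0 v y)) + 1).
  apply: (eq_Rintegral_ae mC).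
  - exact: (rint_measurable (rint_potential mC fC (trace_L2 d_gt0 huv).1)).
  - exact: (rint_measurable (rint_potential mC fC (L2D mC tu (L2Z mC t tv)).1)).
  - have := trace_lin d_gt0 t hu hv.
    by apply: (@filterS _ _ (ae_filter_ringOfSetsType area)) => y yE Cy; rewrite (yE Cy).
have D3 : 0 <= dirichlet v v.
  by apply: Rintegral_ge0 => x _; apply: sumr_ge0 => i _; rewrite -expr2 sqr_ge0.
have E1 := energyE huv; rewrite (dirichlet_lin t hu hv) trE in E1.
rewrite E1 (energyE hu).
exact: expansion_alg D3 (potential_Taylor mC fC t tu tv) (potential_Taylor mO fO t lu lv).
Qed.

Lemma energy_is_derive u v : H1P d u -> H1P d v ->
  is_derive (0 : R) (1 : R) (fun t => energy d h LH (fun x => u x + t * v x)) (weak_form u v).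
Proof.
move=> hu hv; apply: quadratic_is_derive => t.
have -> : (fun x => u x + 0 * v x) = u by apply/funext => x; rewrite mul0r addr0.
exact: energy_expansion.
Qed.

Lemma critical_pointP u : critical_point d h LH u <-> H1P d u /\ forall v, H1P d v -> weak_form u v = 0.
Proof.
split=> -[hu hd]; split=> // v hv.
  exact: derivative_unique (energy_is_derive hu hv) (hd v hv).
by have := energy_is_derive hu hv; rewrite hd.
Qed.

End energy_expansion.

(** * Solutions depending on the height and the shallow case *)

Section dirichlet_vertical.
Context {R : realType}.
Variables d : R.

Lemma vertical_dirichlet_le u : H1P d u ->
  \int[vol]_(x in Omega d) (wpartial d e3 u x ^+ 2) <= dirichlet d u u.
Proof.
move=> hu; have lw := wpartial_L2 e3 hu.1.
apply: (le_Rintegral (measurable_Omega d) lw.2 (rint_dirichlet hu hu)) => x _.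
move: (wpartial d ^~ u) => w; rewrite expr2 (bigD1 e3)// lerDl.
by apply: sumr_ge0 => i _; rewrite -expr2 sqr_ge0.
Qed.

End dirichlet_vertical.

Section vertical_solutions.
Context {R : realType}.
Variables d h LH : R.
Hypothesis d_gt0 : 0 < d.
Let mO := measurable_Omega d.
Let mC := @measurable_cell R.
Let fO := vol_Omega d.
Let fC := @area_cell R.

Variables f f' f'' : R -> R.
Hypothesis df : forall t : R, is_derive t (1 : R) f (f' t).
Hypotheses (cf' : continuous f') (cf'' : continuous f'').
Hypothesis df' : forall t : R, 0 < t < d -> is_derive t (1 : R) f' (f'' t).

Lemma vertical_dirichlet v : f d = 0 -> H1P d v ->
  dirichlet d (fun x => f x.2) v = \int[vol]_(x in Omega d) (f' x.2 * wpartial d e3 v x).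
Proof.
move=> fd hv; have hf := vertical_H1P d_gt0 df cf' fd.
have lw3 := wpartial_L2 e3 hv.1.
have i1 : vol.-integrable (Omega d) (EFin \o (fun x => f' x.2 * wpartial d e3 v x)).
  by apply: L2_mul => //; apply: continuous_L2_Omega; exact: continuous_x3.
apply: (eq_Rintegral_ae mO).
- exact: (rint_measurable (rint_dirichlet hf hv)).
- exact: (rint_measurable i1).
have a i := wpartial_eq d_gt0 (vertical_weak_partial d_gt0 df cf' i).
have alg (w1 w2 w3 g v1 v2 v3 : R) : w1 = 0 -> w2 = 0 -> w3 = g -> w1 * v1 + w2 * v2 + w3 * v3 = g * v3.
  by move=> -> -> ->; ring.
apply: (@filterS3 _ _ (ae_filter_ringOfSetsType vol) _ _ _ _ _ (a e1) (a e2) (a e3)) => x a1 a2 a3 Dx.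
rewrite [LHS]sum_ord3; exact: alg (a1 Dx) (a2 Dx) (a3 Dx).
Qed.

(** Green's formula with the weight f' is the weak form of the one-dimensional
    boundary value problem, tested with functions of three variables. *)
Lemma vertical_weak_form v : f d = 0 ->
  (forall t, 0 < t < d -> f'' t = - (h ^+ 2 * (sin (f t) * cos (f t)))) ->
  f' 0 = - (LH * (sin (f 0) * cos (f 0))) -> H1P d v ->
  weak_form d h LH (fun x => f x.2) v = 0.
Proof.
move=> fd ODE f'0 hv; have hf := vertical_H1P d_gt0 df cf' fd.
have lv := H1_L2 hv.1; have lw := wpartial_L2 e3 hv.1.
have mf : measurable_fun (Omega d) (fun x : space R => f x.2) by exact: (H1_L2 hf.1).1.
have i1 : vol.-integrable (Omega d) (EFin \o (fun x => f' x.2 * wpartial d e3 v x)).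
  by apply: L2_mul => //; apply: continuous_L2_Omega; exact: continuous_x3.
have i2 := L2_mul mO (L2_sincos mO fO mf) lv.
rewrite /weak_form vertical_dirichlet//.
have -> : \int[area]_(y in cell) (sin (trace d 0 (fun x => f x.2) y) * cos (trace d 0 (fun x => f x.2) y) * trace d 0 v y)
   = sin (f 0) * cos (f 0) * \int[area]_(y in cell) trace d 0 v y.
  have tv := trace_L2 d_gt0 hv; have tf := trace_L2 d_gt0 hf.
  rewrite -(RintegralZl _ mC (L2_rint mC fC tv)).
  apply: (eq_Rintegral_ae mC).
  - exact: (rint_measurable (L2_mul mC (L2_sincos mC fC tf.1) tv)).
  - exact: (rint_measurable (rintZ mC _ (L2_rint mC fC tv))).
  have := trace_eq d_gt0 hf (vertical_trace d_gt0 df cf' 0).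
  by apply: (@filterS _ _ (ae_filter_ringOfSetsType area)) => y yE Cy; rewrite (yE Cy).
have G := green_H1P_lin d_gt0 cf' cf'' df' hv.
rewrite f'0 opprK in G; rewrite mulrA -G -(RintegralZl _ mO i2) -RintegralB//; last exact: rintZ.
have -> : \int[vol]_(x in Omega d) (f' x.2 * wpartial d e3 v x + f'' x.2 * v x) =
   \int[vol]_(x in Omega d) (f' x.2 * wpartial d e3 v x - h ^+ 2 * (sin (f x.2) * cos (f x.2) * v x)).
  apply: eq_Rintegral => x /set_mem Ox; rewrite ODE; last exact: Omega_x3 Ox.
  by ring.
by rewrite subrr.
Qed.

End vertical_solutions.

Section shallow.
Context {R : realType}.
Variables d h LH : R.
Hypotheses (d_gt0 : 0 < d) (h_gt0 : 0 < h) (LH_gt0 : 0 < LH).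
Let mO := measurable_Omega d.
Let mC := @measurable_cell R.
Let fO := vol_Omega d.
Let fC := @area_cell R.

Lemma sincos_gap_ge0 (u : R) : 0 <= u * u - sin u * cos u * u.
Proof.
rewrite subr_ge0 -[leRHS]ger0_norm -?expr2 ?sqr_ge0// (le_trans (ler_norm _))//.
rewrite expr2 !normrM ler_wpM2r// -[leRHS]mulr1 ler_pM// ?norm_sin_le//.
by rewrite ler_norml cos_geN1 cos_le1.
Qed.

Lemma sincos_gap_eq0 (u : R) : u * u - sin u * cos u * u = 0 -> u = 0.
Proof.
move=> /eqP; rewrite -mulrBl mulf_eq0 => /orP[|/eqP//]; rewrite subr_eq0 => /eqP uE.
have [//|u0] := eqVneq u 0; exfalso.
have u0' : 0 < `|u| by rewrite normr_gt0.
have h1 : `|u| <= `|u| * `|cos u|.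
  by rewrite {1}uE normrM ler_wpM2r// norm_sin_le.
have h2 : 1 <= `|cos u| by rewrite -(ler_pM2l u0') mulr1.
have h3 : sin u ^+ 2 <= 0.
  rewrite sin2cos2 subr_le0 -[cos u ^+ 2]real_normK ?num_real// -[leLHS](expr1n _ 2).
  by rewrite lerXn2r ?nnegrE.
have h4 : sin u = 0 by apply/eqP; rewrite -sqrf_eq0 eq_le h3 sqr_ge0.
by move/eqP: u0; apply; rewrite uE h4 mul0r.
Qed.

Lemma trivial_critical : critical_point d h LH (fun=> 0).
Proof.
have d0 (t : R) : is_derive t (1 : R) (cst (0 : R)) (cst 0 t) by exact: is_derive_cst.
have c0 : continuous (cst (0 : R) : R -> R) by move=> t; exact: cvg_cst.
apply/(critical_pointP h LH d_gt0); split; first exact: (vertical_H1P d_gt0 d0 c0).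
move=> v hv; apply: (vertical_weak_form d_gt0 d0 c0 c0 (fun t _ => d0 t)) => //=.
- by move=> t _; rewrite sin0 mul0r mulr0 oppr0.
- by rewrite sin0 mul0r mulr0 oppr0.
Qed.

(** The linearisation of the problem at 0 has the solution sin (b - h s) with
    tan b = h / LH, which satisfies the boundary condition at 0 and is positive
    on [0, d) exactly as long as h d <= b, that is for d at most critical. *)
Lemma linearised_Jacobi u : d <= critical_depth h LH -> H1P d u ->
  h ^+ 2 * \int[vol]_(x in Omega d) (u x * u x) +
  LH * \int[area]_(y in cell) (trace d 0 u y * trace d 0 u y) <= dirichlet d u u.
Proof.
rewrite /critical_depth; set b := atan _ => dc hu.
have b_gt0 : 0 < b by rewrite -(@atan0 R) lt_atan// divr_gt0.
have b_lt : b < pi / 2 by exact: atan_ltpi2.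
have hdb : h * d <= b by rewrite mulrC -ler_pdivlMr// mulrC.
have cosb : 0 < cos b by apply: cos_gt0_pihalf; rewrite b_lt andbT; lra.
have bE : LH * sin b = h * cos b.
  have := @atanK R (h / LH); rewrite -/b /tan => /(congr1 (fun x => x * (LH * cos b))).
  move=> E; have <- : sin b / cos b * (LH * cos b) = LH * sin b by field; rewrite gt_eqF.
  by rewrite E; field; rewrite gt_eqF.
pose g (s : R) : R := b - h * s.
have dg (t : R) : is_derive t (1 : R) g (- h).
  have h1 := is_deriveB (is_derive_cst b t (1 : R)) (is_deriveZ h (is_derive_id t (1 : R))).
  by apply: (is_derive_eq h1); rewrite sub0r /GRing.scale/= mulr1.
pose f s := sin (g s); pose f' s := - h * cos (g s); pose f'' s := - (h ^+ 2 * sin (g s)).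
have df (t : R) : is_derive t (1 : R) f (f' t).
  have h1 := is_derive1_comp (is_derive_sin (g t)) (dg t); apply: (is_derive_eq h1).
  by rewrite /f' /GRing.scale/= mulrC.
have df' (t : R) : is_derive t (1 : R) f' (f'' t).
  have h1 := is_derive1_comp (is_derive_cos (g t)) (dg t).
  have h2 := is_deriveZ (- h) h1; apply: (is_derive_eq h2).
  by rewrite /f'' /GRing.scale/=; ring.
have cg : continuous g by apply: is_derive_continuous dg.
have cf : continuous f by apply: is_derive_continuous df.
have cf' : continuous f' by apply: is_derive_continuous df'.
have cf'' : continuous f''.
  by move=> t; apply: cvgN; apply: cvgM; [exact: cvg_cst|exact: cf].
have gle t : 0 <= t -> g t <= b by move=> t0; rewrite /g lerBlDr lerDl mulr_ge0// ltW.
have gge t : t <= d -> 0 <= g t.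
  by move=> td; rewrite /g subr_ge0 (le_trans _ hdb)// ler_pM2l.
have ggt t : t < d -> 0 < g t.
  by move=> td; rewrite /g subr_gt0 (lt_le_trans _ hdb)// ltr_pM2l.
have f_ge0 t : 0 <= t <= d -> 0 <= f t.
  move=> /andP[t0 td]; apply: sin_ge0_pi; rewrite gge//= (le_trans (gle _ t0))//; lra.
have f_gt0 t : 0 <= t < d -> 0 < f t.
  move=> /andP[t0 td]; apply: sin_gt0_pi; rewrite ggt//= (le_lt_trans (gle _ t0))//; lra.
have kE t : 0 < t < d -> f'' t = - (cst (h ^+ 2) t * f t) by [].
have kK t : 0 < t < d -> 0 <= cst (h ^+ 2) t <= h ^+ 2 by rewrite /= sqr_ge0 lexx.
have lE : f' 0 = - (LH * f 0) by rewrite /f' /f /g mulr0 subr0 bE mulNr.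
have lu := H1_L2 hu.1.
have := Jacobi d_gt0 cf cf' cf'' (fun t _ => df t) (fun t _ => df' t) f_ge0 f_gt0 kE kK lE hu.
rewrite /= -(RintegralZl _ mO (L2_mul mO lu lu)).
rewrite (@eq_Rintegral _ _ _ vol _ (fun x => h ^+ 2 * (u x * u x)) (fun x => h ^+ 2 * u x * u x)); last first.
  by move=> x _; rewrite mulrA.
rewrite (@eq_Rintegral _ _ _ area _ (fun y => trace d 0 u y * trace d 0 u y) (fun y => trace d 0 u y ^+ 2)) => [|y _]; last first.
  by rewrite expr2.
move=> /le_trans; apply; exact: vertical_dirichlet_le.
Qed.

(** Testing the equation with the solution itself and comparing with the
    linearised equation leaves only nonnegative gaps u ^ 2 - u sin u cos u. *)
Lemma shallow_unique u : d <= critical_depth h LH -> critical_point d h LH u -> eq_Omega d u (fun=> 0).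
Proof.
move=> dc /(critical_pointP h LH d_gt0)[hu /(_ u hu)]; rewrite /weak_form.
have := linearised_Jacobi dc hu.
have lu := H1_L2 hu.1; have tu := trace_L2 d_gt0 hu.
have i1 := L2_mul mO lu lu; have i2 := L2_mul mO (L2_sincos mO fO lu.1) lu.
have j1 := L2_mul mC tu tu; have j2 := L2_mul mC (L2_sincos mC fC tu.1) tu.
have : 0 <= \int[area]_(y in cell) (trace d 0 u y * trace d 0 u y - sin (trace d 0 u y) * cos (trace d 0 u y) * trace d 0 u y).
  by apply: Rintegral_ge0 => y _; exact: sincos_gap_ge0.
rewrite (RintegralB mC j1 j2) => B0 J W.
have V0 : \int[vol]_(x in Omega d) (u x * u x - sin (u x) * cos (u x) * u x) <= 0.
  rewrite (RintegralB mO i1 i2) -(pmulr_rle0 _ (exprn_gt0 2 h_gt0)).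
  have := mulr_ge0 (ltW LH_gt0) B0; move: J W.
  move: (dirichlet d u u) (\int[vol]_(x in _) _) (\int[vol]_(x in _) _) (\int[area]_(x in _) _) (\int[area]_(x in _) _).
  by move=> D A1 A2 A3 A4; rewrite !mulrBr; lra.
have := Rintegral_ge0_eq0 mO (rintB mO i1 i2) (fun x _ => sincos_gap_ge0 (u x)) V0.
by apply: (@filterS _ _ (ae_filter_ringOfSetsType vol)) => x xE Dx; exact: sincos_gap_eq0 (xE Dx).
Qed.

End shallow.

(** * Solving the one-dimensional equation by quadrature *)

Section primitive.
Context {R : realType}.
Notation leb := (@lebesgue_measure R).

Lemma continuous_rint (k : R -> R) (a b : R) : continuous k -> leb.-integrable `[a, b] (EFin \o k).
Proof.
move=> ck; apply: continuous_compact_integrable; first exact: segment_compact.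
exact: continuous_subspaceT.
Qed.

(** Subtracting the value of k on the left half-line leaves a function whose
    integral can be started at -1. *)
Lemma primitive_exists (k : R -> R) : continuous k -> (forall u, u <= 0 -> k u = k 0) ->
  exists P : R -> R, forall u, is_derive u (1 : R) P (k u).
Proof.
move=> ck k0; pose G u := \int[leb]_(s in `[-1, u]) (k s - k 0).
have ckk : continuous (fun s => k s - k 0).
  by move=> s; apply: cvgB; [exact: ck|exact: cvg_cst].
suff dG u : is_derive u (1 : R) G (k u - k 0).
  exists (fun u => k 0 * u + G u) => u.
  have h := is_deriveD (is_deriveZ (k 0) (is_derive_id u (1 : R))) (dG u).
  by apply: (is_derive_eq h); rewrite /GRing.scale/= mulr1 addrC subrK.
have [u0|u0] := ltP u 0.
  rewrite (k0 _ (ltW u0)) subrr.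
  apply: (near_eq_is_derive _ (is_derive_cst (0 : R) u (1 : R))).
  near=> t => /=; rewrite /G; apply/esym.
  rewrite (@eq_Rintegral _ _ _ _ _ (cst 0)) => [|s]; first by rewrite Rintegral_cst// mul0r.
  rewrite inE/= in_itv/= => /andP[_ st]; rewrite k0 ?subrr// (le_trans st)//.
  by apply: ltW; near: t; exact: lt_nbhsl.
have [] := @continuous_FTC1_closed R (fun s => k s - k 0) (-1) u (u + 1) _ _ _ (ckk u).
- by rewrite ltrDl.
- exact: continuous_rint.
- by apply: lt_le_trans u0; rewrite ltrN10.
by move=> dG GE; apply: DeriveDef => //; rewrite -GE derive1E.
Unshelve. all: by end_near. Qed.

(** The lower bound on the derivative makes P surjective as well as injective. *)
Lemma inverse_exists (P k : R -> R) (m : R) : 0 < m -> (forall u, m <= k u) ->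
  (forall u, is_derive u (1 : R) P (k u)) ->
  exists g : R -> R, cancel P g /\ cancel g P /\ {homo P : x y / x < y} /\
    forall t, is_derive t (1 : R) g (k (g t))^-1.
Proof.
move=> m0 mk dP; have cP := is_derive_continuous dP.
have cPw a b : {within `[a, b], continuous P} by apply: continuous_subspaceT.
have grow x y : x < y -> m * (y - x) <= P y - P x.
  move=> xy; have [c _ ->] := MVT xy (fun t _ => dP t) (cPw x y).
  by rewrite ler_pM2r ?subr_gt0.
have Pinc : {homo P : x y / x < y}.
  move=> x y xy; rewrite -subr_gt0 (lt_le_trans _ (grow _ _ xy))// mulr_gt0// subr_gt0//.
have Pinj : injective P.
  by move=> x y; have [/Pinc/lt_eqF + /eqP|/Pinc/gt_eqF + /eqP|] := ltgtP x y => [->|->|].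
have surj t : exists u, P u = t.
  (* P grows by at least m N on each side of 0, which is more than |t - P 0|. *)
  pose N := (`|t - P 0| + 1) / m.
  have N0 : 0 < N by rewrite divr_gt0// ltr_wpDl.
  have NE : m * N = `|t - P 0| + 1 by rewrite /N mulrC divfK// gt_eqF.
  have h1 := grow 0 N N0; have h2 := grow (- N) 0; rewrite oppr_lt0 in h2; have {}h2 := h2 N0.
  rewrite subr0 NE in h1; rewrite sub0r opprK NE in h2.
  have h3 := ler_norm (t - P 0); have h4 := ler_norm (- (t - P 0)); rewrite normrN in h4.
  have NN : - N <= N by rewrite ltW// (lt_trans _ N0)// oppr_lt0.
  have [|c _ <-] := @IVT R P (- N) N t NN (cPw _ _); last by exists c.
  rewrite min_l ?max_r; lra.
pose g t := sval (cid (surj t)).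
have gK : cancel g P by move=> t; rewrite /g; case: cid.
have PK : cancel P g by move=> u; apply: Pinj; rewrite gK.
exists g; split=> //; split=> //; split=> // t.
rewrite -{1}(gK t); apply: is_derive_inverse.
- by near=> u; exact: PK.
- by near=> u; exact: cP.
- by rewrite gt_eqF// (lt_le_trans m0).
Unshelve. all: by end_near. Qed.

End primitive.

Section profile.
Context {R : realType}.
Variables h LH : R.
Hypotheses (h_gt0 : 0 < h) (LH_gt0 : 0 < LH).

Section with_amplitude.
Variable a : R.
Hypotheses (a_gt0 : 0 < a) (a_lt : a < pi / 2).

(** phi' ^ 2 + h ^ 2 sin ^ 2 phi is constant along solutions. For the solution
    with phi(0) = a and phi'(0) = - LH sin a cos a, this is the value of
    phi' ^ 2 where phi = u. *)
Definition kinetic (u : R) := h ^+ 2 * (sin a ^+ 2 - sin u ^+ 2) + LH ^+ 2 * (sin a ^+ 2 * cos a ^+ 2).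

Lemma sin_le_sin (u : R) : 0 <= u <= a -> 0 <= sin u <= sin a.
Proof.
move=> /andP[u0 ua]; have pi0 := @pi_gt0 R.
have sE (x : R) : sin x = cos (pi / 2 - x) by rewrite -cosN opprB cosBpihalf.
have [u_pi h1 h2] : [/\ u <= pi, 0 <= pi / 2 - a <= pi & 0 <= pi / 2 - u <= pi].
  by move: a_lt pi0; move: (@pi R) => p pa p0; split; [|apply/andP; split..]; lra.
rewrite sin_ge0_pi ?u0//= (sE a) (sE u).
by rewrite leNgt ltr_cos ?in_itv//= -leNgt lerD2l lerN2.
Qed.

Lemma cos_amplitude_gt0 : 0 < cos a.
Proof.
by apply: cos_gt0_pihalf; rewrite a_lt andbT (lt_trans _ a_gt0)// oppr_lt0 divr_gt0// pi_gt0.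
Qed.

Lemma sin_amplitude_gt0 : 0 < sin a. Proof. by apply: sin_gt0_pihalf; rewrite a_gt0. Qed.

Lemma kinetic_gt0 (u : R) : 0 <= u <= a -> 0 < kinetic u.
Proof.
move=> hu; have /andP[su sua] := sin_le_sin hu.
have sa := sin_amplitude_gt0; have ca := cos_amplitude_gt0.
rewrite /kinetic ltr_wpDl//; last first.
  by apply: mulr_gt0; [exact: exprn_gt0|apply: mulr_gt0; exact: exprn_gt0].
by rewrite mulr_ge0 ?sqr_ge0// subr_ge0 lerXn2r// nnegrE ltW.
Qed.

Lemma kinetic_le u : kinetic u <= h ^+ 2 + LH ^+ 2.
Proof.
have h1 : sin a ^+ 2 - sin u ^+ 2 <= 1.
  by have := sqr_ge0 (sin u); have := sqr_ge0 (cos a); rewrite cos2sin2; lra.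
have h2 : sin a ^+ 2 * cos a ^+ 2 <= 1.
  have := sqr_ge0 (sin a); have := sqr_ge0 (cos a); rewrite cos2sin2; nra.
by rewrite /kinetic lerD// ler_piMr// sqr_ge0.
Qed.

Lemma kinetic_derive u : is_derive u (1 : R) kinetic (- (2 * h ^+ 2 * (sin u * cos u))).
Proof.
have h1 := is_deriveX 2 (is_derive_sin u).
have h2 := is_deriveZ (h ^+ 2) (is_deriveB (is_derive_cst (sin a ^+ 2) u (1 : R)) h1).
have h3 := is_deriveD h2 (is_derive_cst (LH ^+ 2 * (sin a ^+ 2 * cos a ^+ 2)) u (1 : R)).
apply: (is_derive_eq h3); rewrite /GRing.scale/= addr0 sub0r; ring.
Qed.

(** The clamp freezes the speed outside [0, a]; the inverse of a primitive is
    then defined, and C^1, on the whole line. *)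
Definition slowness (u : R) := (Num.sqrt (kinetic (clamp a u)))^-1.

Lemma slowness_continuous : continuous slowness.
Proof.
move=> u; apply: cvgV; first by rewrite gt_eqF// sqrtr_gt0 kinetic_gt0// clamp_itv.
apply: (@continuous_comp _ _ _ (fun u => kinetic (clamp a u)) (@Num.sqrt R)); last exact: sqrt_continuous.
apply: (@continuous_comp _ _ _ (clamp a) kinetic); first exact: continuous_clamp.
exact: (is_derive_continuous kinetic_derive).
Qed.

(** Separation of variables: phi is the inverse of a primitive of the slowness.
    As Robin's condition is built into kinetic, the only remaining condition is
    that the travel time from a to 0 be d. *)
Lemma profile_exists d P : (forall u, is_derive u (1 : R) P (slowness u)) -> 0 < d -> P a - P 0 = d ->
  exists f f' : R -> R,
  [/\ (forall t, is_derive t (1 : R) f (f' t)), continuous f',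
      (forall t, 0 < t < d -> is_derive t (1 : R) f' (- (h ^+ 2 * (sin (f t) * cos (f t))))) &
   [/\ f d = 0, f' 0 = - (LH * (sin (f 0) * cos (f 0))),
      (forall t, 0 <= t <= d -> 0 <= f t < pi / 2) & forall t, 0 <= t < d -> 0 < f t]].
Proof.
move=> dP d0 Pd.
pose M := Num.sqrt (h ^+ 2 + LH ^+ 2).
have M0 : 0 < M by rewrite sqrtr_gt0 addr_gt0// exprn_gt0.
have kcM u : M^-1 <= slowness u.
  have k0 : 0 < kinetic (clamp a u) by rewrite kinetic_gt0// clamp_itv.
  by rewrite lef_pV2 ?posrE// ?sqrtr_gt0// ler_wsqrtr// kinetic_le.
have Mi : 0 < M^-1 by rewrite invr_gt0.
have [g [PK [gK [Pinc dg]]]] := inverse_exists Mi kcM dP.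
have cg := is_derive_continuous dg.
have ginc : {homo g : x y / x < y}.
  move=> x y xy; rewrite ltNge; apply/negP => gyx.
  have : P (g y) <= P (g x) by move: gyx; rewrite le_eqVlt => /predU1P[->//|/Pinc/ltW].
  by rewrite !gK leNgt xy.
pose f t := g (P a - t); pose f' t := - Num.sqrt (kinetic (clamp a (f t))).
have df t : is_derive t (1 : R) f (f' t).
  have h1 : is_derive t (1 : R) (fun t => P a - t) (-1).
    by have := is_deriveB (is_derive_cst (P a) t (1 : R)) (is_derive_id t (1 : R)); rewrite sub0r.
  have h2 := @is_derive1_comp R g (fun t => P a - t) t _ _ (dg (P a - t)) h1; apply: (is_derive_eq h2).
  by rewrite /GRing.scale/= mulrN1 /slowness invrK.
have cf := is_derive_continuous df.
have cf' : continuous f'.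
  move=> t; apply: cvgN.
  apply: (@continuous_comp _ _ _ (fun t => kinetic (clamp a (f t))) (@Num.sqrt R)); last exact: sqrt_continuous.
  apply: (@continuous_comp _ _ _ (fun t => clamp a (f t)) kinetic); last exact: (is_derive_continuous kinetic_derive).
  apply: (@continuous_comp _ _ _ f (clamp a)); first exact: cf.
  exact: continuous_clamp.
have f0 : f 0 = a by rewrite /f subr0 PK.
have fd : f d = 0 by rewrite /f -Pd opprB addrC subrK PK.
have fdec s t : s < t -> f t < f s by move=> st; apply: ginc; rewrite ltrD2l ltrN2.
have f_gt0 t : t < d -> 0 < f t by move=> td; rewrite -fd fdec.
have f_lta t : 0 < t -> f t < a by move=> t0; rewrite -f0 fdec.
have f_le t : 0 <= t -> f t <= a.
  by rewrite le_eqVlt => /predU1P[<-|/f_lta/ltW//]; rewrite f0.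
exists f, f'; split => //.
- move=> t /andP[t0 td].
  have ft : 0 < f t < a by rewrite f_gt0// f_lta.
  have Kt : 0 < kinetic (f t) by case/andP: ft => ? ?; rewrite kinetic_gt0// !ltW.
  have K0 : Num.sqrt (kinetic (f t)) != 0 by rewrite gt_eqF// sqrtr_gt0.
  apply: (@near_eq_is_derive _ _ _ (fun t => - Num.sqrt (kinetic (f t)))).
    near=> s; rewrite /f' (_ : clamp a (f s) = f s)//; near: s.
    exact: (cf t _ (near_clamp_id ft)).
  have h1 := is_derive1_comp (kinetic_derive (f t)) (df t).
  have h2 := is_deriveN (@is_derive1_comp R (@Num.sqrt R) (kinetic \o f) t _ _ (is_derive1_sqrt Kt) h1); apply: (is_derive_eq h2).
  case/andP: ft => /ltW ? /ltW ?; rewrite /f' clamp_id ?/GRing.scale/=; first by field.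
  by apply/andP.
- split => //.
  + have sc0 : 0 <= LH * (sin a * cos a).
      by rewrite !mulr_ge0// ltW// ?sin_amplitude_gt0 ?cos_amplitude_gt0.
    have aa : 0 <= a <= a by rewrite (ltW a_gt0) lexx.
    by rewrite /f' f0 (clamp_id aa) /kinetic subrr mulr0 add0r -!exprMn sqrtr_sqr ger0_norm.
  + move=> t /andP[t0]; rewrite le_eqVlt => /predU1P[->|td].
      by rewrite fd lexx divr_gt0// pi_gt0.
    by rewrite (ltW (f_gt0 _ td))/= (le_lt_trans (f_le _ t0)).
  + by move=> t /andP[_]; exact: f_gt0.
Unshelve. all: by end_near. Qed.

End with_amplitude.
End profile.

(** * The time map *)

Section asin.
Context {R : realType}.

Lemma asin_0 : asin 0 = 0 :> R.
Proof.
rewrite -[in LHS](@sin0 R) sinK// in_itv/= oppr_le0.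
by rewrite divr_ge0// pi_ge0.
Qed.

Lemma asin_lt (y z : R) : -1 <= y <= 1 -> -1 <= z <= 1 -> (asin y < asin z) = (y < z).
Proof.
move=> hy hz; rewrite -ltr_sin ?in_itv/= ?asin_geNpi2 ?asin_lepi2//.
by rewrite !asinK ?in_itv.
Qed.

End asin.

Section time_map.
Context {R : realType}.
Variables h LH : R.
Hypotheses (h_gt0 : 0 < h) (LH_gt0 : 0 < LH).
Notation leb := (@lebesgue_measure R).
Let h2_gt0 : 0 < h ^+ 2. Proof. exact: exprn_gt0. Qed.
Let L2_gt0 : 0 < LH ^+ 2. Proof. exact: exprn_gt0. Qed.
Let clamp1 (s : R) : 0 <= clamp 1 s <= 1. Proof. exact: clamp_itv. Qed.

(** With b = sin a and b c = sin u, this is cos ^ 2 u times kinetic u / b ^ 2.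
    In the variable c the travel time becomes an integral over the fixed
    interval (0, 1), which makes sense up to amplitude b = 0. *)
Definition radicand (b c : R) : R :=
  (1 - b ^+ 2 * c ^+ 2) * (h ^+ 2 * (1 - c ^+ 2) + LH ^+ 2 * (1 - b ^+ 2)).
Definition transit (b s : R) : R := (Num.sqrt (radicand b (clamp 1 s)))^-1.
Definition time_map (b : R) : R := \int[leb]_(s in `]0, 1[) transit b s.

Lemma radicand_ge (B b c : R) : 0 <= B < 1 -> `|b| <= B -> 0 <= c <= 1 ->
  (1 - B ^+ 2) * (LH ^+ 2 * (1 - B ^+ 2)) <= radicand b c.
Proof.
move=> /andP[B0 B1] bB /andP[c0 c1].
have b2 : b ^+ 2 <= B ^+ 2 by rewrite -[b ^+ 2]real_normK ?num_real// lerXn2r// nnegrE.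
have B2 : B ^+ 2 < 1 by rewrite -[ltRHS](expr1n _ 2) ltrXn2r// ?nnegrE.
have c2 : c ^+ 2 <= 1 by rewrite -[leRHS](expr1n _ 2) lerXn2r// nnegrE.
have cc := sqr_ge0 c; have bb := sqr_ge0 b.
apply: ler_pM; [lra|by apply: mulr_ge0; [exact: ltW|lra]| |].
  have : b ^+ 2 * c ^+ 2 <= B ^+ 2 * 1 by apply: ler_pM.
  lra.
have h1 : 0 <= h ^+ 2 * (1 - c ^+ 2) by apply: mulr_ge0; [exact: ltW|lra].
have : LH ^+ 2 * (1 - B ^+ 2) <= LH ^+ 2 * (1 - b ^+ 2) by rewrite ler_pM2l//; lra.
lra.
Qed.

Let floor_gt0 (B : R) : 0 <= B < 1 -> 0 < (1 - B ^+ 2) * (LH ^+ 2 * (1 - B ^+ 2)).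
Proof.
move=> /andP[B0 B1].
have B2 : 0 < 1 - B ^+ 2 by rewrite subr_gt0 -[ltRHS](expr1n _ 2) ltrXn2r// ?nnegrE.
by rewrite mulr_gt0// mulr_gt0.
Qed.

Lemma radicand_gt0 (b c : R) : `|b| < 1 -> 0 <= c <= 1 -> 0 < radicand b c.
Proof.
move=> b1 hc; have hB : 0 <= `|b| < 1 by rewrite normr_ge0.
exact: lt_le_trans (floor_gt0 hB) (radicand_ge hB (lexx _) hc).
Qed.

Lemma transit_continuous b : `|b| < 1 -> continuous (transit b).
Proof.
move=> b1 s; apply: cvgV; first by rewrite gt_eqF// sqrtr_gt0 radicand_gt0.
apply: (@continuous_comp _ _ _ (fun s => radicand b (clamp 1 s)) (@Num.sqrt R)); last exact: sqrt_continuous.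
apply: (@continuous_comp _ _ _ (clamp 1) (radicand b)); first exact: continuous_clamp.
have cX : c ^+ 2 @[c --> clamp 1 s] --> clamp 1 s ^+ 2 by apply: exprn_continuous.
apply: cvgM; first by apply: cvgB; [exact: cvg_cst|apply: cvgM => //; exact: cvg_cst].
apply: cvgD; last exact: cvg_cst.
by apply: cvgM; [exact: cvg_cst|apply: cvgB => //; exact: cvg_cst].
Qed.

Lemma transit_continuous_amplitude b s : `|b| < 1 -> {for b, continuous (transit ^~ s)}.
Proof.
move=> b1; apply: cvgV; first by rewrite gt_eqF// sqrtr_gt0 radicand_gt0.
apply: (@continuous_comp _ _ _ (fun b => radicand b (clamp 1 s)) (@Num.sqrt R)); last exact: sqrt_continuous.
have cX : x ^+ 2 @[x --> b] --> b ^+ 2 by apply: exprn_continuous.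
apply: cvgM; first by apply: cvgB; [exact: cvg_cst|apply: cvgM => //; exact: cvg_cst].
apply: cvgD; first exact: cvg_cst.
by apply: cvgM; [exact: cvg_cst|apply: cvgB => //; exact: cvg_cst].
Qed.

Lemma rint_unit (f : R -> R) : continuous f -> leb.-integrable `]0, 1[ (EFin \o f).
Proof.
move=> cf; apply: (integrableS _ _ _ (continuous_rint 0 1 cf)) => //.
exact: subset_itv_oo_cc.
Qed.

Lemma time_map_continuous B : 0 <= B < 1 -> {in `]- B, B[%classic, continuous time_map}.
Proof.
move=> hB; have /andP[B0 B1] := hB; have fl := floor_gt0 hB.
have inB (b : R) : b \in `]- B, B[ -> `|b| <= B by rewrite in_itv/= -ltr_norml => /ltW.
apply: (@continuity_under_integral R _ _ leb transit `]0, 1[%classic (measurable_itv _) (- B) B _ _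
   (cst (Num.sqrt ((1 - B ^+ 2) * (LH ^+ 2 * (1 - B ^+ 2))))^-1)).
- by move=> b /inB bB; apply: rint_unit; apply: transit_continuous; exact: le_lt_trans B1.
- apply: aeW => s _ b /set_mem /inB bB; apply: transit_continuous_amplitude; exact: le_lt_trans B1.
- by apply: rint_unit => s; exact: cvg_cst.
- move=> b /inB bB; apply: aeW => s _ /=.
  have r0 : 0 < radicand b (clamp 1 s) by apply: radicand_gt0 => //; exact: le_lt_trans B1.
  rewrite ger0_norm ?invr_ge0 ?sqrtr_ge0//.
  by rewrite lef_pV2 ?posrE ?sqrtr_gt0// ler_wsqrtr// radicand_ge.
Qed.

(** Solutions of vanishing amplitude take the time of the linearised equation;
    the primitive is h^-1 atan (h c / sqrt (h ^ 2 (1 - c ^ 2) + LH ^ 2)). *)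
Lemma time_map0 : time_map 0 = critical_depth h LH.
Proof.
pose den (c : R) : R := Num.sqrt (h ^+ 2 * (1 - c ^+ 2) + LH ^+ 2).
have den2_gt0 (c : R) : 0 <= c <= 1 -> 0 < h ^+ 2 * (1 - c ^+ 2) + LH ^+ 2.
  move=> /andP[c0 c1]; apply: ltr_wpDl => //; apply: mulr_ge0; first exact: ltW.
  by rewrite subr_ge0 -[leRHS](expr1n _ 2) lerXn2r// nnegrE.
pose F (c : R) : R := h^-1 * atan (h * c / den c).
have dF (c : R) : 0 <= c <= 1 -> is_derive c (1 : R) F (den c)^-1.
  move=> hc; have d0 := den2_gt0 _ hc.
  have e0 : den c != 0 by rewrite gt_eqF// sqrtr_gt0.
  have e2 : den c ^+ 2 = h ^+ 2 * (1 - c ^+ 2) + LH ^+ 2 by rewrite sqr_sqrtr// ltW.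
  have h1 : is_derive c (1 : R) (fun c => h ^+ 2 * (1 - c ^+ 2) + LH ^+ 2) (- (2 * h ^+ 2 * c)).
    have X := is_deriveX 2 (is_derive_id c (1 : R)).
    have Y := is_deriveZ (h ^+ 2) (is_deriveB (is_derive_cst (1 : R) c (1 : R)) X).
    have Z := is_deriveD Y (is_derive_cst (LH ^+ 2) c (1 : R)).
    by apply: (is_derive_eq Z); rewrite /GRing.scale/=; ring.
  have h3 : is_derive c (1 : R) den (- (h ^+ 2 * c / den c)).
    have X := @is_derive1_comp R (@Num.sqrt R) (fun c => h ^+ 2 * (1 - c ^+ 2) + LH ^+ 2) c _ _ (is_derive1_sqrt d0) h1.
    by apply: (is_derive_eq X); rewrite -/(den c); field.
  have h4 := @is_deriveV R den c _ (1 : R) e0 h3.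
  have h5 := is_deriveZ h (is_deriveM (is_derive_id c (1 : R)) h4).
  have h6 : is_derive c (1 : R) (fun c => h * c / den c) (h * (h ^+ 2 + LH ^+ 2) / den c ^+ 3).
    have E : (fun c => h * c / den c) = h \*: (id * (fun c => (den c)^-1)).
      by apply/funext => x /=; rewrite /GRing.scale/= -mulrA.
    rewrite E; apply: (is_derive_eq h5); rewrite /GRing.scale/=.
    have -> : h ^+ 2 + LH ^+ 2 = den c ^+ 2 + h ^+ 2 * c ^+ 2 by rewrite e2; ring.
    by field.
  have h7 := is_deriveZ h^-1 (@is_derive1_comp R atan (fun c => h * c / den c) c _ _ (is_derive1_atan _) h6).
  apply: (is_derive_eq h7); rewrite /GRing.scale/=.
  have -> : h ^+ 2 + LH ^+ 2 = den c ^+ 2 + h ^+ 2 * c ^+ 2 by rewrite e2; ring.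
  have D0 : 0 < den c ^+ 2 + (h * c) ^+ 2.
    by rewrite ltr_wpDr ?sqr_ge0// exprn_gt0// sqrtr_gt0.
  by field; rewrite e0 !gt_eqF.
have cF : continuous (fun s => F (clamp 1 s)).
  move=> s; apply: (@continuous_comp _ _ _ (clamp 1) F); first exact: continuous_clamp.
  apply: differentiable_continuous; apply/derivable1_diffP.
  by have [] := dF _ (clamp1 s).
have cT : continuous (transit 0) by apply: transit_continuous; rewrite normr0.
have dFT (s : R) : 0 < s < 1 -> is_derive s (1 : R) (fun s : R => F (clamp 1 s)) (transit 0 s).
  move=> hs'; have /andP[s0 s1] := hs'; have hs : 0 <= s <= 1 by rewrite (ltW s0) (ltW s1).
  have -> : transit 0 s = (den s)^-1.
    by rewrite /transit clamp_id// /radicand expr0n/= mul0r !subr0 mul1r mulr1.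
  apply: (@near_eq_is_derive _ _ _ F); last exact: dF.
  by have := near_clamp_id hs'; apply: filterS => t ->.
rewrite /time_map (FTC_itv ltr01 cT cF dFT).
rewrite !clamp_id ?lexx ?ler01// /F mulr0 mul0r atan0 mulr0 subr0 /critical_depth mulr1.
by rewrite /den expr1n subrr mulr0 add0r sqrtr_sqr gtr0_norm.
Qed.

(** The square root of the radicand is at most 2 C (1 - b c), where
    C ^ 2 = h ^ 2 + LH ^ 2, so the time map is at least - ln (1 - b) / (2 C b)
    and tends to infinity as b tends to 1. *)
Lemma time_map_large d : 0 < d -> exists b, 0 < b < 1 /\ d <= time_map b.
Proof.
move=> d0; pose C : R := Num.sqrt (h ^+ 2 + LH ^+ 2).
have C0 : 0 < C by rewrite sqrtr_gt0 addr_gt0.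
have C2 : C ^+ 2 = h ^+ 2 + LH ^+ 2 by rewrite sqr_sqrtr// ltW// addr_gt0.
(* This b makes the lower bound equal to d / b. *)
pose b : R := 1 - expR (- (2 * C * d)).
have e1 : 0 < expR (- (2 * C * d)) < 1.
  by rewrite expR_gt0/= expR_lt1 oppr_lt0 mulr_gt0// mulr_gt0.
have b01 : 0 < b < 1 by move: e1; rewrite /b => /andP[? ?]; apply/andP; split; lra.
exists b; split=> //; have /andP[b0 b1] := b01.
have nb : `|b| < 1 by rewrite gtr0_norm.
have den_gt0 (c : R) : 0 <= c <= 1 -> 0 < 1 - b * c.
  move=> /andP[c0 c1]; rewrite subr_gt0; apply: le_lt_trans b1; exact: ler_piMr (ltW b0) c1.
pose k (s : R) : R := (2 * C)^-1 * (1 - b * clamp 1 s)^-1.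
have ck : continuous k.
  move=> s; apply: cvgM; first exact: cvg_cst.
  apply: cvgV; first by rewrite gt_eqF// den_gt0.
  apply: cvgB; first exact: cvg_cst.
  by apply: cvgM; [exact: cvg_cst|exact: continuous_clamp].
pose F (c : R) : R := - (2 * C * b)^-1 * ln (1 - b * c).
have dF (c : R) : 0 <= c <= 1 -> is_derive c (1 : R) F ((2 * C)^-1 * (1 - b * c)^-1).
  move=> hc; have g0 := den_gt0 _ hc.
  have h1 : is_derive c (1 : R) (fun c => 1 - b * c) (- b).
    have X := is_deriveB (is_derive_cst (1 : R) c (1 : R)) (is_deriveZ b (is_derive_id c (1 : R))).
    by apply: (is_derive_eq X); rewrite sub0r /GRing.scale/= mulr1.
  have h2 := is_deriveZ (- (2 * C * b)^-1) (@is_derive1_comp R (@ln R) (fun c => 1 - b * c) c _ _ (is_derive1_ln g0) h1).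
  by apply: (is_derive_eq h2); rewrite /GRing.scale/=; field; rewrite !gt_eqF.
have cF : continuous (fun s => F (clamp 1 s)).
  move=> s; apply: (@continuous_comp _ _ _ (clamp 1) F); first exact: continuous_clamp.
  apply: differentiable_continuous; apply/derivable1_diffP.
  by have [] := dF _ (clamp1 s).
have kE : \int[leb]_(s in `]0, 1[) k s = d / b.
  have dFk (s : R) : 0 < s < 1 -> is_derive s (1 : R) (fun s : R => F (clamp 1 s)) (k s).
    move=> /andP[s0 s1]; have hs : 0 <= s <= 1 by rewrite (ltW s0) (ltW s1).
    rewrite /k clamp_id//; apply: (@near_eq_is_derive _ _ _ F); last exact: dF.
    have hs' : 0 < s < 1 by rewrite s0.
    by have := near_clamp_id hs'; apply: filterS => t ->.
  rewrite (FTC_itv ltr01 ck cF dFk) !clamp_id ?lexx ?ler01// /F mulr0 subr0 ln1 mulr0 subr0 mulr1 /b subKr expRK.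
  by rewrite -/b; field; rewrite !gt_eqF.
apply: (@le_trans _ _ (d / b)); first by rewrite ler_pdivlMr// ler_piMr// ltW.
rewrite -kE; apply: le_Rintegral => //.
- exact: rint_unit.
- by apply: rint_unit; exact: transit_continuous.
move=> s _; rewrite /k /transit -invfM; have hc := clamp1 s; have /andP[c0 c1] := hc.
have r0 := radicand_gt0 nb hc; have g0 := den_gt0 _ hc.
rewrite lef_pV2 ?posrE ?sqrtr_gt0//; last by rewrite !mulr_gt0.
rewrite -[leRHS]ger0_norm; last by rewrite ltW// !mulr_gt0.
rewrite -sqrtr_sqr ler_wsqrtr//; move: (clamp 1 s) c0 c1 g0 {hc r0} => c c0 c1 g0.
have bc : 0 <= b * c by rewrite mulr_ge0// ltW.
have b2 : b ^+ 2 <= 1 by rewrite -[leRHS](expr1n _ 2) lerXn2r// ?nnegrE ltW.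
have c2 : c ^+ 2 <= 1 by rewrite -[leRHS](expr1n _ 2) lerXn2r// nnegrE.
have bc2 : b ^+ 2 * c ^+ 2 <= c ^+ 2 by rewrite ler_piMl// sqr_ge0.
have bc3 : b ^+ 2 * c ^+ 2 <= b ^+ 2 by rewrite ler_piMr// sqr_ge0.
have r1 : 1 - b ^+ 2 * c ^+ 2 <= 2 * (1 - b * c).
  by rewrite -exprMn -subr_ge0 (_ : _ - _ = (1 - b * c) ^+ 2) ?sqr_ge0//; ring.
have r2 : h ^+ 2 * (1 - c ^+ 2) + LH ^+ 2 * (1 - b ^+ 2) <= C ^+ 2 * (2 * (1 - b * c)).
  rewrite C2 mulrDl; apply: lerD; rewrite ler_pM2l//; lra.
have -> : (2 * C * (1 - b * c)) ^+ 2 = 2 * (1 - b * c) * (C ^+ 2 * (2 * (1 - b * c))) by ring.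
rewrite /radicand; apply: ler_pM => //; first lra.
by apply: addr_ge0; (apply: mulr_ge0; [exact: ltW|lra]).
Qed.

(** The intermediate value theorem between the critical depth at b = 0 and
    arbitrarily large values near b = 1. *)
Lemma time_map_onto d : critical_depth h LH < d -> exists b, 0 < b < 1 /\ time_map b = d.
Proof.
move=> dc; have d_gt0 : 0 < d.
  apply: lt_trans dc; rewrite /critical_depth mulr_gt0 ?invr_gt0//.
  by rewrite -(@atan0 R) lt_atan// divr_gt0.
have [b1 [/andP[b10 b11] hb1]] := time_map_large d_gt0.
pose B := (1 + b1) / 2.
have hB : 0 <= B < 1 by rewrite /B; apply/andP; split; lra.
have b1B : b1 < B by rewrite /B; lra.
have cT : {within `[0, b1], continuous time_map}.
  apply: continuous_in_subspaceT => b; rewrite inE/= in_itv/= => /andP[b0 bb].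
  apply: (time_map_continuous hB); rewrite inE/= in_itv/=; apply/andP; split.
    by apply: lt_le_trans b0; rewrite oppr_lt0 (lt_trans b10).
  exact: le_lt_trans b1B.
have [|b] := @IVT R time_map 0 b1 d (ltW b10) cT.
  by rewrite time_map0 ge_min le_max (ltW dc) hb1 orbT.
rewrite in_itv/= => /andP[b0 bb] bd; exists b; split => //.
rewrite (le_lt_trans bb b11) andbT lt_neqAle b0 andbT; apply/eqP => bE.
by move: dc; rewrite -time_map0 bE bd ltxx.
Qed.

(** The substitution sin u = b c in the travel time. *)
Lemma time_map_travel b P : 0 < b < 1 -> (forall u, is_derive u (1 : R) P (slowness h LH (asin b) u)) ->
  P (asin b) - P 0 = time_map b.
Proof.
move=> /andP[b0 b1] dP; have nb : `|b| < 1 by rewrite gtr0_norm.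
have b11 : -1 < b < 1 by rewrite b1 andbT (lt_trans _ b0)// ltrN10.
have bcb c : 0 <= c <= 1 -> 0 <= b * c <= b.
  by move=> /andP[c0 c1]; rewrite mulr_ge0 ?ler_piMr// ltW.
have bc1 c : 0 <= c <= 1 -> -1 < b * c < 1.
  move=> /bcb/andP[bc0 bcb']; rewrite (le_lt_trans bcb' b1) andbT (lt_le_trans _ bc0)// ltrN10.
have asin_in (x : R) : 0 <= x <= b -> 0 <= asin x <= asin b.
  move=> /andP[x0 xb].
  have x11 : -1 <= x <= 1 by apply/andP; split; lra.
  have i0 : -1 <= (0 : R) <= 1 by apply/andP; split; lra.
  have ib : -1 <= b <= 1 by apply/andP; split; lra.
  by rewrite -{1}(@asin_0 R) !leNgt !asin_lt// -!leNgt x0.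
have cP := is_derive_continuous dP.
pose F (c : R) : R := P (asin (b * c)).
have dF (c : R) : 0 <= c <= 1 -> is_derive c (1 : R) F (Num.sqrt (radicand b c))^-1.
  move=> hc; have h0 := bc1 _ hc.
  have h1 : is_derive c (1 : R) (fun c => b * c) b.
    have X := is_deriveZ b (is_derive_id c (1 : R)).
    by apply: (is_derive_eq X); rewrite /GRing.scale/= mulr1.
  have h2 := @is_derive1_comp R asin (fun c => b * c) c _ _ (is_derive1_asin h0) h1.
  have h3 := @is_derive1_comp R P (fun c => asin (b * c)) c _ _ (dP _) h2.
  apply: (is_derive_eq h3); rewrite /slowness.
  have bci : -1 <= b * c <= 1 by case/andP: h0 => /ltW -> /ltW ->.
  have bi : -1 <= b <= 1 by case/andP: b11 => /ltW -> /ltW ->.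
  rewrite (clamp_id (asin_in _ (bcb _ hc))) /kinetic !asinK ?in_itv//= cos_asin//.
  have b2 : 0 < 1 - b ^+ 2 by rewrite subr_gt0 -[ltRHS](expr1n _ 2) ltrXn2r// ?nnegrE// ltW.
  rewrite sqr_sqrtr ?(ltW b2)//.
  have c2 : c ^+ 2 <= 1 by case/andP: hc => c0 c1; rewrite -[leRHS](expr1n _ 2) lerXn2r// nnegrE.
  have b1c : 0 <= 1 - (b * c) ^+ 2.
    by rewrite exprMn subr_ge0 (le_trans (ler_piMr (sqr_ge0 b) c2))// -subr_ge0 ltW.
  set X := h ^+ 2 * (1 - c ^+ 2) + LH ^+ 2 * (1 - b ^+ 2).
  have -> : radicand b c = (1 - (b * c) ^+ 2) * X by rewrite /radicand exprMn.
  have -> : h ^+ 2 * (b ^+ 2 - (b * c) ^+ 2) + LH ^+ 2 * (b ^+ 2 * (1 - b ^+ 2)) = b ^+ 2 * X by rewrite /X; ring.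
  rewrite (sqrtrM X (sqr_ge0 b)) (sqrtrM X b1c) sqrtr_sqr gtr0_norm// !invfM.
  move: (Num.sqrt X)^-1 (Num.sqrt (1 - (b * c) ^+ 2))^-1 => p q.
  by field; rewrite gt_eqF.
have cF : continuous (fun s => F (clamp 1 s)).
  move=> s; apply: (@continuous_comp _ _ _ (clamp 1) F); first exact: continuous_clamp.
  apply: differentiable_continuous; apply/derivable1_diffP.
  by have [] := dF _ (clamp1 s).
have dFT (s : R) : 0 < s < 1 -> is_derive s (1 : R) (fun s : R => F (clamp 1 s)) (transit b s).
  move=> hs'; have /andP[s0 s1] := hs'; have hs : 0 <= s <= 1 by rewrite (ltW s0) (ltW s1).
  rewrite /transit clamp_id//; apply: (@near_eq_is_derive _ _ _ F); last exact: dF.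
  by have := near_clamp_id hs'; apply: filterS => t ->.
rewrite /time_map (FTC_itv ltr01 (transit_continuous nb) cF dFT).
by rewrite !clamp_id ?lexx ?ler01// /F mulr0 mulr1 asin_0.
Qed.

Lemma vertical_profile d : critical_depth h LH < d -> exists f f' : R -> R,
  [/\ (forall t, is_derive t (1 : R) f (f' t)), continuous f',
      (forall t, 0 < t < d -> is_derive t (1 : R) f' (- (h ^+ 2 * (sin (f t) * cos (f t))))) &
   [/\ f d = 0, f' 0 = - (LH * (sin (f 0) * cos (f 0))),
      (forall t, 0 <= t <= d -> 0 <= f t < pi / 2) & forall t, 0 <= t < d -> 0 < f t]].
Proof.
move=> dc; have d_gt0 : 0 < d.
  apply: lt_trans dc; rewrite /critical_depth mulr_gt0 ?invr_gt0//.
  by rewrite -(@atan0 R) lt_atan// divr_gt0.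
have [b [hb bd]] := time_map_onto dc; have /andP[b0 b1] := hb.
have i0 : -1 <= (0 : R) <= 1 by apply/andP; split; lra.
have ib : -1 <= b <= 1 by apply/andP; split; lra.
have a_gt0 : 0 < asin b by rewrite -(@asin_0 R) asin_lt.
have a_lt : asin b < pi / 2 by apply: asin_ltpi2; rewrite b1 andbT (le_trans _ (ltW b0))// lerN10.
have [P dP] : exists P, forall u, is_derive u (1 : R) P (slowness h LH (asin b) u).
  apply: primitive_exists; first exact: slowness_continuous.
  by move=> u u0; rewrite /slowness /clamp !min_l ?ltW// ?(le_lt_trans u0)// max_l// maxxx.
exact: (@profile_exists R h LH h_gt0 LH_gt0 (asin b) a_gt0 a_lt d P dP d_gt0 (etrans (time_map_travel hb dP) bd)).
Qed.

End time_map.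

(** * The deep case *)

Section gap.
Context {R : realType}.

(** The nonlinearity sin p cos p as a multiple of p. *)
Definition secant (p : R) : R := sin p * cos p / p.

Lemma sincos_gt0 (t : R) : 0 < t < pi / 2 -> 0 < sin t * cos t.
Proof.
move=> /andP[t0 tp]; apply: mulr_gt0; first by apply: sin_gt0_pihalf; rewrite t0.
by apply: cos_gt0_pihalf; rewrite tp andbT (lt_trans _ t0)// oppr_lt0 divr_gt0// pi_gt0.
Qed.

Let sincos_derive (t : R) : is_derive t (1 : R) (fun t => sin t * cos t) (cos t ^+ 2 - sin t ^+ 2).
Proof.
have h := is_deriveM (is_derive_sin t) (is_derive_cos t); apply: (is_derive_eq h).
by rewrite /GRing.scale/=; ring.
Qed.

(** This is 2 t cos (2 t) < sin (2 t); the difference of the two sides has the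
    derivative 4 t sin t cos t > 0. *)
Lemma sincos_gt_tangent (t : R) : 0 < t < pi / 2 -> t * (cos t ^+ 2 - sin t ^+ 2) < sin t * cos t.
Proof.
move=> /andP[t0 tp]; pose q (t : R) : R := sin t * cos t - t * (cos t ^+ 2 - sin t ^+ 2).
have dq (s : R) : is_derive s (1 : R) q (4 * s * (sin s * cos s)).
  have h1 : is_derive s (1 : R) (fun t => cos t ^+ 2 - sin t ^+ 2) (- (4 * (sin s * cos s))).
    have h := is_deriveB (is_deriveX 2 (is_derive_cos s)) (is_deriveX 2 (is_derive_sin s)).
    by apply: (is_derive_eq h); rewrite /GRing.scale/=; ring.
  have h2 := is_deriveB (sincos_derive s) (is_deriveM (is_derive_id s (1 : R)) h1).
  by apply: (is_derive_eq h2); rewrite /GRing.scale/=; ring.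
have cq : {within `[0, t], continuous q}.
  by apply: continuous_subspaceT; exact: is_derive_continuous dq.
have [c] := MVT t0 (fun s _ => dq s) cq.
rewrite in_itv/= => /andP[c0 ct] E.
have q0 : q 0 = 0 by rewrite /q sin0 !mul0r subr0.
have : 0 < q t - q 0.
  rewrite E subr0; apply: mulr_gt0 => //; apply: mulr_gt0; first exact: mulr_gt0.
  by apply: sincos_gt0; rewrite c0 (lt_trans ct).
by rewrite q0 subr0 subr_gt0.
Qed.

Lemma secant_decreasing (x y : R) : 0 < x -> x < y -> y < pi / 2 -> secant y < secant x.
Proof.
move=> x0 xy yp.
have ds (t : R) : 0 < t -> is_derive t (1 : R) secant ((t * (cos t ^+ 2 - sin t ^+ 2) - sin t * cos t) / t ^+ 2).
  move=> t0; have n0 : t != 0 by rewrite gt_eqF.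
  have h1 := is_deriveM (sincos_derive t) (@is_deriveV R id t _ (1 : R) n0 (is_derive_id t (1 : R))).
  by apply: (is_derive_eq h1); rewrite /GRing.scale/=; field.
have dxy (t : R) : t \in `]x, y[ -> is_derive t (1 : R) secant ((t * (cos t ^+ 2 - sin t ^+ 2) - sin t * cos t) / t ^+ 2).
  by rewrite in_itv/= => /andP[xt _]; apply: ds; exact: lt_trans xt.
have cs : {within `[x, y], continuous secant}.
  apply: derivable_within_continuous => t; rewrite in_itv/= => /andP[xt _].
  by have [] := ds t (lt_le_trans x0 xt).
have [c] := MVT xy dxy cs; rewrite in_itv/= => /andP[xc cy] E.
rewrite -subr_lt0 E nmulr_rlt0 ?subr_gt0// pmulr_llt0; last by rewrite invr_gt0 exprn_gt0// (lt_trans x0).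
by rewrite subr_lt0; apply: sincos_gt_tangent; rewrite (lt_trans x0)//= (lt_trans cy).
Qed.

(** The weight of u ^ 2 is such that p is a critical point of
    u |-> secant p * u ^ 2 + cos ^ 2 u; the gap is the excess over the value at p. *)
Definition gap (p u : R) : R := secant p * (u * u - p * p) + (cos u ^+ 2 - cos p ^+ 2).

Lemma gap_self p : gap p p = 0. Proof. by rewrite /gap !subrr mulr0 addr0. Qed.

Lemma gapN p u : gap p (- u) = gap p u. Proof. by rewrite /gap mulrNN cosN. Qed.

(** The derivative in u is 2 u (secant p - secant u), which has the sign of
    u - p on (0, pi / 2) because the secant slope decreases. Beyond pi / 2 the
    term cos ^ 2 u is at least its value 0 at pi / 2, and the other one grows. *)
Lemma gap_gt0 (p u : R) : 0 < p < pi / 2 -> 0 <= u -> u != p -> 0 < gap p u.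
Proof.
move=> /andP[p0 pp] u0 up.
have dg (t : R) : is_derive t (1 : R) (gap p) (2 * (secant p * t - sin t * cos t)).
  have h1 := is_deriveB (is_deriveM (is_derive_id t (1 : R)) (is_derive_id t (1 : R))) (is_derive_cst (p * p) t (1 : R)).
  have h2 := is_deriveB (is_deriveX 2 (is_derive_cos t)) (is_derive_cst (cos p ^+ 2) t (1 : R)).
  have h3 := is_deriveD (is_deriveZ (secant p) h1) h2.
  by apply: (is_derive_eq h3); rewrite /GRing.scale/=; ring.
have cg a b : {within `[a, b], continuous (gap p)}.
  by apply: continuous_subspaceT; exact: is_derive_continuous dg.
have dgE (t : R) : 0 < t -> 2 * (secant p * t - sin t * cos t) = 2 * t * (secant p - secant t).
  move=> t0; have <- : secant t * t = sin t * cos t by rewrite /secant divfK// gt_eqF.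
  ring.
have right (v : R) : p < v -> v <= pi / 2 -> 0 < gap p v.
  move=> pv vp; have [c] := MVT pv (fun t _ => dg t) (cg p v).
  rewrite in_itv/= => /andP[pc cv]; have c0 := lt_trans p0 pc.
  rewrite gap_self subr0 dgE// => ->.
  by rewrite mulr_gt0 ?subr_gt0// mulr_gt0 ?mulr_gt0// subr_gt0 secant_decreasing// (lt_le_trans cv).
have [up'|pu|upE] := ltgtP u p; last by rewrite upE eqxx in up.
- have [c] := MVT up' (fun t _ => dg t) (cg u p).
  rewrite in_itv/= => /andP[uc cp]; have c0 := le_lt_trans u0 uc.
  rewrite gap_self sub0r dgE// => /eqP; rewrite eqr_oppLR => /eqP ->.
  rewrite -mulNr mulr_gt0 ?subr_gt0// -mulrN opprB mulr_gt0 ?mulr_gt0// subr_gt0.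
  exact: secant_decreasing.
have [upi|upi] := leP u (pi / 2); first exact: right.
apply: lt_le_trans (right (pi / 2) pp (lexx _)) _.
have s0 : 0 <= secant p by rewrite /secant divr_ge0 ?(ltW p0)// ltW// sincos_gt0// p0.
rewrite /gap cos_pihalf expr0n/=.
apply: lerD; last by rewrite lerD2r sqr_ge0.
have pi0 : 0 <= pi / 2 :> R by rewrite divr_ge0// pi_ge0.
by rewrite ler_wpM2l// lerD2r ler_pM// ltW.
Qed.

Lemma gap_ge0 (p u : R) : 0 < p < pi / 2 -> 0 <= gap p u.
Proof.
move=> hp; wlog u0 : u / 0 <= u.
  by move=> H; have [/H//|/ltW u0] := leP 0 u; rewrite -gapN; apply: H; rewrite oppr_ge0.
have [->|up] := eqVneq u p; first by rewrite gap_self.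
exact: ltW (gap_gt0 hp u0 up).
Qed.

Lemma gap_eq0 (p u : R) : 0 < p < pi / 2 -> gap p u = 0 -> `|u| = p.
Proof.
move=> hp gu; apply/eqP/negPn/negP; have [u0|u0] := leP 0 u.
  by rewrite ger0_norm// => up; have := gap_gt0 hp u0 up; rewrite gu ltxx.
have nu0 : 0 <= - u by rewrite oppr_ge0 ltW.
by rewrite ltr0_norm// => up; have := gap_gt0 hp nu0 up; rewrite gapN gu ltxx.
Qed.

End gap.

Section deep.
Context {R : realType}.
Variables d h LH : R.
Hypotheses (d_gt0 : 0 < d) (h_gt0 : 0 < h) (LH_gt0 : 0 < LH).
Let mO := measurable_Omega d.
Let mC := @measurable_cell R.
Let fO := vol_Omega d.
Let fC := @area_cell R.

Variables f f' : R -> R.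
Hypothesis df : forall t : R, is_derive t (1 : R) f (f' t).
Hypothesis cf' : continuous f'.
Hypothesis df' : forall t : R, 0 < t < d -> is_derive t (1 : R) f' (- (h ^+ 2 * (sin (f t) * cos (f t)))).
Hypothesis fd : f d = 0.
Hypothesis f'0 : f' 0 = - (LH * (sin (f 0) * cos (f 0))).
Hypothesis f_itv : forall t, 0 <= t <= d -> 0 <= f t < pi / 2.
Hypothesis f_gt0 : forall t, 0 <= t < d -> 0 < f t.

Let u0 : space R -> R := fun x => f x.2.
Let cf : continuous f := is_derive_continuous df.
Let hu0 : H1P d u0 := vertical_H1P d_gt0 df cf' fd.
Let f'' (t : R) : R := - (h ^+ 2 * (sin (f t) * cos (f t))).

Let cf'' : continuous f''.
Proof.
move=> t; apply: cvgN; apply: cvgM; first exact: cvg_cst.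
by apply: cvgM; apply: continuous_comp; [exact: cf|exact: continuous_sin|exact: cf|exact: continuous_cos].
Qed.

Let f_in t : 0 <= t < d -> 0 < f t < pi / 2.
Proof.
move=> /andP[t0 td]; rewrite f_gt0 ?t0//=.
by have /andP[] : 0 <= f t < pi / 2 by apply: f_itv; rewrite t0 ltW.
Qed.

Let f_in_Omega x : Omega d x -> 0 < f x.2 < pi / 2.
Proof. by move=> /Omega_x3/andP[/ltW x0 xd]; apply: f_in; rewrite x0. Qed.

Let f0_in : 0 < f 0 < pi / 2. Proof. by apply: f_in; rewrite lexx. Qed.

Lemma profile_weak_form v : H1P d v -> weak_form d h LH u0 v = 0.
Proof. exact: (vertical_weak_form d_gt0 df cf' cf'' df' fd (fun t _ => erefl) f'0). Qed.

Lemma profile_SG : SG_solution d h LH u0.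
Proof.
split=> // v hv; have := profile_weak_form hv; rewrite /weak_form -addrA -opprD.
by move/eqP; rewrite subr_eq0 => /eqP.
Qed.

Let kappa (t : R) : R := h ^+ 2 * secant (f t).

Let kappaK (t : R) : 0 < t < d -> 0 <= kappa t <= h ^+ 2.
Proof.
move=> /andP[/ltW t0 td]; have ht : 0 < f t < pi / 2 by apply: f_in; rewrite t0.
have /andP[p0 pp] := ht; have h2 : 0 <= h ^+ 2 by exact: sqr_ge0.
have s0 := sincos_gt0 ht.
rewrite /kappa mulr_ge0//=; last by rewrite /secant divr_ge0// ltW.
apply: ler_piMr => //; rewrite /secant ler_pdivrMr// mul1r.
apply: le_trans (sin_le_id (ltW p0)); apply: ler_piMr; last exact: cos_le1.
apply: sin_ge0_pi; rewrite (ltW p0)/=; apply: le_trans (ltW pp) _.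
by rewrite ler_pdivrMr// ler_peMr// ?pi_ge0// ler1n.
Qed.

Let f_secant (p : R) : 0 < p -> secant p * p = sin p * cos p.
Proof. by move=> p0; rewrite /secant divfK// gt_eqF. Qed.

Let f_ge0 (t : R) : 0 <= t <= d -> 0 <= f t. Proof. by move=> /f_itv/andP[]. Qed.

Let kappaE (t : R) : 0 < t < d -> f'' t = - (kappa t * f t).
Proof.
move=> /andP[t0 td]; rewrite /f'' /kappa -mulrA f_secant//.
by apply: f_gt0; rewrite ltW.
Qed.

(** The profile f is itself a positive solution of a linear equation, with
    kappa = h ^ 2 secant f and lambda = LH secant (f 0). *)
Lemma profile_Jacobi u : H1P d u ->
  \int[vol]_(x in Omega d) (kappa x.2 * u x * u x) +
  LH * secant (f 0) * \int[area]_(y in cell) (trace d 0 u y ^+ 2) <= dirichlet d u u.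
Proof.
move=> hu; apply: le_trans (vertical_dirichlet_le hu).
apply: (Jacobi d_gt0 cf cf' cf'' (fun t _ => df t) df' f_ge0 f_gt0 kappaE kappaK _ hu).
by rewrite f'0 -mulrA f_secant//; case/andP: f0_in.
Qed.

Let cos2E (t : R) : cos (2 * t) + 1 = 2 * cos t ^+ 2.
Proof.
have -> : 2 * t = t + t by ring.
by rewrite cosD -!expr2 sin2cos2; ring.
Qed.

Let L2_secant u : L2 vol (Omega d) u -> L2 vol (Omega d) (fun x => secant (f x.2) * u x).
Proof.
move=> lu; have := L2Z mO (h ^- 2) (kappa_L2 d_gt0 cf cf'' f_ge0 f_gt0 kappaE kappaK lu).
congr (L2 vol _ _); apply/funext => x.
by rewrite /kappa; field; rewrite gt_eqF.
Qed.

Let rint_cos2 dd (T : measurableType dd) (mu : {measure set T -> \bar R}) (D : set T) (v : T -> R) :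
  measurable D -> (mu D < +oo)%E -> measurable_fun D v -> mu.-integrable D (EFin \o (fun x => cos (v x) ^+ 2)).
Proof.
move=> mD fD mv; apply: (rint_bounded mD fD (M := 1)).
  by apply: measurable_funX; exact: measurable_cos.
move=> x _; rewrite ger0_norm ?sqr_ge0// -[leRHS](expr1n _ 2) -[leLHS]real_normK ?num_real//.
Qed.

Let volume_gap u : H1P d u ->
  vol.-integrable (Omega d) (EFin \o (fun x => gap (f x.2) (u x))) /\
  \int[vol]_(x in Omega d) gap (f x.2) (u x) =
    \int[vol]_(x in Omega d) (secant (f x.2) * u x * u x) -
    \int[vol]_(x in Omega d) (sin (u0 x) * cos (u0 x) * u0 x) +
    (\int[vol]_(x in Omega d) (cos (u x) ^+ 2) - \int[vol]_(x in Omega d) (cos (u0 x) ^+ 2)).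
Proof.
move=> hu; have lu := H1_L2 hu.1; have l0 := H1_L2 hu0.1.
have i1 := L2_mul mO (L2_secant lu) lu.
have i2 := L2_mul mO (L2_sincos mO fO l0.1) l0.
have i3 := rint_cos2 mO fO lu.1; have i4 := rint_cos2 mO fO l0.1.
have E x : Omega d x -> secant (f x.2) * u x * u x - sin (u0 x) * cos (u0 x) * u0 x +
    (cos (u x) ^+ 2 - cos (u0 x) ^+ 2) = gap (f x.2) (u x).
  move=> /f_in_Omega/andP[fx _]; rewrite /gap /u0 -f_secant//; ring.
have i := rintD mO (rintB mO i1 i2) (rintB mO i3 i4); split.
  by apply: eq_integrable i => // x /set_mem Ox /=; rewrite E.
rewrite -(RintegralB mO i1 i2) -(RintegralB mO i3 i4) -(RintegralD mO (rintB mO i1 i2) (rintB mO i3 i4)).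
by apply: eq_Rintegral => x /set_mem Ox; rewrite E.
Qed.

Let surface_gap u : H1P d u ->
  \int[area]_(y in cell) gap (f 0) (trace d 0 u y) =
    secant (f 0) * \int[area]_(y in cell) (trace d 0 u y ^+ 2) -
    \int[area]_(y in cell) (sin (trace d 0 u0 y) * cos (trace d 0 u0 y) * trace d 0 u0 y) +
    (\int[area]_(y in cell) (cos (trace d 0 u y) ^+ 2) - \int[area]_(y in cell) (cos (trace d 0 u0 y) ^+ 2)).
Proof.
move=> hu; have tu := trace_L2 d_gt0 hu; have t0 := trace_L2 d_gt0 hu0.
have i1 := rintZ mC (secant (f 0)) tu.2.
have i2 := L2_mul mC (L2_sincos mC fC t0.1) t0.
have i3 := rint_cos2 mC fC tu.1; have i4 := rint_cos2 mC fC t0.1.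
have mg : measurable_fun cell (fun y => gap (f 0) (trace d 0 u y)).
  apply: measurable_funD.
    apply: measurable_funM => //; apply: measurable_funB => //; apply: measurable_funM; exact: tu.1.
  by apply: measurable_funB => //; exact: (rint_measurable i3).
have i := rintD mC (rintB mC i1 i2) (rintB mC i3 i4).
rewrite -(RintegralZl _ mC tu.2).
rewrite -(RintegralB mC i1 i2) -(RintegralB mC i3 i4) -(RintegralD mC (rintB mC i1 i2) (rintB mC i3 i4)).
apply: (eq_Rintegral_ae mC mg (rint_measurable i)).
have := trace_eq d_gt0 hu0 (vertical_trace d_gt0 df cf' 0).
apply: (@filterS _ _ (ae_filter_ringOfSetsType area)) => y yE Cy; rewrite (yE Cy).
rewrite /gap -f_secant; last by case/andP: f0_in.
by ring.
Qed.

Let potential_cos2 dd (T : measurableType dd) (mu : {measure set T -> \bar R}) (D : set T) (v : T -> R) :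
  measurable D -> (mu D < +oo)%E -> measurable_fun D v ->
  \int[mu]_(x in D) (cos (2 * v x) + 1) = 2 * \int[mu]_(x in D) (cos (v x) ^+ 2).
Proof.
move=> mD fD mv; rewrite -(RintegralZl _ mD (rint_cos2 mD fD mv)).
by apply: eq_Rintegral => x _; rewrite cos2E.
Qed.

Let energy_cos2 u : H1P d u -> energy d h LH u = 2^-1 * dirichlet d u u
  + h ^+ 2 / 4 * (2 * \int[vol]_(x in Omega d) (cos (u x) ^+ 2))
  + LH / 4 * (2 * \int[area]_(y in cell) (cos (trace d 0 u y) ^+ 2)).
Proof.
move=> hu; have lu := H1_L2 hu.1; have tu := trace_L2 d_gt0 hu; rewrite (energyE h LH hu).
congr (_ + _ * _ + _ * _); first exact: (potential_cos2 mO fO lu.1).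
exact: (potential_cos2 mC fC tu.1).
Qed.

Let energy_gap_alg (Du D0 Au A0 Bu S0 Vu V0 Wu W0 c : R) :
  h ^+ 2 * Au + LH * c * Bu <= Du -> D0 - h ^+ 2 * A0 - LH * S0 = 0 ->
  h ^+ 2 / 2 * (Au - A0 + (Vu - V0)) + LH / 2 * (c * Bu - S0 + (Wu - W0)) <=
  (2^-1 * Du + h ^+ 2 / 4 * (2 * Vu) + LH / 4 * (2 * Wu)) -
  (2^-1 * D0 + h ^+ 2 / 4 * (2 * V0) + LH / 4 * (2 * W0)).
Proof. by move: (h ^+ 2) => k J W; lra. Qed.

(** Jacobi's inequality bounds the gradient part of the energy of u from below,
    and the equation tested with the profile itself gives that of the profile;
    what is left is the integral of pointwise gaps. *)
Lemma energy_gap u : H1P d u ->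
  h ^+ 2 / 2 * \int[vol]_(x in Omega d) gap (f x.2) (u x) +
  LH / 2 * \int[area]_(y in cell) gap (f 0) (trace d 0 u y) <= energy d h LH u - energy d h LH u0.
Proof.
move=> hu; have lu := H1_L2 hu.1; have tu := trace_L2 d_gt0 hu.
have l0 := H1_L2 hu0.1; have t0 := trace_L2 d_gt0 hu0.
have J := profile_Jacobi hu.
have kE : \int[vol]_(x in Omega d) (kappa x.2 * u x * u x) =
    h ^+ 2 * \int[vol]_(x in Omega d) (secant (f x.2) * u x * u x).
  rewrite -(RintegralZl _ mO (L2_mul mO (L2_secant lu) lu)).
  by apply: eq_Rintegral => x _; rewrite /kappa !mulrA.
rewrite kE in J; rewrite (energy_cos2 hu) (energy_cos2 hu0) (volume_gap hu).2 (surface_gap hu).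
exact: energy_gap_alg J (profile_weak_form hu0).
Qed.

Lemma profile_minimizes u : H1P d u -> energy d h LH u0 <= energy d h LH u.
Proof.
move=> hu; rewrite -subr_ge0; apply: le_trans (energy_gap hu).
apply: addr_ge0; apply: mulr_ge0.
- by rewrite divr_ge0// sqr_ge0.
- by apply: Rintegral_ge0 => x Ox; apply: gap_ge0; exact: f_in_Omega.
- by rewrite divr_ge0// ltW.
- by apply: Rintegral_ge0 => y _; exact: gap_ge0.
Qed.

Lemma minimizer_abs u : H1P d u -> energy d h LH u <= energy d h LH u0 ->
  ae_eq vol (Omega d) (fun x => `|u x|) u0.
Proof.
move=> hu; rewrite -subr_le0 => /(le_trans (energy_gap hu)) G.
have B0 : 0 <= \int[area]_(y in cell) gap (f 0) (trace d 0 u y).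
  by apply: Rintegral_ge0 => y _; exact: gap_ge0.
have V0 : \int[vol]_(x in Omega d) gap (f x.2) (u x) <= 0.
  have h2 : 0 < h ^+ 2 / 2 by rewrite divr_gt0// exprn_gt0.
  rewrite -(pmulr_rle0 _ h2); apply: le_trans G; rewrite lerDl mulr_ge0//.
  by rewrite divr_ge0// ltW.
have := Rintegral_ge0_eq0 mO (volume_gap hu).1 (fun x Ox => gap_ge0 (u x) (f_in_Omega Ox)) V0.
apply: (@filterS _ _ (ae_filter_ringOfSetsType vol)) => x xE Dx.
exact: gap_eq0 (f_in_Omega Dx) (xE Dx).
Qed.

Lemma profile_positive : positive_least_energy_solution d h LH u0.
Proof.
split; first by split; [exact: profile_SG|exact: profile_minimizes].
exists u0; split => //.
- by apply: continuous_subspaceT; exact: continuous_x3.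
- exact: aeW.
- by move=> x; exact: f_gt0.
Qed.

(** A minimizer has zero gap almost everywhere, hence the absolute value of the
    profile, and positivity fixes its sign. *)
Lemma positive_unique u : positive_least_energy_solution d h LH u -> eq_Omega d u u0.
Proof.
move=> [[[hu _] mu] [v [_ _ uv v0]]].
have := minimizer_abs hu (mu _ hu0); move: uv.
apply: (@filterS2 _ _ (ae_filter_ringOfSetsType vol)) => x uv ux Dx.
rewrite -(ux Dx) (uv Dx) gtr0_norm// v0//.
by have /andP[/ltW -> ->] := Omega_x3 Dx.
Qed.

End deep.

Theorem theorem1p2 (R : realType) (d h LH : R)
    (d_gt0 : 0 < d) (h_gt0 : 0 < h) (LH_gt0 : 0 < LH) :
  [/\ d <= critical_depth h LH ->
        critical_point d h LH (fun=> 0) /\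
        (forall phi, critical_point d h LH phi -> eq_Omega d phi (fun=> 0)),
      critical_depth h LH < d ->
        exists phi, positive_least_energy_solution d h LH phi /\
          forall psi, positive_least_energy_solution d h LH psi ->
            eq_Omega d psi phi
    & critical_depth h LH < d ->
        forall phi, positive_least_energy_solution d h LH phi ->
          depends_only_on_x3 d phi].
Proof.
split=> dc.
- split; first exact: trivial_critical.
  by move=> phi; exact: shallow_unique.
- have [f [f' [df cf' df' [fd f'0 fI fpos]]]] := vertical_profile h_gt0 LH_gt0 dc.
  exists (fun x => f x.2); split; first exact: (profile_positive d_gt0 h_gt0 LH_gt0 df cf' df' fd f'0 fI fpos).
  by move=> psi; exact: (positive_unique d_gt0 h_gt0 LH_gt0 df cf' df' fd f'0 fI fpos).
- have [f [f' [df cf' df' [fd f'0 fI fpos]]]] := vertical_profile h_gt0 LH_gt0 dc.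
  move=> phi hphi; exists f.
  exact: (positive_unique d_gt0 h_gt0 LH_gt0 df cf' df' fd f'0 fI fpos hphi).
Qed.
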